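(* Let $O\subset\mathbb{R}^3$ be a bounded open set with smooth boundary, let $K$ be a compact semisimple matrix group with Lie algebra $\mathfrak{k}$, let $P=\bar O\times K\to\bar O$ be the trivial bundle with the flat connection $\nabla_0$ as base connection, and let $k$ be an integer with $k>3/2+1$. Let $F$ be a smooth $\mathfrak{k}$-valued function on $\partial O$. Then there exists $f\in[\mathcal{L}_0\cap C^\infty,\mathcal{L}_0\cap C^\infty]$ with $T_0(f)=F$; that is, there exist finitely many smooth $g_i,h_i\in\mathcal{L}_0$ such that on $\partial O$ $$d\Big(\Delta\Big(\sum_i[g_i,h_i]\Big)\Big)(\nu)+2\tau\,\Delta\Big(\sum_i[g_i,h_i]\Big)=F.$$
   Context: Sections of $\mathfrak{k}_P$ are $\mathfrak{k}$-valued functions on $\bar O$; brackets of functions are pointwise; smooth means smooth up to the boundary. $d$ is the exterior derivative, $d^*$ its formal adjoint for the Euclidean metric, $\Delta=d^*d=-\sum_i\partial_i^2$ on functions, and $G=\Delta^{-1}$ is the Green operator with zero Dirichlet boundary values. $H_0=\{\alpha\ \mathfrak{k}\text{-valued 1-form of Sobolev class }H^k\text{ on }\bar O:\ \iota^*\alpha=0,\ d^*\alpha=0\}$, where $\iota:\partial O\to\bar O$ is the inclusion. For $\alpha=\sum\alpha_idx_i,\beta=\sum\beta_idx_i$ in Euclidean coordinates, $[\alpha\cdot\beta]=\sum_i[\alpha_i,\beta_i]$. $\mathcal{L}_0=\mathrm{Span}\{-2G([\alpha\cdot\beta]):\alpha,\beta\in H_0\}$ is the span of the image of the curvature of the Coulomb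 connection at $\nabla_0$. $[\mathcal{L}_0\cap C^\infty,\mathcal{L}_0\cap C^\infty]$ is the linear span of pointwise brackets of pairs of elements of $\mathcal{L}_0\cap C^\infty$. $T_0(f)=\big(d(\Delta f)(\nu)+2\tau\Delta f\big)|_{\partial O}$, where $\nu$ is the inward unit normal and $\tau:\partial O\to\mathbb{R}$ is $\tau=\frac1a\frac{\partial a}{\partial x_3}$, $a=\sqrt{\det(g_{ij})}$, in any boundary coordinates $(x_1,x_2,x_3)$ (with $x_3\ge0$ and $\partial O=\{x_3=0\}$) such that $\partial/\partial x_3$ is orthogonal to $\partial/\partial x_1,\partial/\partial x_2$ on $\partial O$, has norm $1$ everywhere, and is the inward normal on $\partial O$ (independent of the choice). *)

(* Defs.v *)
From HB Require Import structures.
From mathcomp Require Import all_boot all_order all_algebra.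
From mathcomp Require Import all_classical all_reals all_analysis.

Set Implicit Arguments.
Unset Strict Implicit.
Unset Printing Implicit Defensive.

Import Order.TTheory GRing.Theory Num.Theory.
Import numFieldNormedType.Exports.

Local Open Scope classical_set_scope.
Local Open Scope ring_scope.

(* Euclidean space is 'rV[R]_3, and x_1, x_2, x_3 are the coordinates 0, 1, 2.
   The library norm on 'rV[R]_3 is the sup norm; only its topology and
   bornology are used, the Euclidean metric is [dot].
   A function on a subset A of R^3 is represented by a function on R^3 whose
   values off A are irrelevant. *)

Section LinearSpan.
Context (R : realType) (V : lmodType R).

Definition lin_span (A : set V) : set V :=
  [set v | exists m (c : 'I_m -> R) (a : 'I_m -> V),
     (forall i, A (a i)) /\ v = \sum_(i < m) c i *: a i].

End LinearSpan.

Section MatrixGroups.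
Context (R : realType) (n : nat).
Implicit Types (K I : set 'M[R]_n.+1) (A B : 'M[R]_n.+1).

(* Real matrices also cover complex matrix groups, through the realification
   M_n(C) -> M_2n(R). *)
Definition matrix_group K : Prop :=
  [/\ K `<=` [set A | A \in unitmx], K 1%:M,
      (forall A B, K A -> K B -> K (A *m B))
    & (forall A, K A -> K (invmx A))].

Definition expmx A : 'M[R]_n.+1 :=
  lim (series (fun i => (i`!%:R)^-1 *: A ^+ i) @ \oo).

Definition lie_algebra K : set 'M[R]_n.+1 :=
  [set A | forall t : R, K (expmx (t *: A))].

Definition lieb A B : 'M[R]_n.+1 := A *m B - B *m A.

Definition lie_ideal (k I : set 'M[R]_n.+1) : Prop :=
  [/\ I `<=` k, lin_span I `<=` I & forall A B, k A -> I B -> I (lieb A B)].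

Definition derived I : set 'M[R]_n.+1 :=
  lin_span [set C | exists A B, [/\ I A, I B & C = lieb A B]].

Definition solvable_lie I : Prop := exists m, iter m derived I `<=` [set 0].

Definition semisimple_lie (k : set 'M[R]_n.+1) : Prop :=
  forall I, lie_ideal k I -> solvable_lie I -> I `<=` [set 0].

End MatrixGroups.

Section Calculus.
Context (R : realType) (V : normedModType R).
Local Notation E := 'rV[R]_3.
Implicit Types (f : E -> V) (U A : set E).

Definition partial (i : 'I_3) f : E -> V := fun x => 'D_(delta_mx 0 i) f x.

Definition partials (s : seq 'I_3) f : E -> V := foldr partial f s.

Definition C_ (m : nat) U f : Prop :=
  forall s : seq 'I_3, (size s <= m)%N ->
    (forall x, U x -> {for x, continuous (partials s f)}) /\
    ((size s < m)%N ->
       forall i x, U x -> derivable (partials s f) x (delta_mx 0 i)).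

Definition smooth U f : Prop := forall m, C_ m U f.

(* Smoothness on an arbitrary subset by local smooth extension; on the closure
   of a domain this is smoothness up to the boundary. *)
Definition smooth_on A f : Prop :=
  forall p, A p -> exists U (g : E -> V),
    [/\ open U, U p, smooth U g & forall x, U x -> A x -> f x = g x].

(* Positive sign convention: [laplace] is d^* d. *)
Definition laplace f : E -> V :=
  fun x => - \sum_(i < 3) partial i (partial i f) x.

End Calculus.

Section Sobolev.
Context (R : realType).
Local Notation E := 'rV[R]_3.
Local Notation mu3 :=
  ((lebesgue_measure \x lebesgue_measure) \x lebesgue_measure)%E.
Implicit Types (O : set E) (u v : E -> R).

(* Lebesgue measure lives on R * R * R; [pt] identifies that type with E. *)
Definition pt (x : R * R * R) : E := \row_(i < 3) [:: x.1.1; x.1.2; x.2]`_i.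

Definition integral3 O u : R := Rintegral mu3 (pt @^-1` O) (u \o pt).

Definition L2 O u : Prop :=
  measurable_fun (pt @^-1` O) (u \o pt) /\
  mu3.-integrable (pt @^-1` O) (fun x => ((u (pt x)) ^+ 2)%:E).

Definition test_function O u : Prop :=
  smooth setT u /\
  exists2 C, compact C /\ C `<=` O & forall x, ~ C x -> u x = 0.

Definition weak_partials O (s : seq 'I_3) u v : Prop :=
  forall phi, test_function O phi ->
    integral3 O (fun x => u x * partials s phi x) =
    (-1) ^+ size s * integral3 O (fun x => v x * phi x).

Definition sobolev O (k : nat) u : Prop :=
  L2 O u /\ forall s : seq 'I_3, (size s <= k)%N ->
    exists v, L2 O v /\ weak_partials O s u v.

End Sobolev.

Section Domain.
Context (R : realType).
Local Notation E := 'rV[R]_3.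
Implicit Types (O W : set E) (phi psi : E -> E) (p v w : E).

Definition dot v w : R := \sum_(i < 3) v 0 i * w 0 i.

Definition bdry O : set E := closure O `\` O°.

(* phi parametrizes a neighbourhood of a piece of the boundary by coordinates
   ranging over W, and psi is the inverse coordinate map. *)
Definition boundary_chart O W phi psi : Prop :=
  [/\ [/\ open W & open (phi @` W)],
      [/\ smooth W phi & smooth (phi @` W) psi],
      (forall x, W x -> psi (phi x) = x)
    & forall x, W x ->
        (O (phi x) <-> 0 < x 0 2) /\ (bdry O (phi x) <-> x 0 2 = 0)].

Definition smooth_boundary O : Prop :=
  forall p, bdry O p ->
    exists W phi psi, boundary_chart O W phi psi /\ (phi @` W) p.

Definition tangent O p v : Prop :=
  exists W phi psi x (c1 c2 : R),
    [/\ boundary_chart O W phi psi, W x, phi x = p, bdry O p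
      & v = c1 *: partial 0 phi x + c2 *: partial 1 phi x].

Definition inward_normal O p v : Prop :=
  [/\ dot v v = 1, (forall w, tangent O p w -> dot v w = 0)
    & \forall t \near (0 : R)^'+, O (p + t *: v)].

Definition metric phi (x : E) : 'M[R]_3 :=
  \matrix_(i, j) dot (partial i phi x) (partial j phi x).

Definition volume_density phi (x : E) : R := Num.sqrt (\det (metric phi x)).

Definition adapted_chart O W phi psi : Prop :=
  [/\ boundary_chart O W phi psi,
      (forall x, W x -> x 0 2 = 0 ->
         metric phi x 2 0 = 0 /\ metric phi x 2 1 = 0),
      (forall x, W x -> 0 <= x 0 2 -> metric phi x 2 2 = 1)
    & forall x, W x -> x 0 2 = 0 ->
        inward_normal O (phi x) (partial 2 phi x)].

(* All adapted charts through a boundary point give the same value, namely the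
   divergence along the boundary of the inward unit normal. *)
Definition is_tau O (tau : E -> R) : Prop :=
  forall W phi psi x, adapted_chart O W phi psi -> W x -> x 0 2 = 0 ->
    tau (phi x) =
    (volume_density phi x)^-1 * partial 2 (volume_density phi) x.

End Domain.

Section CoulombConnection.
Context (R : realType) (n : nat).
Local Notation E := 'rV[R]_3.
Local Notation M := 'M[R]_n.+1.
Implicit Types (O : set E) (k : set M) (f u w : E -> M) (a b : 'I_3 -> E -> M).

(* A 1-form sum_i a_i dx_i is the family of its components a_i. *)

Definition sections O k : set (E -> M) :=
  [set f | forall x, closure O x -> k (f x)].

Definition codiff a : E -> M := fun x => - \sum_(i < 3) partial i (a i) x.

Definition bracket_dot a b : E -> M :=
  fun x => \sum_(i < 3) lieb (a i x) (b i x).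

(* For s > 3/2 + 1 a 1-form of class H^s has a unique continuous representative
   on the closure of O, which is C^1; it is the one used here, so the boundary
   condition and the codifferential are pointwise. *)
Definition H0 O k (s : nat) : set ('I_3 -> E -> M) :=
  [set a | [/\ (forall i, sections O k (a i)),
     (forall i, {within closure O, continuous (a i)}),
     (forall i r c, sobolev O s (fun x => a i x r c)),
     (forall p v, tangent O p v -> \sum_(i < 3) v 0 i *: a i p = 0)
   & (forall x, O x -> codiff a x = 0)]].

(* Graph of the Dirichlet Green operator: w = G u on the closure of O.  Such a
   w is unique there by the maximum principle. *)
Definition green O u w : Prop :=
  [/\ {within closure O, continuous w}, C_ 2 O w,
      (forall x, O x -> laplace w x = u x)
    & (forall x, bdry O x -> w x = 0)].

Definition L0 O k (s : nat) : set (E -> M) :=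
  lin_span [set u | exists a b w,
    [/\ H0 O k s a, H0 O k s b, sections O k w, green O (bracket_dot a b) w
      & forall x, closure O x -> u x = (-2) *: w x]].

Definition pointwise_brackets (A : set (E -> M)) : set (E -> M) :=
  lin_span [set f | exists g h, [/\ A g, A h & f = fun x => lieb (g x) (h x)]].

(* Boundary value of a function on O as a limit from inside O.  If f is smooth
   up to the boundary, these are the values on the boundary of the
   derivatives of f. *)
Definition boundary_value O f : E -> M := fun p => lim (f @ within O (nbhs p)).

Definition T0 O (nu : E -> E) (tau : E -> R) f : E -> M := fun p =>
  boundary_value O (fun x => 'D_(nu p) (laplace f) x) p +
  (2 * tau p) *: boundary_value O (laplace f) p.

End CoulombConnection.

(* Main.v *)
(** Green's operator is only needed on functions known to be Laplacians, so no
    elliptic theory enters.  If p, q, f satisfy the Neumann condition, the cross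
    products of their gradients are Coulomb fields in H_0, and with B = grad p x grad q,
    A1 = grad (p f) x grad q, A2 = grad f x grad q, B1 = grad (p^2/2) x grad q one has
    A1.B - A2.B1 = f |B|^2.  Hence w [a, b] lies in L_0 whenever w vanishes on the
    boundary and laplace w = f |B|^2 with f Neumann.
    Near a boundary point let S be a defining function and B a nowhere vanishing field
    as above.  For w = S theta or w = S^2 theta' the quotient laplace w / |B|^2 becomes
    Neumann after adding a term c S^3.  The bracket of two such elements is, up to higher
    order, S^3 theta theta' [[a, b], [a', b']]: its Laplacian vanishes on the boundary, so
    tau plays no role, and the normal derivative of its Laplacian is
    -6 theta theta' |grad S|^3 [[a, b], [a', b']].  Since k is perfect, double commutators span k,
    and a partition of unity on the compact boundary concludes.

    For perfectness, X in k with tr (X^2) = 0 is zero because the one-parameter group of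
    X is bounded; so the trace form is nondegenerate on k, the orthogonal of [k, k] is
    an abelian ideal, and it vanishes by semisimplicity. *)

From HB Require Import structures.
Require Import Defs.
From mathcomp Require Import all_boot all_order all_algebra.
From mathcomp Require Import all_classical all_reals all_analysis.
From mathcomp Require Import measurable_realfun.
From mathcomp Require Import spectral mxred.
From mathcomp.real_closed Require Import complex.
From mathcomp Require Import ring lra.

Set Implicit Arguments.
Unset Strict Implicit.
Unset Printing Implicit Defensive.

Import Order.TTheory GRing.Theory Num.Theory.
Import numFieldNormedType.Exports.

Local Open Scope classical_set_scope.
Local Open Scope ring_scope.

(** * Calculus of smooth functions on R^3 *)

(** The gradients of Neumann functions are tangent to the boundary, so their cross product is normal
    there; it is divergence-free, being dual to dp ^ dq. Both conditions in H_0 thus hold with no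
    equation to solve. Two elements a, b of k enter, in A1 a + A2 b against B1 a + B b, because
    [a, a] = [b, b] = 0 leaves only the antisymmetric combination of the coefficients; since A1 = f
    B + p A2 and B1 = p B, the terms p A2.B cancel and f stays free.

    The price is the Neumann condition on f, a third-order condition on w at the boundary. Order
    three is where a multiple of S^3 first acts, so the term c S^3 repairs it and leaves the
    boundary 2-jet of w alone. The product of the two factors is made to vanish to the same order
    three: the normal derivative of its Laplacian then involves only the value of the coefficient of
    S^3 on the boundary, no derivative of it and no curvature, so the data are prescribed by a mere
    division.

    Each factor in L_0 already carries a commutator, hence the double commutators. Cutoffs keep
    every function smooth on all of R^3, from which Sobolev regularity and smoothness up to the
    boundary follow. *)

Section SmoothCalculus.
Context (R : realType).
Local Notation E := 'rV[R]_3.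

Section General.
Context (V : normedModType R).
Implicit Types (f g : E -> V) (U : set E).

Lemma C_0P U f : C_ 0 U f <-> forall x, U x -> {for x, continuous f}.
Proof.
split=> [H|H [|//] _]; first by have [] := H [::] isT.
by split.
Qed.

Lemma partials_rcons s i f : partials (rcons s i) f = partials s (partial i f).
Proof. by rewrite /partials foldr_rcons. Qed.

(** Words of derivatives are peeled at their last letter, the derivative applied first. This makes
    induction on [m], with the function generalised, available for every closure property below. *)
Lemma C_SP m U f : C_ m.+1 U f <->
  [/\ forall x, U x -> {for x, continuous f},
      forall i x, U x -> derivable f x (delta_mx 0 i)
    & forall i, C_ m U (partial i f)].
Proof.
split=> [H|[H1 H2 H3] s].
  split; first by have [] := H [::] isT.
    by move=> i x Ux; have [_ /(_ isT)] := H [::] isT; exact.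
  move=> i s sm; have [|H1 H2] := H (rcons s i); first by rewrite size_rcons.
  rewrite partials_rcons in H1 H2; split => // sm'; apply: H2.
  by rewrite size_rcons.
case: (lastP s) => [_|{}s i]; first by split.
rewrite size_rcons partials_rcons => sm; have [H4 H5] := H3 i s sm; split=> //.
Qed.

Lemma eq_on_open U f g x : open U -> (forall x, U x -> f x = g x) -> U x ->
  {near x, f =1 g}.
Proof.
move=> oU fg Ux; have : nbhs x U by exact: open_nbhs_nbhs.
by apply: filterS => y; exact: fg.
Qed.

Lemma C_ext m U f g : open U -> (forall x, U x -> f x = g x) ->
  C_ m U f -> C_ m U g.
Proof.
move=> oU; elim: m f g => [|m IH] f g fg.
  rewrite !C_0P => H x Ux; rewrite /prop_for /continuous_at -(fg _ Ux).
  by apply: cvg_trans (H _ Ux); exact: (near_eq_cvg (eq_on_open oU fg Ux)).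
rewrite !C_SP => -[H1 H2 H3]; split.
- move=> x Ux; rewrite /prop_for /continuous_at -(fg _ Ux).
  by apply: cvg_trans (H1 _ Ux); exact: (near_eq_cvg (eq_on_open oU fg Ux)).
- move=> i x Ux; apply: near_eq_derivable (H2 i x Ux); exact: (eq_on_open oU fg Ux).
- by move=> i; apply: IH (H3 i) => x Ux; apply: near_eq_derive; exact: (eq_on_open oU fg Ux).
Qed.

Lemma C_sub m U W f : W `<=` U -> C_ m U f -> C_ m W f.
Proof.
move=> WU H s sm; have [H1 H2] := H s sm; split; first by move=> x /WU; exact: H1.
by move=> sm' i x /WU; exact: H2.
Qed.

Lemma C_cover m U f : (forall x, U x -> exists2 W, W x & C_ m W f) -> C_ m U f.
Proof.
move=> H s sm; split=> [x Ux|sm' i x Ux].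
  by have [W Wx /(_ s sm)[H1 _]] := H x Ux; exact: H1.
by have [W Wx /(_ s sm)[_ H1]] := H x Ux; exact: H1.
Qed.

Lemma C_lower m U f : C_ m.+1 U f -> C_ m U f.
Proof.
move=> H s sm; have [H1 H2] := H s (leqW sm); split=> // sm'.
by apply: H2; apply: leq_trans sm' _.
Qed.

Lemma smooth_partial U f i : smooth U f -> smooth U (partial i f).
Proof. by move=> H m; have /C_SP[_ _] := H m.+1; exact. Qed.

Lemma smooth_continuous U f x : smooth U f -> U x -> {for x, continuous f}.
Proof. by move=> /(_ 0%N)/C_0P; exact. Qed.

Lemma smooth_derivable U f x i : smooth U f -> U x ->
  derivable f x (delta_mx 0 i).
Proof. by move=> /(_ 1%N)/C_SP[_ + _]; exact. Qed.

Lemma smooth_ext U f g : open U -> (forall x, U x -> f x = g x) ->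
  smooth U f -> smooth U g.
Proof. by move=> oU fg H m; exact: C_ext (H m). Qed.

Lemma smooth_cover U f : (forall x, U x -> exists2 W, W x & smooth W f) ->
  smooth U f.
Proof. by move=> H m; apply: C_cover => x /H[W Wx H']; exists W. Qed.

Lemma smooth_sub U W f : W `<=` U -> smooth U f -> smooth W f.
Proof. by move=> WU H m; exact: C_sub (H m). Qed.

Lemma partial_cst i (c : V) : partial i (fun=> c) = fun=> 0.
Proof. by apply/funext => x; rewrite /partial derive_cst. Qed.

Lemma C_cst m U (c : V) : C_ m U (fun=> c).
Proof.
elim: m c => [|m IH] c; first by apply/C_0P => x _; apply: cst_continuous.
apply/C_SP; split=> [x _|i x _|i]; first by apply: cst_continuous.
  by apply: derivable_cst.
by rewrite partial_cst.
Qed.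

Lemma C_add m U f g : open U -> C_ m U f -> C_ m U g ->
  C_ m U (fun x => f x + g x).
Proof.
move=> oU; elim: m f g => [|m IH] f g.
  rewrite !C_0P => H1 H2 x Ux; apply: continuousD; [exact: H1|exact: H2].
move=> /C_SP[H1 H2 H3] /C_SP[H4 H5 H6]; apply/C_SP; split=> [x Ux|i x Ux|i].
- by apply: continuousD; [exact: H1|exact: H4].
- by apply: derivableD; [exact: H2|exact: H5].
apply: C_ext (IH _ _ (H3 i) (H6 i)) => // x Ux.
by rewrite /partial -deriveD; [|exact: H2|exact: H5].
Qed.

End General.

Section Scalar.
Implicit Types (f g : E -> R) (U : set E).

Lemma C_scale (V : normedModType R) m U f (c : V) : open U -> C_ m U f ->
  C_ m U (fun x => f x *: c).
Proof.
move=> oU; elim: m f => [|m IH] f.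
  rewrite !C_0P => H1 x Ux; apply: continuousZl; exact: H1.
have aux x v : derivable f x v -> is_derive x v (fun x => f x *: c) ('D_v f x *: c).
  move=> df.
  have H : (fun h => h^-1 *: (f (h *: v + x) *: c - f x *: c)) @ 0^' --> 'D_v f x *: c.
    rewrite (_ : (fun h => _) =
      (fun h => (h^-1 *: (f (h *: v + x) - f x)) *: c)); last first.
      by apply/funext => h; rewrite -scalerBl scalerA.
    by apply: cvgZr_tmp; exact: df.
  split; first by apply/cvg_ex; exists ('D_v f x *: c).
  exact/cvg_lim.
move=> /C_SP[H1 H2 H3]; apply/C_SP; split=> [x Ux|i x Ux|i].
- apply: continuousZl; exact: H1.
- by have [] := aux x (delta_mx 0 i) (H2 i x Ux).
apply: C_ext (IH _ (H3 i)) => // x Ux.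
by have [_ <-] := aux x (delta_mx 0 i) (H2 i x Ux).
Qed.

Lemma C_mul m U f g : open U -> C_ m U f -> C_ m U g ->
  C_ m U (fun x => f x * g x).
Proof.
move=> oU; elim: m f g => [|m IH] f g.
  rewrite !C_0P => H1 H2 x Ux; apply: continuousM; [exact: H1|exact: H2].
move=> Cf Cg; have := Cf; have := Cg.
move=> /C_SP[H4 H5 H6] /C_SP[H1 H2 H3]; apply/C_SP; split=> [x Ux|i x Ux|i].
- by apply: continuousM; [exact: H1|exact: H4].
- by apply: derivableM; [exact: H2|exact: H5].
apply: (C_ext (f := (fun x => partial i f x * g x + f x * partial i g x)) oU).
  move=> x Ux; rewrite /partial deriveM; [|exact: H2|exact: H5].
  by rewrite addrC /GRing.scale /= [in X in _ + X]mulrC.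
exact: (C_add oU (IH _ _ (H3 i) (C_lower Cg)) (IH _ _ (C_lower Cf) (H6 i))).
Qed.

End Scalar.
End SmoothCalculus.

(** * Composition with one-variable functions: flat functions, inverse, square root *)

Section Composition.
Context (R : realType).
Local Notation E := 'rV[R]_3.

(** Restriction to the line through [x] in direction [v] reduces this to the one-variable chain
    rule; [g] is only assumed to have a derivative in that direction. *)
Lemma is_derive_comp1 (V : normedModType R) (h : R -> R) (g : V -> R) x v dg dh :
  is_derive x v g dg -> is_derive (g x) 1 h dh ->
  is_derive x v (h \o g) (dh * dg).
Proof.
move=> [g1 g2] Hh.
have Hg0 : is_derive (0 : R) 1 (fun t : R => g (t *: v + x)) dg.
  split; first exact: (derivable1P _ _ _).1 g1.
  rewrite -g2 /derive; congr (lim _).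
  apply: (f_equal (fun F => F @ 0^')); apply/funext => t /=.
  by rewrite [_%:A]mulr1 !addr0 scale0r add0r.
have Hh0 : is_derive (g (0 *: v + x)) 1 h dh by rewrite scale0r add0r.
have [H1 H2] : is_derive (0 : R) 1 (h \o (fun t : R => g (t *: v + x))) (dh * dg).
  exact: is_derive1_comp.
split; first exact: (derivable1P _ _ _).2 H1.
rewrite -H2 /derive; congr (lim _).
apply: (f_equal (fun F => F @ 0^')); apply/funext => t /=.
by rewrite [_%:A]mulr1 !addr0 scale0r add0r.
Qed.

Section Flat.

(* [flat k x] is x^-k exp(-1/x) for x > 0: this family is stable under derivation. *)
Definition flat k (x : R) : R := if 0 < x then x ^- k * expR (- x^-1) else 0.

(** From exp(1/x) >= x^-(k+2) / (k+2)!. The power 2 on the right makes the difference quotient at 0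
    of order h, so the derivative there is 0. *)
Lemma flat_bound k x : 0 < x -> flat k x <= (k.+2)`!%:R * x ^+ 2.
Proof.
move=> x0; rewrite /flat x0 expRN.
have xi0 : 0 < x^-1 by rewrite invr_gt0.
have H : x^-1 ^+ k.+2 / k.+2`!%:R <= expR x^-1.
  by apply: le_trans (expR_ge1Dxn k.+1 (ltW xi0)); rewrite lerDr.
have f0 : 0 < k.+2`!%:R :> R by rewrite ltr0n fact_gt0.
have p0 : 0 < x^-1 ^+ k.+2 / k.+2`!%:R by rewrite divr_gt0 // exprn_gt0.
have: (expR x^-1)^-1 <= (x^-1 ^+ k.+2 / k.+2`!%:R)^-1.
  by rewrite lef_pV2 // posrE // expR_gt0.
move=> H2; apply: le_trans (ler_wpM2l _ H2) _.
  by rewrite invr_ge0 exprn_ge0 // ltW.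
rewrite invfM invrK exprVn invrK; set c : R := _`!%:R.
have -> : x ^+ k.+2 = x ^+ k * x ^+ 2 by rewrite -exprD addn2.
set a := x ^+ k; set b := x ^+ 2.
have a0 : a != 0 by rewrite expf_neq0 // gt_eqF.
by rewrite [leLHS](_ : _ = c * b) //; field.
Qed.

Lemma flat_ge0 k x : 0 <= flat k x.
Proof.
rewrite /flat; case: ltP => // x0; rewrite mulr_ge0 ?expR_ge0 //.
by rewrite invr_ge0 exprn_ge0 // ltW.
Qed.

Lemma flat_gt0 k x : 0 < x -> 0 < flat k x.
Proof.
by move=> x0; rewrite /flat x0 mulr_gt0 ?expR_gt0 // invr_gt0 exprn_gt0.
Qed.

Lemma is_derive_flat k (x : R) :
  is_derive x 1 (flat k) (flat k.+2 x - k%:R * flat k.+1 x).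
Proof.
case: (ltgtP x 0) => x0.
- rewrite {2 3}/flat ltNge (ltW x0) /= mulr0 subr0.
  apply: (@near_eq_is_derive _ _ _ (cst 0 : R -> R)).
    near=> y; rewrite /flat /= ltNge ltW //=.
    by near: y; exact: lt_nbhsl.
- have xn0 : x != 0 by rewrite gt_eqF.
  apply: (@near_eq_is_derive _ _ _ (fun y : R => (y ^+ k)^-1 * expR (- y^-1) : R)).
    near=> y; rewrite /flat /= ifT //.
    by near: y; exact: lt_nbhsr.
  have d1 : is_derive x 1 (fun y : R => y ^+ k) (k%:R * x ^+ k.-1).
    by split; [exact: exprn_derivable | rewrite exp_derive /GRing.scale /= mulr1].
  have d2 : is_derive x 1 (fun y : R => (y ^+ k)^-1) (- (x ^+ k) ^- 2 * (k%:R * x ^+ k.-1)).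
    case: d1 => a b; split; first by apply: derivableV => //; rewrite expf_neq0.
    by rewrite deriveV ?expf_neq0 // b.
  have d3 : is_derive x 1 (fun y : R => - y^-1) (x ^- 2).
    by apply: (is_derive_eq (is_deriveN (is_deriveV xn0 (is_derive_id x 1)))); rewrite /GRing.scale /= mulr1 opprK.
  have d4 : is_derive x 1 (fun y : R => expR (- y^-1)) (expR (- x^-1) * x ^- 2).
    by apply: (@is_derive_comp1 _ expR (fun y : R => - y^-1)).
  apply: (is_derive_eq (is_deriveM d2 d4)); rewrite /GRing.scale /= /flat x0.
  case: k {d1 d2} => [|k]; first by rewrite !mul0r mulr0 !expr0 invr1; field.
  by rewrite /= !exprS; field; rewrite expf_neq0.
rewrite x0 {2 3}/flat ltxx mulr0 subr0.
pose C := (k.+2)`!%:R : R.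
have C0 : 0 < C by rewrite /C ltr0n fact_gt0.
have H : (fun h => h^-1 *: ((flat k \o shift (0:R)) (h *: (1:R)) - flat k 0)) @ 0^' --> (0:R).
  apply/cvgrPdist_le => e e0; near=> h.
  rewrite /= {2}/flat ltxx subr0 sub0r normrN addr0 [_%:A]mulr1 normrZ normfV.
  have h0 : 0 < `|h| by rewrite normr_gt0; near: h; exact: nbhs_dnbhs_neq.
  rewrite ler_pdivrMl //.
  have [hn|hp] := leP h 0; first by rewrite /flat ltNge hn /= normr0 mulr_ge0 // ltW.
  rewrite (ger0_norm (flat_ge0 _ _)); apply: le_trans (flat_bound _ hp) _.
  rewrite -/C expr2 mulrA [_ * h]mulrC gtr0_norm // ler_pM2l //.
  rewrite mulrC -ler_pdivlMr //; apply: le_trans (ler_norm _) _.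
  apply: ltW; near: h; apply: dnbhs0_lt; by rewrite divr_gt0.
split; first by apply/cvg_ex; exists 0.
exact/cvg_lim.
Unshelve. all: by end_near. Qed.

End Flat.

(** The index [k] varies in the induction, since differentiating [flat k] produces [flat k.+1] and
    [flat k.+2]. *)
Lemma C_comp_flat m k U (f : E -> R) : open U -> C_ m U f ->
  C_ m U (fun x => flat k (f x)).
Proof.
move=> oU; elim: m k f => [|m IH] k f.
  move=> /C_0P H; apply/C_0P => x Ux; apply: continuous_comp; first exact: H.
  apply: differentiable_continuous; apply/derivable1_diffP.
  by have [] := is_derive_flat k (f x).
move=> Cf; have /C_SP[H1 H2 H3] := Cf.
have D i x : U x -> is_derive x (delta_mx 0 i) (fun y => flat k (f y))
   ((flat k.+2 (f x) - k%:R * flat k.+1 (f x)) * partial i f x).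
  move=> Ux; apply: (@is_derive_comp1 _ (flat k) f); last exact: is_derive_flat.
  by apply: derivableP; exact: H2.
apply/C_SP; split=> [x Ux|i x Ux|i].
- apply: continuous_comp; first exact: H1.
  apply: differentiable_continuous; apply/derivable1_diffP.
  by have [] := is_derive_flat k (f x).
- by have [] := D i x Ux.
apply: (@C_ext R R m U (fun x => (flat k.+2 (f x) + (- k%:R) * flat k.+1 (f x)) * partial i f x) _ oU).
  by move=> x Ux; have [_] := D i x Ux; rewrite /partial => ->; rewrite mulNr.
have Cf' := C_lower Cf.
apply: (C_mul oU _ (H3 i)); apply: (C_add oU (IH k.+2 f Cf')).
apply: (C_mul oU _ (IH k.+1 f Cf')); apply: C_cst.
Qed.

Lemma C_inv m U (f : E -> R) : open U -> (forall x, U x -> f x != 0) ->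
  C_ m U f -> C_ m U (fun x => (f x)^-1).
Proof.
move=> oU f0; elim: m => [|m IH].
  by move=> /C_0P H; apply/C_0P => x Ux; apply: continuousV; [exact: f0|exact: H].
move=> Cf; have /C_SP[H1 H2 H3] := Cf; apply/C_SP; split=> [x Ux|i x Ux|i].
- by apply: continuousV; [exact: f0|exact: H1].
- by apply: derivableV; [exact: f0|exact: H2].
have Ci := IH (C_lower Cf).
apply: (@C_ext R R m U (fun x => (-1) * ((f x)^-1 * (f x)^-1) * partial i f x) _ oU).
  move=> x Ux; rewrite /partial deriveV; [|exact: f0|exact: H2].
  by rewrite /GRing.scale /= expr2 invfM mulN1r.
apply: (C_mul oU _ (H3 i)); apply: (C_mul oU _ (C_mul oU Ci Ci)); apply: C_cst.
Qed.

Lemma C_sqrt m U (f : E -> R) : open U -> (forall x, U x -> 0 < f x) ->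
  C_ m U f -> C_ m U (fun x => Num.sqrt (f x)).
Proof.
move=> oU f0; elim: m => [|m IH].
  move=> /C_0P H; apply/C_0P => x Ux; apply: continuous_comp; first exact: H.
  exact: sqrt_continuous.
move=> Cf; have /C_SP[H1 H2 H3] := Cf.
have D i x : U x -> is_derive x (delta_mx 0 i) (fun y => Num.sqrt (f y))
   ((2 * Num.sqrt (f x))^-1 * partial i f x).
  move=> Ux; apply: (@is_derive_comp1 _ Num.sqrt f).
    by apply: derivableP; exact: H2.
  by apply: is_derive1_sqrt; exact: f0.
apply/C_SP; split=> [x Ux|i x Ux|i].
- apply: continuous_comp; first exact: H1.
  exact: sqrt_continuous.
- by have [] := D i x Ux.
apply: (@C_ext R R m U (fun x => (2 * Num.sqrt (f x))^-1 * partial i f x) _ oU).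
  by move=> x Ux; have [_] := D i x Ux; rewrite /partial => ->.
apply: (C_mul oU _ (H3 i)); apply: (C_inv oU).
  by move=> x Ux; rewrite mulf_neq0 ?pnatr_eq0 // gt_eqF // sqrtr_gt0 f0.
apply: (C_mul oU _ (IH (C_lower Cf))); apply: C_cst.
Qed.

End Composition.

(** * Differentiability from continuous partial derivatives, and symmetry of second derivatives *)

Section Differentiability.
Context (R : realType).
Local Notation E := 'rV[R]_3.
Implicit Types (f g : E -> R) (x v : E).

Lemma I3_ind (P : 'I_3 -> Prop) : P 0 -> P 1 -> P 2 -> forall i, P i.
Proof.
move=> P0 P1 P2 [[|[|[|//]]] lti].
- by rewrite (_ : Ordinal lti = 0) //; apply/val_inj.
- by rewrite (_ : Ordinal lti = 1) //; apply/val_inj.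
- by rewrite (_ : Ordinal lti = 2) //; apply/val_inj.
Qed.

Lemma sum3 (V : nmodType) (F : 'I_3 -> V) : \sum_(i < 3) F i = F 0 + F 1 + F 2.
Proof.
rewrite !big_ord_recl big_ord0 addr0 addrA.
by congr (_ + F _ + F _); apply/val_inj.
Qed.

Lemma MVT_line f x v (t : R) : (forall y, derivable f y v) ->
  exists2 xi : R, `|xi| <= `|t| & f (x + t *: v) - f x = t * 'D_v f (x + xi *: v).
Proof.
move=> df; pose h (s : R) := f (s *: v + x).
have dh (s : R) : is_derive s 1 h ('D_v f (x + s *: v)).
  have H : (fun u => u^-1 *: ((h \o shift s) (u *: 1) - h s)) =
      (fun u => u^-1 *: ((f \o shift (x + s *: v)) (u *: v) - f (x + s *: v))).
    apply/funext => u /=; rewrite /h [_%:A]mulr1 scalerDl.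
    by rewrite -!addrA (addrC (s *: v) x).
  split; first by rewrite /derivable H; exact: df.
  by rewrite /derive H.
have ch : continuous h.
  move=> s; apply: differentiable_continuous; apply/derivable1_diffP.
  by have [] := dh s.
have [t0|t0] := leP 0 t.
  have [|xi xi1 Exi] := @MVT_segment R h (fun s => 'D_v f (x + s *: v)) 0 t t0 (fun s _ => dh s).
    exact: continuous_subspaceT.
  move: xi1; rewrite in_itv /= => /andP[xi1 xi2].
  exists xi; first by rewrite !ger0_norm.
  by move: Exi; rewrite /h subr0 scale0r add0r (addrC _ x) [RHS]mulrC.
have [|xi xi1 Exi] := @MVT_segment R h (fun s => 'D_v f (x + s *: v)) t 0 (ltW t0) (fun s _ => dh s).
  exact: continuous_subspaceT.
move: xi1; rewrite in_itv /= => /andP[xi1 xi2].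
exists xi; first by rewrite ler0_norm // ltr0_norm // lerN2.
move: Exi; rewrite /h sub0r scale0r add0r mulrN (mulrC _ t) (addrC _ x).
by move=> E1; rewrite -[LHS]opprB E1 opprK.
Qed.

Lemma norm_rV_le (h : E) i : `|h 0 i| <= `|h|.
Proof.
rewrite [leRHS]/Num.Def.normr /= mx_normrE.
exact: (@le_bigmax _ _ _ 0 (fun ij : 'I_1 * 'I_3 => `|h ij.1 ij.2|) (0, i)).
Qed.

Lemma norm_rV_leP (h : E) (e : R) : 0 <= e -> (forall i, `|h 0 i| <= e) -> `|h| <= e.
Proof.
move=> e0 H; rewrite [leLHS]/Num.Def.normr /= mx_normrE.
by apply: bigmax_le => // -[i j] _ /=; rewrite ord1.
Qed.

Definition grad f x : E := \row_i partial i f x.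

Lemma rV3E (h : E) : h = h 0 0 *: delta_mx 0 0 + h 0 1 *: delta_mx 0 1 + h 0 2 *: delta_mx 0 2.
Proof.
by apply/rowP; elim/I3_ind; rewrite !mxE /= !(mulr0, mulr1) ?addr0 ?add0r.
Qed.

(** The increment from [x] to [x + h] is split along the three axes; the mean value theorem on each
    segment and continuity of the partial derivatives bound each error by a third of e|h|. *)
Lemma smooth_differentiable_aux f x : smooth setT f ->
  f \o shift x = cst (f x) + (fun h => dot h (grad f x)) +o_ (0 : E) (id : E -> E).
Proof.
move=> sf; apply/eqaddoP => _/posnumP[e].
have c3 i : \forall y \near x, `|partial i f x - partial i f y| <= e%:num / 3.
  have /(_ x I)/cvgrPdist_le := smooth_continuous (smooth_partial i sf).
  by apply; rewrite divr_gt0.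
have /nbhs_ballP[d0 /= d00 H0] := c3 0.
have /nbhs_ballP[d1 /= d10 H1] := c3 1.
have /nbhs_ballP[d2 /= d20 H2] := c3 2.
near=> h.
have hd0 : `|h| < d0 by near: h; exact: cvgr0_norm_lt.
have hd1 : `|h| < d1 by near: h; exact: cvgr0_norm_lt.
have hd2 : `|h| < d2 by near: h; exact: cvgr0_norm_lt.
rewrite /= !fctE /=.
have df i y : derivable f y (delta_mx 0 i) by exact: smooth_derivable sf I.
have [a a1 Ea] := MVT_line x (h 0 0) (df 0).
have [b b1 Eb] := MVT_line (x + h 0 0 *: delta_mx 0 0) (h 0 1) (df 1).
have [c c1 Ec] := MVT_line (x + h 0 0 *: delta_mx 0 0 + h 0 1 *: delta_mx 0 1) (h 0 2) (df 2).
have bnd (k : E) d : `|h| < d -> (forall i, `|k 0 i| <= `|h|) -> ball x d (x + k).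
  move=> hd H; rewrite -ball_normE /= opprD addrA subrr sub0r normrN.
  by apply: le_lt_trans hd; apply: norm_rV_leP.
have -> : f (h + x) - (f x + dot h (grad f x)) =
   h 0 0 * (partial 0 f (x + a *: delta_mx 0 0) - partial 0 f x)
 + h 0 1 * (partial 1 f (x + (h 0 0 *: delta_mx 0 0 + b *: delta_mx 0 1)) - partial 1 f x)
 + h 0 2 * (partial 2 f (x + (h 0 0 *: delta_mx 0 0 + h 0 1 *: delta_mx 0 1 + c *: delta_mx 0 2)) - partial 2 f x).
  rewrite !addrA /partial !mulrBr -Ea -Eb -Ec [h in f (h + x)]rV3E.
  rewrite /dot sum3 !mxE (addrC _ x) !addrA /partial; ring.
have e3 : e%:num * `|h| = `|h| * (e%:num / 3) + `|h| * (e%:num / 3) + `|h| * (e%:num / 3) by field.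
rewrite e3; apply: le_trans (ler_normD _ _) _; apply: lerD.
  apply: le_trans (ler_normD _ _) _; apply: lerD.
    rewrite normrM ler_pM ?norm_rV_le // distrC; apply: H0; apply: bnd => // i.
    by rewrite !mxE /=; case: eqP => /= _; rewrite ?mulr1 ?mulr0 ?normr0 // (le_trans a1) ?norm_rV_le.
  rewrite normrM ler_pM ?norm_rV_le // distrC; apply: H1; apply: bnd => // i.
  elim/I3_ind : i; rewrite !mxE /= !(mulr0, mulr1) ?addr0 ?add0r ?normr0 ?norm_rV_le //.
  by rewrite (le_trans b1) ?norm_rV_le.
rewrite normrM ler_pM ?norm_rV_le // distrC; apply: H2; apply: bnd => // i.
elim/I3_ind : i; rewrite !mxE /= !(mulr0, mulr1) ?addr0 ?add0r ?norm_rV_le //.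
by rewrite (le_trans c1) ?norm_rV_le.
Unshelve. all: by end_near. Qed.

Lemma dotDr x v w : dot x (v + w) = dot x v + dot x w.
Proof. by rewrite /dot -big_split; apply: eq_bigr => i _; rewrite mxE mulrDr. Qed.

Lemma dotZr x v (a : R) : dot x (a *: v) = a * dot x v.
Proof. by rewrite /dot mulr_sumr; apply: eq_bigr => i _; rewrite mxE mulrCA. Qed.

Lemma dotC x v : dot x v = dot v x.
Proof. by apply: eq_bigr => i _; rewrite mulrC. Qed.

Lemma dotDl x v w : dot (x + w) v = dot x v + dot w v.
Proof. by rewrite dotC dotDr !(dotC v). Qed.

Lemma dotZl x v (a : R) : dot (a *: x) v = a * dot x v.
Proof. by rewrite dotC dotZr dotC. Qed.

Lemma smooth_differentiable f x : smooth setT f ->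
  differentiable f x /\ forall v, 'd f x v = dot v (grad f x).
Proof.
move=> sf.
have lin : linear (fun h : E => dot h (grad f x)).
  by move=> a u v; rewrite dotDl dotZl.
pose lm := GRing.isLinear.Build _ _ _ _ _ lin.
pose L : {linear E -> R} := HB.pack (fun h : E => dot h (grad f x)) lm.
have cL : continuous L.
  move=> u; rewrite /L /=.
  have -> : (fun h => dot h (grad f x)) =
      (fun h : E => h 0 0 * grad f x 0 0 + h 0 1 * grad f x 0 1 + h 0 2 * grad f x 0 2).
    by apply/funext => h; rewrite /dot sum3.
  have c i : {for u, continuous (fun h : E => h 0 i * grad f x 0 i)}.
    by apply: continuousM; [exact: coord_continuous|exact: cst_continuous].
  exact: (continuousD (continuousD (c 0) (c 1)) (c 2)).
have H : f \o shift x = cst (f x) + L +o_ (0 : E) (id : E -> E) by exact: smooth_differentiable_aux.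
have dL : 'd f x = L :> (E -> R) by exact: diff_unique.
split; last by move=> v; rewrite dL.
by apply/diff_locallyP; rewrite dL.
Qed.

Lemma smooth_derive f x v : smooth setT f ->
  derivable f x v /\ 'D_v f x = dot v (grad f x).
Proof.
move=> /(smooth_differentiable x)[H1 H2].
by split; [exact: diff_derivable|rewrite deriveE // H2].
Qed.

Lemma smoothT_derivable f : smooth setT f ->
  forall i y, derivable f y (delta_mx 0 i).
Proof. by move=> sf i y; exact: smooth_derivable sf I. Qed.

Lemma derive_translate f x v c :
  (derivable f (x + c) v -> derivable (fun y => f (y + c)) x v) /\
  'D_v (fun y => f (y + c)) x = 'D_v f (x + c).
Proof.
have H : (fun h => h^-1 *: (((fun y => f (y + c)) \o shift x) (h *: v) - f (x + c)))
   = (fun h => h^-1 *: ((f \o shift (x + c)) (h *: v) - f (x + c))).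
  by apply/funext => h /=; rewrite addrA.
by split; rewrite /derivable /derive H.
Qed.

Lemma second_difference f x i j (t : R) : smooth setT f ->
  exists2 y, `|y - x| <= `|t| + `|t| &
    f (x + t *: delta_mx 0 i + t *: delta_mx 0 j) - f (x + t *: delta_mx 0 i)
    - f (x + t *: delta_mx 0 j) + f x = t * t * partial j (partial i f) y.
Proof.
move=> sf; set ei := delta_mx 0 i; set ej := delta_mx 0 j.
have dl (k : 'I_3) (s : R) : `|s *: delta_mx 0 k : E| <= `|s|.
  rewrite normrZ ler_piMr //; apply: norm_rV_leP => // l.
  by rewrite !mxE /=; case: eqP => _; rewrite ?normr1 ?normr0.
pose g y := f (y + t *: ej) - f y.
have dg y : derivable g y ei /\ 'D_ei g y = partial i f (y + t *: ej) - partial i f y.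
  have [H1 H2] := derive_translate f y ei (t *: ej).
  have d1 : derivable (fun y => f (y + t *: ej)) y ei.
    by apply: H1; exact: (smoothT_derivable sf).
  have d2 : derivable f y ei by exact: (smoothT_derivable sf).
  by split; [exact: (derivableB d1 d2)|rewrite (deriveB d1 d2) H2].
have [a a1 Ea] := MVT_line x t (fun y => (dg y).1).
have dj y : derivable (partial i f) y ej.
  exact: (smoothT_derivable (smooth_partial i sf)).
have [b b1 Eb] := MVT_line (x + a *: ei) t dj.
exists (x + a *: ei + b *: ej).
  have -> : x + a *: ei + b *: ej - x = a *: ei + b *: ej by rewrite addrAC (addrAC x) subrr add0r.
  apply: le_trans (ler_normD _ _) _; apply: lerD; first exact: le_trans (dl _ _) _.
  exact: le_trans (dl _ _) _.
rewrite -mulrA -Eb -(dg _).2 -Ea /g; ring.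
Qed.

(** The second difference is symmetric in [i] and [j], so the two mixed derivatives agree at two
    points near [x]; continuity brings both points to [x]. *)
Lemma schwarz f i j : smooth setT f ->
  partial i (partial j f) = partial j (partial i f).
Proof.
move=> sf; apply/funext => x; apply/eqP; rewrite -subr_eq0 -normr_le0.
apply/ler_addgt0Pr => e e0; rewrite add0r.
have c (k l : 'I_3) : \forall y \near x, `|partial k (partial l f) x - partial k (partial l f) y| <= e / 2.
  have /(_ x I)/cvgrPdist_le := smooth_continuous (smooth_partial k (smooth_partial l sf)).
  by apply; rewrite divr_gt0.
have /nbhs_ballP[d0 /= d00 H0] := c i j.
have /nbhs_ballP[d1 /= d10 H1] := c j i.
pose d := Num.min d0 d1; have d_gt0 : 0 < d by rewrite lt_min d00.
have dd0 : d <= d0 by rewrite /d ge_min lexx.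
have dd1 : d <= d1 by rewrite /d ge_min lexx orbT.
(* Both mean-value points lie within 2t < d of [x]. *)
pose t := d / 4; have t0 : 0 < t by rewrite divr_gt0.
have tt : `|t| + `|t| < d by rewrite gtr0_norm // /t; move: d_gt0; lra.
have [y y1 Ey] := second_difference x i j t sf.
have [z z1 Ez] := second_difference x j i t sf.
have yz : partial j (partial i f) y = partial i (partial j f) z.
  apply: (@mulfI _ (t * t)); first by rewrite mulf_neq0 // gt_eqF.
  transitivity (f (x + t *: delta_mx 0 i + t *: delta_mx 0 j) - f (x + t *: delta_mx 0 i) - f (x + t *: delta_mx 0 j) + f x); first exact: (esym Ey).
  transitivity (f (x + t *: delta_mx 0 j + t *: delta_mx 0 i) - f (x + t *: delta_mx 0 j) - f (x + t *: delta_mx 0 i) + f x); last exact: Ez.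
  rewrite (addrAC x (t *: delta_mx 0 j)); ring.
have b0 : ball x d0 z.
  rewrite -ball_normE /=; rewrite distrC; apply: le_lt_trans z1 _; exact: lt_le_trans tt dd0.
have b1 : ball x d1 y.
  rewrite -ball_normE /=; rewrite distrC; apply: le_lt_trans y1 _; exact: lt_le_trans tt dd1.
have := H0 _ b0; have := H1 _ b1; rewrite /= -yz => A B.
rewrite -(subrKA (partial j (partial i f) y)) [leRHS]splitr.
apply: le_trans (ler_normD _ _) _; apply: (lerD B); rewrite distrC; exact: A.
Qed.

End Differentiability.

(** * Smooth functions on the whole space, bump functions, localisation *)

Section GlobalSmooth.
Context (R : realType).
Local Notation E := 'rV[R]_3.
Local Notation sm := (smooth (@setT E)).
Implicit Types (f g : E -> R) (x v p : E).

Lemma smooth_coord (m n : nat) U (f : E -> 'M[R]_(m, n)) i j : open U -> smooth U f ->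
  smooth U (fun x => f x i j).
Proof.
move=> oU sf k; move: (sf k) => {sf}; elim: k f => [|k IH] f.
  move=> /C_0P H; apply/C_0P => x Ux.
  by apply: (@continuous_comp _ _ _ f (fun M : 'M[R]_(m, n) => M i j) x (H x Ux)); exact: coord_continuous.
move=> /C_SP[H1 H2 H3]; apply/C_SP; split=> [x Ux|l x Ux|l].
- by apply: (@continuous_comp _ _ _ f (fun M : 'M[R]_(m, n) => M i j) x (H1 x Ux)); exact: coord_continuous.
- exact: (derivable_mxP _ _ _).1 (H2 l x Ux) i j.
apply: (@C_ext R R k U (fun x => partial l f x i j) _ oU _ (IH _ (H3 l))).
by move=> x Ux; rewrite /partial derive_mx ?mxE //; exact: H2.
Qed.

Lemma sm_cst (V : normedModType R) (c : V) : sm (fun=> c).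
Proof. by move=> m; exact: C_cst. Qed.

Lemma smooth_add (V : normedModType R) U (f g : E -> V) : open U ->
  smooth U f -> smooth U g -> smooth U (fun x => f x + g x).
Proof. by move=> oU sf sg m; exact: C_add. Qed.

Lemma smooth_mul U f g : open U ->
  smooth U f -> smooth U g -> smooth U (fun x => f x * g x).
Proof. by move=> oU sf sg m; exact: C_mul. Qed.

Lemma smooth_inv U f : open U -> (forall x, U x -> f x != 0) ->
  smooth U f -> smooth U (fun x => (f x)^-1).
Proof. by move=> oU f0 sf m; exact: C_inv. Qed.

Lemma smooth_sqrt U f : open U -> (forall x, U x -> 0 < f x) ->
  smooth U f -> smooth U (fun x => Num.sqrt (f x)).
Proof. by move=> oU f0 sf m; exact: C_sqrt. Qed.

Lemma sm_add (V : normedModType R) (f g : E -> V) :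
  sm f -> sm g -> sm (fun x => f x + g x).
Proof. exact: smooth_add openT. Qed.

Lemma sm_mul f g : sm f -> sm g -> sm (fun x => f x * g x).
Proof. exact: smooth_mul openT. Qed.

Lemma sm_opp f : sm f -> sm (fun x => - f x).
Proof.
move=> sf; have := sm_mul (sm_cst (-1 : R)) sf.
by apply: (smooth_ext openT) => x _; rewrite mulN1r.
Qed.

Lemma sm_sub f g : sm f -> sm g -> sm (fun x => f x - g x).
Proof. by move=> sf sg; exact: (sm_add sf (sm_opp sg)). Qed.

Lemma sm_scale (V : normedModType R) f (c : V) : sm f -> sm (fun x => f x *: c).
Proof. by move=> sf m; apply: (C_scale c openT). Qed.

Lemma sm_sum (V : normedModType R) n (f : 'I_n -> E -> V) : (forall i, sm (f i)) ->
  sm (fun x => \sum_(i < n) f i x).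
Proof.
elim: n f => [|n IH] f sf.
  by apply: (smooth_ext openT _ (sm_cst (0 : V))) => x _; rewrite big_ord0.
apply: (smooth_ext openT _ (sm_add (sf ord0) (IH (fun i => f (lift ord0 i)) _))).
  by move=> x _; rewrite big_ord_recl.
by move=> i; exact: sf.
Qed.

Lemma sm_partial (V : normedModType R) (f : E -> V) i : sm f -> sm (partial i f).
Proof. exact: smooth_partial. Qed.

Lemma partialD (V : normedModType R) (f g : E -> V) i x : sm f -> sm g ->
  partial i (fun x => f x + g x) x = partial i f x + partial i g x.
Proof.
move=> sf sg; rewrite /partial deriveD; first by [].
  exact: smooth_derivable sf I.
exact: smooth_derivable sg I.
Qed.

Lemma partialM f g i x : sm f -> sm g ->
  partial i (fun x => f x * g x) x = partial i f x * g x + f x * partial i g x.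
Proof.
move=> sf sg; rewrite /partial deriveM; [|exact: smooth_derivable sf I|exact: smooth_derivable sg I].
by rewrite addrC; congr (_ + _); exact: mulrC.
Qed.

Lemma partialN f i x : sm f -> partial i (fun x => - f x) x = - partial i f x.
Proof. move=> sf; rewrite /partial deriveN; first by [].
exact: smooth_derivable sf I. Qed.

Lemma partialB f g i x : sm f -> sm g ->
  partial i (fun x => f x - g x) x = partial i f x - partial i g x.
Proof. by move=> sf sg; rewrite (partialD _ _ sf (sm_opp sg)) (partialN _ _ sg) . Qed.

Lemma partialZl (V : normedModType R) f (c : V) i x : sm f ->
  partial i (fun x => f x *: c) x = partial i f x *: c.
Proof.
move=> sf; have df : derivable f x (delta_mx 0 i) by exact: smooth_derivable sf I.
have H : (fun h => h^-1 *: (f (h *: delta_mx 0 i + x) *: c - f x *: c)) @ 0^' --> partial i f x *: c.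
  rewrite (_ : (fun h => _) =
    (fun h => (h^-1 *: (f (h *: delta_mx 0 i + x) - f x)) *: c)); last first.
    by apply/funext => h; rewrite -scalerBl scalerA.
  by apply: cvgZr_tmp; exact: df.
exact/cvg_lim.
Qed.

Lemma partial_sum (V : normedModType R) n (f : 'I_n -> E -> V) i x : (forall j, sm (f j)) ->
  partial i (fun x => \sum_(j < n) f j x) x = \sum_(j < n) partial i (f j) x.
Proof.
elim: n f => [|n IH] f sf.
  rewrite big_ord0 (_ : (fun _ => _) = fun=> 0); first by rewrite partial_cst.
  by apply/funext => y; rewrite big_ord0.
rewrite big_ord_recl -IH; last by move=> j; exact: sf.
rewrite -partialD; [|exact: sf|apply: sm_sum => j; exact: sf].
by congr (partial i _ x); apply/funext => y; rewrite big_ord_recl.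
Qed.

Lemma partial_near (V : normedModType R) U (f g : E -> V) i x : open U -> U x ->
  (forall y, U y -> f y = g y) -> partial i f x = partial i g x.
Proof. by move=> oU Ux fg; apply: near_eq_derive; exact: eq_on_open oU fg Ux. Qed.

Lemma partial_coord i j x : partial i (fun x : E => x 0 j) x = (i == j)%:R.
Proof.
rewrite /partial deriveE; last exact: differentiable_coord.
rewrite -deriveE; last exact: differentiable_coord.
have H : (fun h : R => h^-1 *: (((fun x : E => x 0 j) \o shift x) (h *: delta_mx 0 i) - x 0 j)) @ 0^' --> ((i == j)%:R : R).
  apply/cvgrPdist_le => e e0; near=> h.
  rewrite /= !mxE eqxx /= addrK (eq_sym j) /GRing.scale /= mulrA mulVf ?mul1r ?subrr ?normr0 ?ltW //.
  near: h; exact: nbhs_dnbhs_neq.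
exact/cvg_lim.
Unshelve. all: by end_near. Qed.

Lemma sm_coord j : sm (fun x : E => x 0 j).
Proof.
move=> m; elim: m => [|m _]; first by apply/C_0P => x _; exact: coord_continuous.
apply/C_SP; split=> [x _|i x _|i]; first exact: coord_continuous.
  by apply: diff_derivable; exact: differentiable_coord.
rewrite (_ : partial i _ = fun=> (i == j)%:R : R); first by apply: C_cst.
by apply/funext => x; exact: partial_coord.
Qed.

Lemma sm_continuous (V : normedModType R) (f : E -> V) : sm f -> continuous f.
Proof. by move=> sf x; exact: smooth_continuous sf I. Qed.

Lemma sm_cutoff U C (chi : E -> R) f : open U -> closed C -> C `<=` U -> sm chi ->
  (forall x, ~ C x -> chi x = 0) -> smooth U f -> sm (fun x => chi x * f x).
Proof.
move=> oU cC CU schi chi0 sf; apply: smooth_cover => x _.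
have [Cx|nCx] := pselect (C x).
  exists U; first exact: CU.
  exact: (smooth_mul oU (smooth_sub (@subsetT _ _) schi) sf).
exists (~` C) => //; have oC : open (~` C) by exact: closed_openC.
apply: (smooth_ext oC _ (smooth_sub (@subsetT _ _) (sm_cst (0:R)))).
by move=> y Cy; rewrite chi0 // mul0r.
Qed.

Definition dist2 p x : R := \sum_(i < 3) (x 0 i - p 0 i) * (x 0 i - p 0 i).

Lemma sm_dist2 p : sm (dist2 p).
Proof.
have sc i : sm (fun x : E => x 0 i - p 0 i) by apply: sm_sub; [exact: sm_coord|exact: sm_cst].
by apply: sm_sum => i; exact: (sm_mul (sc i) (sc i)).
Qed.

Lemma dist2_ge p x i : `|x 0 i - p 0 i| ^+ 2 <= dist2 p x.
Proof.
rewrite /dist2 sum3 real_normK ?num_real // expr2.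
pose q k := (x 0 k - p 0 k) * (x 0 k - p 0 k).
have q0 k : 0 <= q k by rewrite /q -expr2 sqr_ge0.
rewrite -!/(q _); move: (q0 0) (q0 1) (q0 2).
by elim/I3_ind: i; move: (q 0) (q 1) (q 2) => a b c a0 b0 c0; lra.
Qed.

Lemma bump_exists U p : open U -> U p -> exists (chi : E -> R) C W,
  [/\ sm chi, closed C /\ C `<=` U, (forall x, ~ C x -> chi x = 0),
      open W /\ W p & forall x, W x -> chi x = 1].
Proof.
move=> oU Up; have /nbhs_ballP[d /= d0 dU] : nbhs p U by exact: open_nbhs_nbhs.
(* The bump is a / (a + b). It is 1 where [dist2 p x] < r, as b vanishes there, and 0 beyond 4r =
   d^2/2. Since d^2/2 <= (3d/4)^2, its support stays inside the sup-norm ball of radius d. *)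
pose r := d ^+ 2 / 8; have r0 : 0 < r by rewrite divr_gt0 // exprn_gt0.
pose a x := flat 0 (r * 4 - dist2 p x); pose b x := flat 0 (dist2 p x - r).
have sma : sm a.
  by move=> m; apply: (C_comp_flat 0 openT); apply: (sm_sub (sm_cst (r * 4)) (sm_dist2 p)).
have smb : sm b.
  by move=> m; apply: (C_comp_flat 0 openT); apply: (sm_sub (sm_dist2 p) (sm_cst r)).
have ab0 x : a x + b x != 0.
  rewrite gt_eqF //; have [h|h] := ltP (dist2 p x) (r * 4).
    by rewrite ltr_pwDl ?flat_ge0 // flat_gt0 // subr_gt0.
  by rewrite ltr_wpDl ?flat_ge0 // flat_gt0 // subr_gt0; apply: lt_le_trans h; lra.
have cd : continuous (dist2 p) by exact/sm_continuous/sm_dist2.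
exists (fun x => a x * (a x + b x)^-1), [set x | dist2 p x <= r * 4], [set x | dist2 p x < r].
split.
- apply: (sm_mul sma); apply: (smooth_inv openT) => [x _|]; [exact: ab0|exact: (sm_add sma smb)].
- split.
    have -> : [set x | dist2 p x <= r * 4] = dist2 p @^-1` [set y | y <= r * 4] by [].
    by apply: closed_comp => [x _|]; [exact: cd|exact: closed_le].
  move=> x /= xr; apply: dU; rewrite -ball_normE /=.
  apply: (@le_lt_trans _ _ (d * (3 / 4))); last by move: d0; lra.
  apply: norm_rV_leP => [|i]; first by move: d0; lra.
  rewrite !mxE distrC -ler_sqr ?nnegrE //; last by move: d0; lra.
  apply: le_trans (dist2_ge p x i) _; apply: le_trans xr _; rewrite /r.
  by have := exprn_gt0 2 d0; rewrite !expr2; lra.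
- move=> x /negP; rewrite -ltNge => xr; rewrite /a /flat ltNge.
  by rewrite ifF ?mul0r //; apply/negbF; rewrite subr_le0 ltW.
- split; last by rewrite /= /dist2 big1 // => i _; rewrite subrr mulr0.
  have -> : [set x | dist2 p x < r] = dist2 p @^-1` [set y | y < r] by [].
  by apply: open_comp => [x _|]; [exact: cd|exact: open_lt].
move=> x /= xr; have -> : b x = 0.
  by rewrite /b /flat ltNge ifF //; apply/negbF; rewrite subr_le0 ltW.
have a0 : a x != 0 by rewrite gt_eqF // flat_gt0 // subr_gt0; apply: lt_trans xr _; lra.
by rewrite addr0 divff.
Qed.

(** Replaces a locally defined function by a global one with the same germ, so that the calculus
    rules can be stated on the whole space. *)
Lemma smooth_localize U f p : open U -> U p -> smooth U f ->
  exists (g : E -> R) W, [/\ sm g, open W, W p & forall x, W x -> U x /\ g x = f x].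
Proof.
move=> oU Up sf; have [chi [C [W [s1 [cC CU] s2 [oW Wp] s3]]]] := bump_exists oU Up.
exists (fun x => chi x * f x), (W `&` U); split.
- exact: (sm_cutoff oU cC CU).
- exact: openI.
- by [].
by move=> x [Wx Ux]; split=> //; rewrite s3 // mul1r.
Qed.

End GlobalSmooth.

(** * Smooth functions are Sobolev functions *)

Section SobolevSmooth.
Context (R : realType).
Local Notation E := 'rV[R]_3.
Local Notation sm := (smooth (@setT E)).
Local Notation mu := (@lebesgue_measure R).
Local Notation mu3 := ((mu \x mu) \x mu)%E.
Local Notation T3 := (measurableTypeR R * measurableTypeR R * measurableTypeR R)%type.
Implicit Types (f g u w : E -> R) (x : E).

Definition cube (M : R) : set E := [set x | forall i, `|x 0 i| <= M].

(** The product sigma-algebra is generated by boxes, not by the topology of row vectors. An open set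
    is the countable union of the rational boxes that it contains. *)
Lemma measurable_pt (A : set E) : open A -> measurable (@pt R @^-1` A : set T3).
Proof.
move=> oA.
pose itv (q : rat) (n : nat) : set R := `](ratr q - n.+1%:R^-1), (ratr q + n.+1%:R^-1)[%classic.
pose B (i : rat * rat * rat * nat) : set T3 :=
  (itv i.1.1.1 i.2 `*` itv i.1.1.2 i.2) `*` itv i.1.2 i.2.
have mI q n : measurable (itv q n : set (measurableTypeR R)) by exact: measurable_itv.
have mB i : measurable (B i).
  by apply: measurableX => //; apply: measurableX.
pose G i : set T3 := if pselect (B i `<=` @pt R @^-1` A) then B i else set0.
have -> : @pt R @^-1` A = \bigcup_i G i.
  apply/seteqP; split=> [y|y [i _]]; last first.
    by rewrite /G; case: pselect => // BA /BA.
  case: y => -[a b] c Ax.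
  have /nbhs_ballP[d /= d0 dA] : nbhs (pt (a, b, c)) A by exact: open_nbhs_nbhs.
  have [n nd] : exists n : nat, n.+1%:R^-1 + n.+1%:R^-1 < d.
    have d2 : 0 < d / 2 by rewrite divr_gt0.
    near \oo => n; exists n; rewrite [ltRHS]splitr.
    have : n.+1%:R^-1 < d / 2 by near: n; exact: (near_infty_natSinv_lt (PosNum d2)).
    by move=> h; exact: ltrD.
  have n0 : 0 < n.+1%:R^-1 :> R by rewrite invr_gt0.
  have rq (t : R) : exists q : rat, `|t - ratr q| < n.+1%:R^-1.
    have [|q] := @rat_in_itvoo R (t - n.+1%:R^-1) (t + n.+1%:R^-1).
      by rewrite ltrD2l gtrN.
    by rewrite in_itv /= -ltr_distlC distrC => ?; exists q; rewrite distrC.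
  have [qa Ha] := rq a; have [qb Hb] := rq b; have [qc Hc] := rq c.
  have inB (t : R) q : itv q n t -> `|t - ratr q| < n.+1%:R^-1.
    by rewrite /itv /= in_itv /= -ltr_distl.
  have inB' (t : R) q : `|t - ratr q| < n.+1%:R^-1 -> itv q n t.
    by rewrite /itv /= in_itv /= -ltr_distl.
  exists (qa, qb, qc, n) => //; rewrite /G; case: pselect => [BA|nB].
    by split=> /=; [split|] => /=; apply: inB'.
  case: nB => y' [[/= /inB Ha' /inB Hb'] /inB Hc'].
  case: y' Ha' Hb' Hc' => -[a' b'] c' /= Ha' Hb' Hc'.
  apply: dA; rewrite -ball_normE /=.
  have H (s t : R) q : `|s - ratr q| < n.+1%:R^-1 -> `|t - ratr q| < n.+1%:R^-1 -> `|s - t| <= n.+1%:R^-1 + n.+1%:R^-1.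
    move=> h1 h2; rewrite -(subrKA (ratr q)).
    by apply: le_trans (ler_normD _ _) _; apply: lerD; rewrite ltW // distrC.
  apply: le_lt_trans nd; apply: norm_rV_leP; first by rewrite addr_ge0 ?ltW.
  by apply: I3_ind; rewrite !mxE /=; [exact: H Ha Ha'|exact: H Hb Hb'|exact: H Hc Hc'].
apply: countable_bigcupT_measurable => [|i]; first exact: countableP.
by rewrite /G; case: pselect => BA; [exact: mB|exact: measurable0].
Unshelve. all: by end_near. Qed.

Lemma measurable_fun_pt f : continuous f -> measurable_fun [set: T3] (f \o @pt R).
Proof.
move=> cf; apply: (measurability _ (RGenOInfty.measurableE R)).
move=> _ [_ [a ->] <-]; rewrite setTI.
apply: (@measurable_pt (f @^-1` `]a, +oo[)).
by apply: open_comp => [x _|]; [exact: cf|exact: interval_open].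
Qed.


Lemma pt_cube M : @pt R @^-1` cube M = (`[- M, M] `*` `[- M, M]) `*` `[- M, M].
Proof.
apply/seteqP; split=> -[[a b] c] /=; rewrite !in_itv /= -!ler_norml.
  by move=> H; have := H 0; have := H 1; have := H 2; rewrite !mxE.
by move=> [[Ha Hb] Hc]; apply: I3_ind; rewrite mxE.
Qed.

Lemma measurable_cube M : measurable (@pt R @^-1` cube M : set T3).
Proof. by rewrite pt_cube; apply: measurableX => //; apply: measurableX. Qed.

Lemma mu_cube M : (mu3 (@pt R @^-1` cube M) < +oo)%E.
Proof.
rewrite pt_cube.
have mi : measurable (`[- M, M] : set (measurableTypeR R)) by exact: measurable_itv.
have fi : (mu `[(- M)%R, M]%classic < +oo)%E.
  by rewrite lebesgue_measure_itv; case: ifP => // _; rewrite -EFinB ltry.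
pose I := (`[(- M)%R, M]%classic : set (measurableTypeR R)).
have p2 : (mu \x mu)%E (I `*` I) = (mu I * mu I)%E by rewrite product_measure1E.
have -> : mu3 ((I `*` I) `*` I) = ((mu I * mu I) * mu I)%E.
  by rewrite product_measure1E; [congr (_ * _)%E; exact: p2|exact: measurableX|].
have f2 : (mu I * mu I < +oo)%E by rewrite lte_mul_pinfty // ge0_fin_numE.
by apply: lte_mul_pinfty => //; [exact: mule_ge0|rewrite ge0_fin_numE // mule_ge0].
Qed.

Lemma cube_bounded_fun f M : continuous f -> exists C : R, forall x, cube M x -> `|f x| <= C.
Proof.
move=> cf.
have cc : compact (cube M).
  have -> : cube M = [set v : E | forall i, [set y : R | `|y| <= M] (v ord0 i)].
    by apply/seteqP; split => v H i; exact: H.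
  apply: (@rV_compact _ _ (fun=> [set y : R | `|y| <= M])) => _.
  rewrite (_ : [set y : R | _] = `[- M, M]%classic); first exact: segment_compact.
  by apply/seteqP; split=> y; rewrite /= in_itv /= ler_norml.
have /compact_bounded[C [_ HC]] := continuous_compact (continuous_subspaceT cf) cc.
exists (C + 1) => x Mx; apply: HC; first by rewrite ltrDl.
by exists x.
Qed.

Lemma integrable_cube f M : continuous f -> (forall x, ~ cube M x -> f x = 0) ->
  mu3.-integrable [set: T3] (EFin \o (f \o @pt R)).
Proof.
move=> cf f0; have mc := measurable_cube M.
have H : mu3.-integrable (@pt R @^-1` cube M : set T3) (EFin \o (f \o @pt R)).
  apply: measurable_bounded_integrable => //; first exact: mu_cube.
    by apply: measurable_funTS; exact: measurable_fun_pt.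
  have [C HC] := cube_bounded_fun M cf.
  exists C; split; first exact: num_real.
  by move=> y Cy x Mx; apply: le_trans (HC _ Mx) _; exact: ltW.
have /(integrable_mkcond _ mc) := H; congr (integrable _ _ _).
apply/funext => x; rewrite /patch; case: ifPn => // /negP nx.
by rewrite /= f0 // => h; apply: nx; rewrite inE.
Qed.


Lemma integral_derive_support (k k' : R -> R) (M : R) :
  (forall t : R, is_derive t 1 k (k' t)) -> continuous k' ->
  (forall t, M < `|t| -> k t = 0) -> (forall t, M < `|t| -> k' t = 0) ->
  (\int[mu]_t (k' t)%:E = 0)%E.
Proof.
(* [k] vanishes only where M < |t|, so the interval [-N, N] of the fundamental theorem has to be
   strictly larger; the absolute value covers a negative [M]. *)
move=> dk ck k0 k'0; pose N := `|M| + 1.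
have MN : M < N by apply: le_lt_trans (ler_norm M) _; rewrite ltrDl.
have N0 : 0 < N by rewrite /N ltr_wpDl.
have NN : - N < N by rewrite gtrN.
have cont t : {for t, continuous k}.
  by apply: differentiable_continuous; apply/derivable1_diffP; have [] := dk t.
transitivity (\int[mu]_(t in `[(- N)%R, N]%classic) (k' t)%:E)%E.
  rewrite [RHS]integral_mkcond; apply: eq_integral => t _.
  rewrite patchE; case: ifPn => //; rewrite notin_setE /= in_itv /= -ler_norml.
  by move=> /negP; rewrite -ltNge => Nt; rewrite k'0 // (lt_trans MN).
rewrite (@continuous_FTC2 _ k' k) //.
- by rewrite !k0 ?subee // ?normrN gtr0_norm.
- exact: continuous_subspaceT.
- split.
  + by move=> t _; have [] := dk t.
  + by apply: cvg_at_right_filter; exact: cont.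
  + by apply: cvg_at_left_filter; exact: cont.
- by move=> t _; rewrite derive1E; have [] := dk t.
Qed.

Lemma cube_closed M : closed (cube M).
Proof.
have -> : cube M = \bigcap_(i : 'I_3) ((fun x : E => `|x 0 i|) @^-1` [set y | y <= M]).
  by apply/seteqP; split=> [x H i _|x H i]; [exact: H|exact: H].
apply: closed_bigI => i _; apply: closed_comp => [x _|]; last exact: closed_le.
by apply: continuous_comp; [exact: coord_continuous|exact: norm_continuous].
Qed.

Lemma partial_supp C f i : closed C -> (forall x, ~ C x -> f x = 0) ->
  forall x, ~ C x -> partial i f x = 0.
Proof.
move=> cC f0 x nCx; rewrite (@partial_near _ _ (~` C) f (fun=> 0)) ?partial_cst //.
exact: closed_openC.
Qed.

Definition ptline (y : R * R * R) (i : 'I_3) (t : R) : R * R * R :=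
  (if i == 0 then t else y.1.1, if i == 1 then t else y.1.2, if i == 2 then t else y.2).

Lemma integral_ptline w M i y : sm w -> (forall x, ~ cube M x -> w x = 0) ->
  (\int[mu]_t (partial i w (pt (ptline y i t)))%:E = 0)%E.
Proof.
move=> sw w0.
have L (s t : R) : pt (ptline y i t) = (t - s) *: delta_mx 0 i + pt (ptline y i s).
  apply/rowP; elim/I3_ind: i => {w sw w0}; apply: I3_ind;
    by rewrite !mxE /= ?mulr1 ?mulr0 ?add0r ?subrK.
have out t : M < `|t| -> ~ cube M (pt (ptline y i t)).
  move=> Mt /(_ i); rewrite leNgt => /negP; apply; apply: lt_le_trans Mt _.
  by elim/I3_ind: i {L w sw w0}; rewrite mxE.
apply: (@integral_derive_support (fun t => w (pt (ptline y i t))) _ M).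
- move=> t; have dw : derivable w (pt (ptline y i t)) (delta_mx 0 i).
    exact: smoothT_derivable.
  have H : (fun h : R => h^-1 *: (((fun t => w (pt (ptline y i t))) \o shift t) (h *: 1) - w (pt (ptline y i t)))) =
    (fun h => h^-1 *: ((w \o shift (pt (ptline y i t))) (h *: delta_mx 0 i) - w (pt (ptline y i t)))).
    apply/funext => h /=; rewrite (L t (h%:A + t)) addrK.
    by rewrite [h%:A]mulr1.
  by split; [rewrite /derivable H; exact: dw|rewrite /derive H].
- move=> t.
  have cl : {for t, continuous (fun t => pt (ptline y i t))}.
    rewrite (_ : (fun t => _) = (fun t => (t - 0) *: delta_mx 0 i + pt (ptline y i 0))).
      apply: continuousD; last exact: cst_continuous.
      by apply: continuousZl; apply: continuousB => //; exact: cst_continuous.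
    by apply/funext => s; exact: L.
  apply: (@continuous_comp _ _ _ _ (partial i w) t cl).
  exact: (sm_continuous (sm_partial i sw)).
- by move=> t /out; exact: w0.
- by move=> t /out; exact: (partial_supp i (@cube_closed M) w0).
Qed.

Lemma integrable_slice f M z : continuous f -> (forall x, ~ cube M x -> f x = 0) ->
  (mu \x mu)%E.-integrable [set: measurableTypeR R * measurableTypeR R]
    (fun xy => (f (pt (xy, z)))%:E).
Proof.
move=> cf f0; pose I := (`[(- M)%R, M]%classic : set (measurableTypeR R)).
have mI : measurable I by exact: measurable_itv.
have mII : measurable (I `*` I) by exact: measurableX.
have fi : (mu I < +oo)%E.
  by rewrite lebesgue_measure_itv; case: ifP => // _; rewrite -EFinB ltry.
have mf : measurable_fun [set: measurableTypeR R * measurableTypeR R] (fun xy => f (pt (xy, z))).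
  apply: (measurableT_comp (measurable_fun_pt cf)); exact: pair2_measurable.
have H : (mu \x mu)%E.-integrable (I `*` I) (EFin \o (fun xy => f (pt (xy, z)))).
  apply: measurable_bounded_integrable => //.
  - suff : ((mu \x mu)%E (I `*` I) < +oo)%E by [].
    have -> : (mu \x mu)%E (I `*` I) = (mu I * mu I)%E by rewrite product_measure1E.
    by rewrite lte_mul_pinfty // ge0_fin_numE.
  - by apply: measurable_funTS.
  (* The height [z] of the slice may exceed [M]; the bound is taken on a cube that contains it. *)
  have [C HC] := cube_bounded_fun (Num.max M `|z|) cf.
  exists C; split; first exact: num_real.
  move=> y Cy [a b] /= [Ia Ib]; apply: le_trans (HC _ _) (ltW Cy).
  move: Ia Ib; rewrite /I /= !in_itv /= -!ler_norml => Ia Ib.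
  by apply: I3_ind; rewrite mxE /= le_max ?Ia ?Ib ?lexx ?orbT.
have /(integrable_mkcond _ mII) := H; congr (integrable _ _ _).
apply/funext => -[a b]; rewrite /patch; case: ifPn => // /negP nx.
rewrite f0 // => h; apply: nx; rewrite inE /I /= !in_itv /= -!ler_norml.
by have := h 0; have := h 1; rewrite !mxE.
Qed.

Local Notation T2 := (measurableTypeR R * measurableTypeR R)%type.

Lemma sigma_finite_plane : sigma_finite [set: T2] (mu \x mu)%E.
Proof.
pose I (n : nat) := (`[(- n%:R)%R, n%:R]%classic : set (measurableTypeR R)).
have mI n : measurable (I n) by exact: measurable_itv.
have fI n : (mu (I n) < +oo)%E.
  by rewrite lebesgue_measure_itv; case: ifP => // _; rewrite -EFinB ltry.
exists (fun n => I n `*` I n) => [|n]; last first.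
  split; first exact: measurableX.
  rewrite product_measure1E; [|exact: mI|exact: mI].
  apply: lte_mul_pinfty => //; last exact: (fI n).
  by rewrite ge0_fin_numE; [exact: (fI n)|exact: measure_ge0].
apply/seteqP; split=> // -[a b] _; exists (Num.trunc (`|a| + `|b|)).+1 => //=.
have := truncnS_gt (`|a| + `|b|).
set k := (_%:R) => h; split; rewrite /I /= in_itv /= -ler_norml; apply: ltW; apply: le_lt_trans h.
  by rewrite lerDl.
by rewrite lerDr.
Qed.

(** Fubini on (R x R) x R takes its first factor as a bundled sigma-finite measure; this is the
    bundled form of the measure on the plane. *)
Definition plane_measure : {sigma_finite_measure set T2 -> \bar R} :=
  HB.pack_for (SigmaFiniteMeasure.type T2 R) (mu \x mu)%E (Measure_isSigmaFinite.Build _ _ _ (mu \x mu)%E sigma_finite_plane).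

(** The order of integration is chosen for each [i] so that the innermost integral runs along the
    i-th axis, where the fundamental theorem makes it vanish. *)
Lemma integral_partial0 w M i : sm w -> (forall x, ~ cube M x -> w x = 0) ->
  (\int[mu3]_(x in [set: T3]) (partial i w (pt (x : R * R * R)))%:E = 0)%E.
Proof.
move=> sw w0.
have cp : continuous (partial i w) by exact: (sm_continuous (sm_partial i sw)).
have p0 := partial_supp i (@cube_closed M) w0.
have int3 : mu3.-integrable [set: T3] (EFin \o (partial i w \o @pt R)).
  exact: integrable_cube cp p0.
elim/I3_ind: i cp p0 int3 => cp p0 int3.
- rewrite -(@integral21_prod_meas1 _ _ _ _ R plane_measure mu _ int3) integral0_eq // => z _.
  rewrite /fubini_G -(integral21_prod_meas1 (integrable_slice z cp p0)) integral0_eq // => y _.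
  exact: (@integral_ptline w M 0 ((0, y), z)).
- rewrite -(@integral21_prod_meas1 _ _ _ _ R plane_measure mu _ int3) integral0_eq // => z _.
  rewrite /fubini_G -(integral12_prod_meas1 (integrable_slice z cp p0)) integral0_eq // => y _.
  exact: (@integral_ptline w M 1 ((y, 0), z)).
- rewrite -(@integral12_prod_meas1 _ _ _ _ R plane_measure mu _ int3) integral0_eq // => -[x y] _.
  exact: (@integral_ptline w M 2 ((x, y), 0)).
Qed.

End SobolevSmooth.

(** * Integration by parts and Sobolev regularity on a bounded open set *)

Section SobolevOfSmooth.
Context (R : realType).
Local Notation E := 'rV[R]_3.
Local Notation sm := (smooth (@setT E)).
Local Notation mu := (@lebesgue_measure R).
Local Notation mu3 := ((mu \x mu) \x mu)%E.
Local Notation T3 := (measurableTypeR R * measurableTypeR R * measurableTypeR R)%type.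
Implicit Types (f g u w phi : E -> R) (x : E) (O : set E).

Lemma bounded_cube O : bounded_set O -> exists M, O `<=` cube M.
Proof.
move=> /pinfty_ex_gt0[M M0 HM]; exists M => x Ox i.
by apply: le_trans (norm_rV_le x i) _; exact: HM Ox.
Qed.

Lemma sm_partials s u : sm u -> sm (partials s u).
Proof. by move=> su; elim: s => [|i s IH]; [exact: su|exact: (sm_partial i IH)]. Qed.

(** As [phi] is supported inside [O], both integrals extend by zero to the whole space, where the
    derivative of u phi has integral zero. *)
Lemma integral3_by_parts O C i u phi : open O -> bounded_set O -> closed C ->
  C `<=` O -> (forall x, ~ C x -> phi x = 0) -> sm u -> sm phi ->
  integral3 O (fun x => u x * partial i phi x) =
  - integral3 O (fun x => partial i u x * phi x).
Proof.
move=> oO bO cC CO phi0 su sphi; have [M OM] := bounded_cube bO.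
have outM x : ~ cube M x -> ~ C x by move=> nM /CO /OM.
have dphi0 := partial_supp i cC phi0.
have ext g : (forall x, ~ C x -> g x = 0) ->
    integral3 O g = Rintegral mu3 [set: T3] (g \o @pt R).
  move=> g0; rewrite /integral3 Rintegral_mkcond; congr (Rintegral _ _ _).
  apply/funext => x; rewrite /patch; case: ifPn => // /negP nx.
  by rewrite /= g0 // => /CO h; apply: nx; rewrite inE.
have int g : sm g -> (forall x, ~ C x -> g x = 0) ->
    mu3.-integrable [set: T3] (EFin \o (g \o @pt R)).
  move=> sg g0; apply: (@integrable_cube R g M (sm_continuous sg)).
  by move=> x /outM; exact: g0.
have s1 : sm (fun x => u x * partial i phi x) by exact: (sm_mul su (sm_partial i sphi)).
have s2 : sm (fun x => partial i u x * phi x) by exact: (sm_mul (sm_partial i su) sphi).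
have z1 x : ~ C x -> u x * partial i phi x = 0 by move=> /dphi0 ->; rewrite mulr0.
have z2 x : ~ C x -> partial i u x * phi x = 0 by move=> /phi0 ->; rewrite mulr0.
rewrite (ext _ z1) (ext _ z2).
apply/eqP; rewrite -addr_eq0; apply/eqP.
rewrite -(RintegralD measurableT (int _ s1 z1) (int _ s2 z2)) /Rintegral.
have s3 : sm (fun x => u x * phi x) by exact: (sm_mul su sphi).
have z3 x : ~ cube M x -> u x * phi x = 0 by move=> /outM /phi0 ->; rewrite mulr0.
rewrite -[RHS]/(fine 0%E) -(integral_partial0 i s3 z3).
by congr fine; apply: eq_integral => x _ /=; rewrite (partialM _ _ su sphi) addrC.
Qed.

(** The outermost derivative of [phi] is moved first and so acts innermost on [u]; this reverses the
    word. *)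
Lemma weak_partials_smooth O s u : open O -> bounded_set O -> sm u ->
  weak_partials O s u (partials (rev s) u).
Proof.
move=> oO bO su phi [sphi [C [cC CO] phi0]].
have clC : closed C by exact: compact_closed cC.
elim: s u su => [|i s IH] u su.
  by rewrite expr0 mul1r.
have dphi : forall s x, ~ C x -> partials s phi x = 0.
  by elim=> //= j s' IH' x; exact: (partial_supp j clC IH').
rewrite /= (integral3_by_parts i oO bO clC CO (dphi s) su (sm_partials s sphi)).
by rewrite (IH _ (sm_partial i su)) rev_cons partials_rcons exprS mulN1r mulNr.
Qed.

Lemma L2_smooth O u : open O -> bounded_set O -> sm u -> L2 O u.
Proof.
move=> oO bO su; have [M OM] := bounded_cube bO.
have mO := measurable_pt oO.
split.
  by apply: (measurable_funTS (measurable_fun_pt (sm_continuous su))).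
have s2 := sm_mul su su.
have H : mu3.-integrable (@pt R @^-1` O : set T3) (EFin \o ((fun y => u y * u y) \o @pt R)).
  apply: measurable_bounded_integrable => //.
  - apply: le_lt_trans (mu_cube M); apply: le_measure; rewrite ?inE //.
      exact: measurable_cube.
    by move=> x /OM.
  - by apply: (measurable_funTS (measurable_fun_pt (sm_continuous s2))).
  have [B HB] := cube_bounded_fun M (sm_continuous s2).
  exists B; split; first exact: num_real.
  by move=> y By x Ox; apply: le_trans (ltW By); apply: HB; exact: OM.
by move: H; congr (integrable _ _ _).
Qed.

Lemma sobolev_smooth O k u : open O -> bounded_set O -> sm u -> sobolev O k u.
Proof.
move=> oO bO su; split; first exact: (L2_smooth oO bO su).
move=> s _; exists (partials (rev s) u); split.
  exact: (L2_smooth oO bO (sm_partials (rev s) su)).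
exact: (weak_partials_smooth s oO bO su).
Qed.

End SobolevOfSmooth.

(** * Lie algebras of compact matrix groups *)

Section MatrixExponential.
Context (R : realType) (n : nat).
Local Notation M := 'M[R]_n.+1.
Implicit Types (A B X : M) (t s : R).

Lemma cvg_mx_coord (T : Type) (F : set_system T) (FF : Filter F) (u : T -> M) (L : M) :
  (forall i j, (fun x => u x i j) @ F --> L i j) -> u @ F --> L.
Proof.
move=> H; apply/cvgrPdist_le => e e0; near=> x.
rewrite [leLHS]/Num.Def.normr /= mx_normrE (bigmax_le _ (ltW e0)) //= => i _.
rewrite !mxE; move: i; near: x; apply: filter_forall => i.
exact: ((cvgrPdist_le _ _).1 (H i.1 i.2)).
Unshelve. all: by end_near. Qed.

Lemma mx_norm_coord A i j : `|A i j| <= `|A|.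
Proof.
rewrite [leRHS]/Num.Def.normr /= mx_normrE.
exact: (@le_bigmax _ _ _ 0 (fun ij => `|A ij.1 ij.2|) (i, j)).
Qed.

Lemma mx_norm_leP A (e : R) : 0 <= e -> (forall i j, `|A i j| <= e) -> `|A| <= e.
Proof.
by move=> e0 H; rewrite [leLHS]/Num.Def.normr /= mx_normrE; apply: bigmax_le.
Qed.

(** The norm is the largest absolute value of an entry, which is submultiplicative only up to the
    dimension. *)
Lemma mx_normM A B : `|A *m B| <= n.+1%:R * (`|A| * `|B|).
Proof.
apply: mx_norm_leP => [|i j]; first by rewrite mulr_ge0 // mulr_ge0.
rewrite mxE; apply: le_trans (ler_norm_sum _ _ _) _.
apply: (@le_trans _ _ (\sum_(l < n.+1) `|A| * `|B|)).
  by apply: ler_sum => l _; rewrite normrM ler_pM // mx_norm_coord.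
by rewrite sumr_const card_ord mulr_natl.
Qed.

Lemma expmx_coef_bound A k i j : `|(A ^+ k) i j| <= (n.+1%:R * `|A|) ^+ k.
Proof.
elim: k i j => [|k IH] i j.
  by rewrite !expr0 -[1 in X in X <= _]/(1%:M) mxE; case: eqP => _; rewrite ?normr1 ?normr0.
rewrite exprS mxE; apply: le_trans (ler_norm_sum _ _ _) _.
apply: (@le_trans _ _ (\sum_(l < n.+1) `|A| * (n.+1%:R * `|A|) ^+ k)).
  by apply: ler_sum => l _; rewrite normrM ler_pM // mx_norm_coord.
by rewrite sumr_const card_ord exprS; set q := (_ * `|A|) ^+ k; rewrite -mulrA [leRHS]mulr_natl.
Qed.

(** Power series coefficients in t of the (i, j) entry of A^m exp(tA). The shift by [m] closes the
    family under termwise differentiation. *)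
Definition expc A m i j : R^nat := fun k => (A ^+ (k + m)) i j / k`!%:R.

Lemma expc_diffs A m i j : pseries_diffs (expc A m i j) = expc A m.+1 i j.
Proof.
apply/funext => k; rewrite /pseries_diffs /expc addSnnS factS natrM invfM.
by rewrite mulrCA mulVKf ?pnatr_eq0.
Qed.

Lemma expc_cvg A m i j t : cvgn (pseries (expc A m i j) t).
Proof.
set c := n.+1%:R * `|A|; have c0 : 0 <= c by rewrite /c mulr_ge0.
apply: normed_cvg.
apply: (@series_le_cvg R _ (fun k => c ^+ m * (c * `|t|) ^+ k / k`!%:R)).
- by move=> k; apply: normr_ge0.
- by move=> k; rewrite divr_ge0 // mulr_ge0 ?exprn_ge0 // mulr_ge0.
- move=> k; rewrite /= /expc !normrM normfV [`|k`!%:R|]ger0_norm // normrX.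
  have E (x y z : R) : x ^+ m * (x * y) ^+ k / z = x ^+ (k + m) * (z^-1 * y ^+ k).
    by rewrite exprD exprMn; ring.
  rewrite E.
  rewrite -mulrA; apply: ler_wpM2r; last exact: expmx_coef_bound.
  by rewrite mulr_ge0 ?exprn_ge0 ?invr_ge0.
- have -> : (fun k => c ^+ m * (c * `|t|) ^+ k / k`!%:R) =
      c ^+ m *: exp_coeff (c * `|t|).
    by apply/funext => k; rewrite -mulrA.
  apply: is_cvg_seriesZ; exact: is_cvg_series_exp_coeff.
Qed.

Definition expE A m t i j : R := limn (pseries (expc A m i j) t).

Lemma is_derive_expE A m i j t :
  is_derive t 1 (fun t => expE A m t i j) (expE A m.+1 t i j).
Proof.
rewrite /expE -expc_diffs; apply: (@pseries_snd_diffs _ _ (`|t| + 1)).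
- exact: expc_cvg.
- by rewrite expc_diffs; exact: expc_cvg.
- by rewrite !expc_diffs; exact: expc_cvg.
- by rewrite [ltRHS]ger0_norm ?ltrDl // addr_ge0.
Qed.

Lemma expmxE A t i j : expmx (t *: A) i j = expE A 0 t i j.
Proof.
have -> : expmx (t *: A) = \matrix_(i, j) expE A 0 t i j; last by rewrite mxE.
apply/cvg_lim => //; apply: cvg_mx_coord => {}i {}j; rewrite mxE.
have : pseries (expc A 0 i j) t @ \oo --> expE A 0 t i j by exact: expc_cvg.
congr (cvg_to _ _).
apply: (f_equal (fun F => F @ \oo)); apply/funext => k.
rewrite /series /pseries /= summxE; apply: eq_bigr => l _.
by rewrite !mxE exprZn mxE /expc addn0; ring.
Qed.

Lemma expES A m t i j : expE A m.+1 t i j = \sum_l A i l * expE A m t l j.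
Proof.
apply/cvg_lim => //.
have -> : pseries (expc A m.+1 i j) t =
    (fun k => \sum_l A i l * pseries (expc A m l j) t k).
  apply/funext => k; rewrite /pseries /series /=.
  under [RHS]eq_bigr do rewrite mulr_sumr.
  rewrite exchange_big /=; apply: eq_bigr => p _.
  rewrite /expc addnS exprS mxE !mulr_suml; apply: eq_bigr => l _; ring.
apply: cvg_big => [|l _]; first exact: add_continuous.
by apply: cvgM; [exact: cvg_cst|exact: expc_cvg].
Qed.


Lemma expESr A m t i j : expE A m.+1 t i j = \sum_l expE A m t i l * A l j.
Proof.
apply/cvg_lim => //.
have -> : pseries (expc A m.+1 i j) t =
    (fun k => \sum_l pseries (expc A m i l) t k * A l j).
  apply/funext => k; rewrite /pseries /series /=.
  under [RHS]eq_bigr do rewrite mulr_suml.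
  rewrite exchange_big /=; apply: eq_bigr => p _.
  rewrite /expc addnS exprSr mxE !mulr_suml; apply: eq_bigr => l _; ring.
apply: cvg_big => [|l _]; first exact: add_continuous.
by apply: cvgM; [exact: expc_cvg|exact: cvg_cst].
Qed.

Lemma is_derive_mxP (y : R -> M) (Y : M) t :
  is_derive t 1 y Y <-> forall i j, is_derive t 1 (fun s => y s i j) (Y i j).
Proof.
split=> [[dy <-] i j|H].
  split; first exact: (derivable_mxP _ _ _).1 dy i j.
  by rewrite derive_mx // mxE.
have dy : derivable y t 1 by apply/derivable_mxP => i j; have [] := H i j.
split=> //; rewrite derive_mx //; apply/matrixP => i j; rewrite mxE.
by have [] := H i j.
Qed.

Lemma is_derive_mulmx (y z : R -> M) (Y Z : M) t :
  is_derive t 1 y Y -> is_derive t 1 z Z ->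
  is_derive t 1 (fun s => y s *m z s) (Y *m z t + y t *m Z).
Proof.
move=> /is_derive_mxP dy /is_derive_mxP dz; apply/is_derive_mxP => i j.
have -> : (fun s => (y s *m z s) i j) = \sum_l (fun s => y s i l * z s l j).
  by apply/funext => s; rewrite mxE fct_sumE.
rewrite !mxE -big_split /=.
apply: is_derive_sum => l; apply: (is_derive_eq (is_deriveM (dy i l) (dz l j))).
by rewrite addrC; congr (_ + _); exact: mulrC.
Qed.

Lemma is_derive_mulmxl (g : M) (y : R -> M) (Y : M) t :
  is_derive t 1 y Y -> is_derive t 1 (fun s => g *m y s) (g *m Y).
Proof.
move=> dy; have := is_derive_mulmx (is_derive_cst g t 1) dy.
by rewrite mul0mx add0r.
Qed.

Lemma is_derive_mulmxr (g : M) (y : R -> M) (Y : M) t :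
  is_derive t 1 y Y -> is_derive t 1 (fun s => y s *m g) (Y *m g).
Proof.
move=> dy; have := is_derive_mulmx dy (is_derive_cst g t 1).
by rewrite mulmx0 addr0.
Qed.

Lemma is_derive_expmx A t :
  is_derive t 1 (fun s => expmx (s *: A)) (A *m expmx (t *: A)).
Proof.
apply/is_derive_mxP => i j; rewrite mxE.
have -> : (fun s => expmx (s *: A) i j) = (fun s => expE A 0 s i j).
  by apply/funext => s; rewrite expmxE.
rewrite (eq_bigr (fun l => A i l * expE A 0 t l j)); last by move=> l _; rewrite expmxE.
by rewrite -expES; exact: is_derive_expE.
Qed.

Lemma expmx_comm A t : A *m expmx (t *: A) = expmx (t *: A) *m A.
Proof.
apply/matrixP => i j; rewrite !mxE.
rewrite (eq_bigr (fun l => A i l * expE A 0 t l j)); last by move=> l _; rewrite expmxE.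
rewrite [RHS](eq_bigr (fun l => expE A 0 t i l * A l j)); last by move=> l _; rewrite expmxE.
by rewrite -expES -expESr.
Qed.

Lemma expmx0 : expmx (0 : M) = 1%:M.
Proof.
apply: lim_near_cst => //; near=> k.
have k0 : (0 < k)%N by near: k; exact: nbhs_infty_gt.
rewrite /series /= -(prednK k0) big_nat_recl // big1 ?addr0.
  by rewrite expr0 fact0 invr1 scale1r.
by move=> i _; rewrite expr0n /= scaler0.
Unshelve. all: by end_near. Qed.

Lemma is_derive0_cst (y : R -> M) : (forall t : R, is_derive t 1 y 0) ->
  forall s t, y s = y t.
Proof.
move=> dy s t; apply/matrixP => i j.
apply: (@is_derive_0_is_cst R (fun s => y s i j)) => u.
by have /is_derive_mxP/(_ i j) := dy u; rewrite mxE.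
Qed.

Lemma is_derive_expmxN A t :
  is_derive t 1 (fun s => expmx ((- s) *: A)) (- (A *m expmx ((- t) *: A))).
Proof.
have := is_derive_expmx (- A) t; rewrite mulNmx scalerN -scaleNr.
by congr (is_derive _ _ _ _); apply/funext => s; rewrite scalerN -scaleNr.
Qed.

(** The product has derivative zero. This uniqueness principle yields the inverse and the addition
    law of the exponential, and its behaviour under conjugation. *)
Lemma linear_ode (y : R -> M) B : (forall t : R, is_derive t 1 y (y t *m B)) ->
  forall t, y t *m expmx ((- t) *: B) = y 0.
Proof.
move=> dy t.
have H : forall s : R, is_derive s 1 (fun s => y s *m expmx ((- s) *: B)) 0.
  move=> s; apply: (is_derive_eq (is_derive_mulmx (dy s) (is_derive_expmxN B s))).
  by rewrite mulmxN mulmxA subrr.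
by rewrite (is_derive0_cst H t 0) oppr0 scale0r expmx0 mulmx1.
Qed.

Lemma expmxNK A t : expmx (t *: A) *m expmx ((- t) *: A) = 1%:M.
Proof.
have H (s : R) : is_derive s 1 (fun s => expmx (s *: A)) (expmx (s *: A) *m A).
  by rewrite -expmx_comm; exact: is_derive_expmx.
by rewrite (linear_ode H) scale0r expmx0.
Qed.

Lemma linear_odeE (y : R -> M) B : (forall t : R, is_derive t 1 y (y t *m B)) ->
  forall t, y t = y 0 *m expmx (t *: B).
Proof.
move=> dy t; rewrite -(linear_ode dy t) -mulmxA.
by have := expmxNK B (- t); rewrite opprK => ->; rewrite mulmx1.
Qed.

Lemma expmxD A s t : expmx ((s + t) *: A) = expmx (s *: A) *m expmx (t *: A).
Proof.
pose y (u : R) := expmx ((u + s) *: A).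
have dy (u : R) : is_derive u 1 y (y u *m A).
  have := is_derive_expmx A (u + s); rewrite expmx_comm => -[H1 H2].
  have E : (fun h => h^-1 *: ((y \o shift u) (h *: 1) - y u)) =
      (fun h => h^-1 *: (((fun v => expmx (v *: A)) \o shift (u + s)) (h *: 1) - expmx ((u + s) *: A))).
    by apply/funext => h; rewrite /y /= addrA.
  by split; [rewrite /derivable E; exact: H1|rewrite /derive E; exact: H2].
by have := linear_odeE dy t; rewrite /y add0r addrC.
Qed.

End MatrixExponential.

(** * The Lie algebra of a compact group: linearity and invariance under conjugation *)

Section LieAlgebraOfGroup.
Context (R : realType) (n : nat) (K : set 'M[R]_n.+1).
Local Notation M := 'M[R]_n.+1.
Hypotheses (gK : matrix_group K) (cK : compact K).
Implicit Types (A B X g h : M).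

Lemma matrix_group_exp g i : K g -> K (g ^+ i).
Proof.
have [_ K1 KM _] := gK => Kg; elim: i => [|i IH]; first by rewrite expr0.
by rewrite exprS; exact: KM.
Qed.

Lemma matrix_group_bounded : exists2 C, 0 < C & forall g, K g -> `|g| <= C.
Proof.
have /pinfty_ex_gt0[C C0 HC] := compact_bounded cK.
by exists C => // g; exact: HC.
Qed.

Lemma expmx_bounded X : exists2 D, 0 < D & forall s, 0 <= s <= 1 -> `|expmx (s *: X)| <= D.
Proof.
have cX : continuous (fun s : R => expmx (s *: X)).
  move=> s; apply: differentiable_continuous; apply/derivable1_diffP.
  by have [] := is_derive_expmx X s.
have := continuous_compact (continuous_subspaceT cX) (@segment_compact R 0 1).
move=> /compact_bounded/pinfty_ex_gt0[D D0 HD]; exists D => // s s01; apply: HD.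
by exists s; rewrite //= in_itv.
Qed.

(** Telescoping of g^j - h^j into terms g^a (g - h) h^b. Powers of the norm of [g] could blow up, so
    bounds on the powers themselves are assumed; the prefactor g^i lets the induction absorb one [g]
    at each step. *)
Lemma pow_diff_bound g h (C D : R) m : 0 <= C -> 0 <= D ->
  (forall i, `|g ^+ i| <= C) -> (forall j, (j <= m)%N -> `|h ^+ j| <= D) ->
  forall i j, (j <= m)%N ->
  `|g ^+ i * (g ^+ j - h ^+ j)| <= j%:R * (n.+1%:R * (C * (n.+1%:R * (`|g - h| * D)))).
Proof.
move=> C0 D0 gC hD i j; elim: j i => [|j IH] i jm.
  by rewrite !expr0 subrr mulr0 normr0 mul0r.
have -> : g ^+ i * (g ^+ j.+1 - h ^+ j.+1) =
    g ^+ i.+1 * (g ^+ j - h ^+ j) + g ^+ i * ((g - h) * h ^+ j).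
  rewrite [in g ^+ i.+1]exprSr -mulrA -mulrDr; congr (_ * _).
  by rewrite mulrBr mulrBl -!exprS addrA subrK.
have SE (x : R) : j.+1%:R * x = j%:R * x + x by rewrite -natr1 mulrDl mul1r.
apply: le_trans (ler_normD _ _) _; rewrite SE; apply: lerD.
  exact: IH (ltnW jm).
apply: le_trans (mx_normM _ _) _; apply: ler_wpM2l => //.
apply: ler_pM => //; apply: le_trans (mx_normM _ _) _; apply: ler_wpM2l => //.
by apply: ler_wpM2l => //; exact: hD (ltnW jm).
Qed.

(** exp X is the limit of y(1/m)^m. These powers lie in [K], hence are bounded by compactness, and
    [K] is closed. *)
Lemma path_velocity (y : R -> M) X : y 0 = 1%:M -> (forall s, K (y s)) ->
  is_derive (0 : R) 1 y X -> K (expmx X).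
Proof.
move=> y0 Ky dy.
have [C C0 HC] := matrix_group_bounded.
have [D D0 HD] := expmx_bounded X.
have clK : closed K by exact: compact_closed cK.
apply: clK => U /nbhs_ballP[e /= e0 eU].
pose q : R := n.+1%:R * (C * (n.+1%:R * D)).
have q0 : 0 < q by rewrite !mulr_gt0.
(* With s = 1/(m+1), the m+1 telescoping terms, each at most q ee s, add up to e/2. *)
pose ee := e / 2 / q; have ee0 : 0 < ee by rewrite !divr_gt0.
pose z s := y s - expmx (s *: X).
have dz : is_derive (0 : R) 1 z 0.
  apply: (is_derive_eq (is_deriveB dy (is_derive_expmx X 0))).
  by rewrite scale0r expmx0 mulmx1 subrr.
have z0 : z 0 = 0 by rewrite /z y0 scale0r expmx0 subrr.
have [dz1 dz2] := dz; have := dz1; rewrite /derivable -/(derive z 0 1) dz2.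
move=> /cvgrPdist_le/(_ ee ee0); rewrite near_withinE => /nbhs_ballP[d /= d0 Hd].
have [m md] : exists m : nat, m.+1%:R^-1 < d.
  by near \oo => m; exists m; near: m; exact: (near_infty_natSinv_lt (PosNum d0)).
pose s : R := m.+1%:R^-1.
have s0 : 0 < s by rewrite /s invr_gt0.
have zs : `|z s| <= ee * s.
  have /Hd : ball_ Num.norm (0 : R) d s by rewrite /= sub0r normrN gtr0_norm.
  move=> /(_ (lt0r_neq0 s0)); rewrite z0 subr0 sub0r normrN addr0 [_%:A]mulr1.
  by rewrite normrZ normfV gtr0_norm // ler_pdivrMl // mulrC.
have hj j : expmx (s *: X) ^+ j = expmx ((j%:R * s) *: X).
  elim: j => [|j IH]; first by rewrite expr0 mul0r scale0r expmx0.
  by rewrite exprS IH -(natr1 j) mulrDl mul1r addrC expmxD.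
exists (y s ^+ m.+1); split; first exact: matrix_group_exp.
apply: eU; rewrite -ball_normE /= distrC.
have -> : expmx X = expmx (s *: X) ^+ m.+1.
  by rewrite hj /s mulfV ?scale1r // pnatr_eq0.
have := @pow_diff_bound (y s) (expmx (s *: X)) C D m.+1 (ltW C0) (ltW D0) _ _ 0 m.+1 (leqnn _).
rewrite expr0 mul1r => H; apply: le_lt_trans (H _ _) _.
- by move=> i; apply: HC; exact: matrix_group_exp.
- move=> j jm; rewrite hj; apply: HD; rewrite mulr_ge0 ?(ltW s0) //=.
  by rewrite /s ler_pdivrMr // mul1r ler_nat.
apply: (@le_lt_trans _ _ (m.+1%:R * (q * (ee * s)))).
  have E (x : R) : q * x = n.+1%:R * (C * (n.+1%:R * (D * x))) by rewrite /q; ring.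
  rewrite E; apply: ler_wpM2l => //; apply: ler_wpM2l => //.
  apply: ler_wpM2l; first exact: ltW.
  by apply: ler_wpM2l => //; rewrite mulrC; apply: ler_wpM2l; [exact: ltW|exact: zs].
have m0 : m.+1%:R != 0 :> R by rewrite pnatr_eq0.
have -> : m.+1%:R * (q * (ee * s)) = e / 2.
  have F (a b c f : R) : a * (b * (c * f)) = (a * f) * (c * b) by ring.
  by rewrite F /s mulfV // mul1r /ee divfK // lt0r_neq0.
by rewrite ltr_pdivrMr // ltr_pMr // ltr1n.
Unshelve. all: by end_near. Qed.

Local Notation k := (lie_algebra K).

Lemma lie_scale A c : k A -> k (c *: A).
Proof. by move=> kA t; rewrite scalerA; exact: kA. Qed.

Lemma lie0 : k 0.
Proof. by move=> t; rewrite scaler0 expmx0; have [] := gK. Qed.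

(** The path exp(s t A) exp(s t B) in [K] has velocity t(A + B) at s = 0. *)
Lemma lie_add A B : k A -> k B -> k (A + B).
Proof.
move=> kA kB t; have [_ K1 KM _] := gK.
apply: (@path_velocity (fun s => expmx (s *: (t *: A)) *m expmx (s *: (t *: B)))).
- by rewrite !scale0r expmx0 mulmx1.
- by move=> s; apply: KM; rewrite scalerA; [exact: kA|exact: kB].
apply: (is_derive_eq (is_derive_mulmx (is_derive_expmx (t *: A) 0) (is_derive_expmx (t *: B) 0))).
by rewrite !scale0r expmx0 !mulmx1 mul1mx scalerDr.
Qed.

(** g exp(tA) g^-1 solves the differential equation of the one-parameter group of g A g^-1. *)
Lemma lie_Ad g A : K g -> k A -> k (g *m A *m invmx g).
Proof.
have [KU K1 KM KV] := gK => Kg kA t.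
have gu : g \in unitmx by exact: KU.
pose y (s : R) := g *m expmx (s *: A) *m invmx g.
have dy (s : R) : is_derive s 1 y (y s *m (g *m A *m invmx g)).
  apply: (is_derive_eq (is_derive_mulmxr (invmx g) (is_derive_mulmxl g (is_derive_expmx A s)))).
  by rewrite /y expmx_comm !mulmxA mulmxKV.
have := linear_odeE dy t; rewrite {2}/y scale0r expmx0 mulmx1 mulmxV // mul1mx => <-.
by rewrite /y; apply: (KM); [apply: (KM) => //; exact: kA|exact: KV].
Qed.

End LieAlgebraOfGroup.

(** * Spectral consequences of a bounded one-parameter group *)

Section BoundedOneParameterGroup.
Context (R : realType) (n : nat).
Local Notation M := 'M[R]_n.+1.
Implicit Types (A X Y : M).

Lemma is_derive_mull (k s : R) : is_derive s 1 (fun x : R => k * x) k.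
Proof.
apply: (is_derive_eq (is_deriveZ k (is_derive_id s 1))).
by rewrite /GRing.scale /= mulr1.
Qed.

(* N = |X exp(tA)|^2 + |Y exp(tA)|^2 satisfies N' = 2 a N, so it is unbounded unless a = 0. *)
Lemma bounded_expmx_eigen A X Y (a b C : R) :
  (forall t, `|expmx (t *: A)| <= C) ->
  X *m A = a *: X - b *: Y -> Y *m A = b *: X + a *: Y ->
  X != 0 \/ Y != 0 -> a = 0.
Proof.
move=> HC XA YA XY0.
pose U t := X *m expmx (t *: A); pose Z t := Y *m expmx (t *: A).
have dU (t : R) : is_derive t 1 U (a *: U t - b *: Z t).
  apply: (is_derive_eq (is_derive_mulmxl X (is_derive_expmx A t))).
  by rewrite mulmxA XA mulmxBl -!scalemxAl.
have dZ (t : R) : is_derive t 1 Z (b *: U t + a *: Z t).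
  apply: (is_derive_eq (is_derive_mulmxl Y (is_derive_expmx A t))).
  by rewrite mulmxA YA mulmxDl -!scalemxAl.
pose N t := \sum_i \sum_j (U t i j ^+ 2 + Z t i j ^+ 2).
have dN (t : R) : is_derive t 1 N (2 * a * N t).
  have /is_derive_mxP du := dU t; have /is_derive_mxP dz := dZ t.
  have -> : 2 * a * N t = \sum_i \sum_j 2 * a * (U t i j ^+ 2 + Z t i j ^+ 2).
    by rewrite mulr_sumr; apply: eq_bigr => i _; rewrite mulr_sumr.
  have -> : N = \sum_i \sum_j (fun t => U t i j ^+ 2 + Z t i j ^+ 2).
    by apply/funext => s; rewrite fct_sumE; apply: eq_bigr => i _; rewrite fct_sumE.
  apply: is_derive_sum => i; apply: is_derive_sum => j.
  apply: (is_derive_eq (is_deriveD (is_deriveM (du i j) (du i j)) (is_deriveM (dz i j) (dz i j)))).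
  by rewrite !mxE /GRing.scale /=; ring.
have N0 : 0 < N 0.
  have sq i j : 0 <= U 0 i j ^+ 2 + Z 0 i j ^+ 2 by rewrite addr_ge0 ?sqr_ge0.
  rewrite lt0r sumr_ge0 ?andbT; last by move=> i _; rewrite sumr_ge0.
  apply/negP; rewrite psumr_eq0; last by move=> i _; rewrite sumr_ge0.
  move=> /allP H.
  have H' i j : (X i j == 0) && (Y i j == 0).
    have := H i (mem_index_enum i); rewrite psumr_eq0 // => /allP/(_ j (mem_index_enum j)).
    by rewrite paddr_eq0 ?sqr_ge0 // !sqrf_eq0 /U /Z scale0r expmx0 !mulmx1.
  case: XY0 => /eqP; apply; apply/matrixP => i j; rewrite mxE;
    by have /andP[/eqP ? /eqP ?] := H' i j.
have HN t : N t = N 0 * expR (2 * a * t).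
  pose P s := N s * expR (- (2 * a) * s).
  have dP (s : R) : is_derive s 1 P 0.
    have d2 := is_derive1_comp (is_derive_expR (- (2 * a) * s)) (is_derive_mull (- (2 * a)) s).
    apply: (is_derive_eq (is_deriveM (dN s) d2)).
    by rewrite /GRing.scale /=; ring.
  have := is_derive_0_is_cst t 0 dP; rewrite /P mulr0 expR0 mulr1 => <-.
  by rewrite -mulrA -expRD mulNr addNr expR0 mulr1.
have [B HB] : exists B, forall t, N t <= B.
  pose q := n.+1%:R * (`|X| * C); pose q' := n.+1%:R * (`|Y| * C).
  exists (\sum_(i < n.+1) \sum_(j < n.+1) (q ^+ 2 + q' ^+ 2)) => t.
  apply: ler_sum => i _; apply: ler_sum => j _.
  have bd W : `|(W *m expmx (t *: A)) i j| <= n.+1%:R * (`|W| * C).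
    apply: le_trans (mx_norm_coord _ _ _) _; apply: le_trans (mx_normM _ _) _.
    by apply: ler_wpM2l => //; apply: ler_wpM2l.
  have sqr_le (x y : R) : `|x| <= y -> x ^+ 2 <= y ^+ 2.
    move=> xy; rewrite -[x ^+ 2]real_normK ?num_real //.
    by rewrite lerXn2r // nnegrE ?normr_ge0 // (le_trans _ xy).
  by apply: lerD; apply: sqr_le; exact: bd.
apply/eqP/negP => /negP a0.
have B0 : 0 < B by apply: lt_le_trans (HB 0).
(* At this time, whatever the sign of [a], N = N(0) exp(B/N(0)) >= N(0) + B, against the bound
   [B]. *)
have := HB (B / N 0 / (2 * a)); rewrite HN.
rewrite [2 * a * _]mulrC divfK ?mulf_neq0 // => H.
have := le_trans (ler_wpM2l (ltW N0) (expR_ge1Dx (B / N 0))) H.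
by rewrite mulrDr mulr1 mulrC divfK ?gt_eqF // gerDr leNgt N0.
Qed.

(** If A^(m+2) = 0, then A^m exp(tA) = A^m + t A^(m+1); boundedness in t forces A^(m+1) = 0, and the
    exponent descends to 1. *)
Lemma bounded_expmx_nilpotent A (C : R) m : (forall t, `|expmx (t *: A)| <= C) ->
  A ^+ m = 0 -> A = 0.
Proof.
move=> HC; elim: m => [|m IH] Am.
  by move/eqP: Am; rewrite expr0 oner_eq0.
case: m => [|m] in IH Am *; first by rewrite expr1 in Am.
apply: IH; pose y t := A ^+ m *m expmx (t *: A).
have dz (t : R) : is_derive t 1 (fun t => A ^+ m.+1 *m expmx (t *: A)) 0.
  apply: (is_derive_eq (is_derive_mulmxl (A ^+ m.+1) (is_derive_expmx A t))).
  by rewrite mulmxA [A ^+ m.+1 *m A](_ : _ = 0) ?mul0mx // -[_ *m _]/(_ * _) -exprSr.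
have zE t : A ^+ m.+1 *m expmx (t *: A) = A ^+ m.+1.
  by rewrite (is_derive0_cst dz t 0) scale0r expmx0 mulmx1.
have dy (t : R) : is_derive t 1 y (A ^+ m.+1).
  apply: (is_derive_eq (is_derive_mulmxl (A ^+ m) (is_derive_expmx A t))).
  by rewrite mulmxA -[RHS](zE t) exprSr.
have yE t : y t = A ^+ m + t *: A ^+ m.+1.
  pose w t := y t - t *: A ^+ m.+1.
  have dw (s : R) : is_derive s 1 w 0.
    apply/is_derive_mxP => i j.
    have /is_derive_mxP/(_ i j) d1 := dy s.
    have d2 : is_derive s 1 (fun s : R => s * (A ^+ m.+1) i j) ((A ^+ m.+1) i j).
      have -> : (fun s : R => s * (A ^+ m.+1) i j) = (fun s => (A ^+ m.+1) i j * s).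
        by apply/funext => u; rewrite mulrC.
      exact: is_derive_mull.
    have -> : (fun s => w s i j) = (fun s => y s i j) - (fun s => s * (A ^+ m.+1) i j).
      apply/funext => u; rewrite -[RHS]/(y u i j - u * (A ^+ m.+1) i j) /w.
      by move: (y u) => Yu; rewrite !mxE.
    by apply: (is_derive_eq (is_deriveB d1 d2)); rewrite subrr mxE.
  have := is_derive0_cst dw t 0.
  by rewrite /w scale0r subr0 {2}/y scale0r expmx0 mulmx1 => <-; rewrite subrK.
apply/matrixP => i j; rewrite [RHS]mxE; apply/eqP/negP => /negP a0.
pose q := n.+1%:R * (`|A ^+ m| * C) + `|A ^+ m|.
have q0 : 0 <= q.
  rewrite addr_ge0 // mulr_ge0 // mulr_ge0 //; apply: le_trans (HC 0).
  exact: normr_ge0.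
have bd t : `|t * (A ^+ m.+1) i j| <= q.
  have -> : t * (A ^+ m.+1) i j = (y t - A ^+ m) i j.
    by rewrite yE !mxE addrAC subrr add0r.
  apply: le_trans (mx_norm_coord _ _ _) _; apply: le_trans (ler_normB _ _) _.
  rewrite /q; apply: lerD => //; apply: le_trans (mx_normM _ _) _.
  by apply: ler_wpM2l => //; apply: ler_wpM2l.
have q1 : 0 <= q + 1 by rewrite addr_ge0.
have := bd ((q + 1) / (A ^+ m.+1) i j); rewrite divfK // ger0_norm //.
by rewrite gerDl leNgt ltr01.
Qed.

Local Notation cx := (real_complex R).

(** After complex triangularisation, boundedness makes the diagonal purely imaginary, so tr(A^2) is
    minus the sum of the squared imaginary parts. If it is zero, the diagonal vanishes, the
    characteristic polynomial is a power of X, and [A] is nilpotent. *)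
Lemma bounded_expmx_trace0 A (C : R) : (forall t, `|expmx (t *: A)| <= C) ->
  \tr (A *m A) = 0 -> A = 0.
Proof.
move=> HC trA.
pose Ac : 'M[complex R]_n.+1 := map_mx cx A.
have [P Pu Tt] := Schur Ac (ltn0Sn n).
have Pun : P \in unitmx by exact: unitarymx_unit.
have [T TE {}Tt] : exists2 T, T = P *m Ac *m invmx P & is_trig_mx T.
  by exists (conjmx P Ac); [exact: conjumx|exact: Tt].
have AcE : Ac = invmx P *m T *m P by rewrite TE !mulmxA mulVmx // mul1mx mulmxKV.
have eigT i : eigenvalue T (T i i).
  rewrite eigenvalue_root_char char_poly_trig // (bigD1 i) //= rootM.
  by rewrite root_XsubC eqxx.
have ReD : {morph (@complex.Re R) : x y / x + y} by move=> [a b] [c d].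
have ImD : {morph (@complex.Im R) : x y / x + y} by move=> [a b] [c d].
have Re0 : complex.Re (0 : complex R) = 0 by [].
have Im0 : complex.Im (0 : complex R) = 0 by [].
have ReMc (x : complex R) r : complex.Re (x * cx r) = complex.Re x * r.
  by case: x => a b /=; rewrite mulr0 subr0.
have ImMc (x : complex R) r : complex.Im (x * cx r) = complex.Im x * r.
  by case: x => a b /=; rewrite mulr0 add0r.
have eig i : complex.Re (T i i) = 0.
  have /eigenvalueP[v vT v0] := eigT i.
  have [w wE] : exists w, w = v *m P by exists (v *m P).
  have wA : w *m Ac = T i i *: w.
    by rewrite AcE wE !mulmxA mulmxK // vT -scalemxAl.
  have w0 : w != 0.
    apply/eqP => w0; move/eqP: v0; apply.
    by rewrite -(mulmxK Pun v) -wE w0 mul0mx.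
  (* Every row of [X] and [Y] is the real, respectively imaginary, part of the left eigenvector [w],
     which puts the eigenvector equation in square-matrix form. *)
  pose X : M := \matrix_(k, j) complex.Re (w 0 j); pose Y : M := \matrix_(k, j) complex.Im (w 0 j).
  have coef j : \sum_l w 0 l * cx (A l j) = T i i * w 0 j.
    move/matrixP/(_ 0 j): wA; rewrite !mxE => <-.
    by apply: eq_bigr => l _; rewrite !mxE.
  apply: (@bounded_expmx_eigen A X Y (complex.Re (T i i)) (complex.Im (T i i)) C HC).
  - apply/matrixP => k j; rewrite !mxE.
    under eq_bigr do rewrite mxE -ReMc.
    rewrite -(big_morph _ ReD Re0) coef.
    by case: (T i i) => a b; case: (w 0 j).
  - apply/matrixP => k j; rewrite !mxE.
    under eq_bigr do rewrite mxE -ImMc.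
    rewrite -(big_morph _ ImD Im0) coef.
    by case: (T i i) => a b; case: (w 0 j) => c d /=; rewrite addrC.
  - apply/orP; rewrite -negb_and; apply: contra w0 => /andP[/eqP X0 /eqP Y0].
    apply/eqP/rowP => j; move/matrixP/(_ 0 j): X0; move/matrixP/(_ 0 j): Y0.
    by rewrite !mxE; case: (w 0 j) => c d /= -> ->.
have trT : \sum_i T i i * T i i = 0.
  have : \tr (T *m T) = 0.
    have -> : T *m T = P *m (Ac *m Ac) *m invmx P.
      by rewrite {1 2}TE !mulmxA mulmxKV.
    rewrite mxtrace_mulC mulmxA mulVmx // mul1mx.
    have -> : Ac *m Ac = map_mx cx (A *m A) by rewrite map_mxM.
    by rewrite trace_map_mx trA rmorph0.
  move=> tT; rewrite -[RHS]tT; apply: eq_bigr => i _; rewrite mxE (bigD1 i) //=.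
  rewrite big1 ?addr0 // => j ji; move/is_trig_mxP: Tt => Tt.
  have [lt|gt|/val_inj e] := ltngtP i j; first by rewrite Tt // mul0r.
    by rewrite [T j i]Tt // mulr0.
  by rewrite e eqxx in ji.
have T0 i : T i i = 0.
  have H : \sum_i (complex.Im (T i i)) ^+ 2 = 0.
    apply/eqP; rewrite -oppr_eq0 -sumrN.
    rewrite (eq_bigr (fun i => complex.Re (T i i * T i i))); last first.
      by move=> l _; have := eig l; case: (T l l) => a b /= ->; rewrite mul0r sub0r.
    by rewrite -(big_morph _ ReD Re0) trT.
  have : complex.Im (T i i) ^+ 2 == 0.
    have := H => /eqP; rewrite psumr_eq0; last by move=> l _; exact: sqr_ge0.
    by move=> /allP/(_ i (mem_index_enum i)).
  by rewrite sqrf_eq0; have := eig i; case: (T i i) => a b /= -> /eqP ->.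
have TN : T ^+ n.+1 = 0.
  have := Cayley_Hamilton T; rewrite char_poly_trig //.
  under eq_bigr do rewrite T0 subr0.
  by rewrite prodr_const card_ord rmorphXn /= horner_mx_X.
apply: (@bounded_expmx_nilpotent A C n.+1 HC).
have AcN k : Ac ^+ k = invmx P *m T ^+ k *m P.
  elim: k => [|k IH]; first by rewrite !expr0 mulmx1 mulVmx.
  rewrite exprS IH {1}AcE exprS -[_ * (_ *m _)]/(_ *m _) !mulmxA.
  by rewrite mulmxK // -[in RHS]mulmxA.
have : map_mx cx (A ^+ n.+1) = 0.
  have -> : map_mx cx (A ^+ n.+1) = Ac ^+ n.+1 by rewrite rmorphXn.
  by rewrite AcN TN mulmx0 mul0mx.
by move/eqP; rewrite map_mx_eq0 => /eqP.
Qed.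

End BoundedOneParameterGroup.

(** * Linear spans and finite-dimensional subspaces *)

Section Span.
Context (R : realType) (V : lmodType R).
Implicit Types (S : set V) (u v : V).

Lemma lin_span_sub S v : S v -> lin_span S v.
Proof.
by move=> Sv; exists 1%N, (fun=> 1), (fun=> v); split=> //; rewrite big_ord1 scale1r.
Qed.

Lemma lin_span0 S : lin_span S 0.
Proof. by exists 0%N, (fun=> 0), (fun=> 0); split=> [[]|] //; rewrite big_ord0. Qed.

Lemma lin_spanD S u v : lin_span S u -> lin_span S v -> lin_span S (u + v).
Proof.
move=> [m [c [a [Sa ->]]]] [p [d [b [Sb ->]]]].
exists (m + p)%N, (fun i => match fintype.split i with inl j => c j | inr j => d j end),
  (fun i => match fintype.split i with inl j => a j | inr j => b j end); split.
  by move=> i; case: fintype.split.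
rewrite big_split_ord /=; congr (_ + _); apply: eq_bigr => i _.
  by rewrite -[lshift _ _]/(unsplit (inl i)) unsplitK.
by rewrite -[rshift _ _]/(unsplit (inr i)) unsplitK.
Qed.

Lemma lin_spanZ S c v : lin_span S v -> lin_span S (c *: v).
Proof.
move=> [m [d [a [Sa ->]]]]; exists m, (fun i => c * d i), a; split=> //.
by rewrite scaler_sumr; apply: eq_bigr => i _; rewrite scalerA.
Qed.

Lemma lin_span_sum S m (v : 'I_m -> V) : (forall i, lin_span S (v i)) ->
  lin_span S (\sum_i v i).
Proof.
move=> H; elim/big_ind: _ => [|x y|i _]; [exact: lin_span0|exact: lin_spanD|exact: H].
Qed.

Lemma lin_span_min S (T : set V) : S `<=` T -> T 0 ->
  (forall u v, T u -> T v -> T (u + v)) -> (forall c v, T v -> T (c *: v)) ->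
  lin_span S `<=` T.
Proof.
move=> ST T0 TD TZ _ [m [c [a [Sa ->]]]].
by elim/big_ind: _ => // i _; apply: TZ; apply: ST; exact: Sa.
Qed.

End Span.

Section SubspaceVspace.
Context (R : realType) (V : vectType R).

(** A subspace of maximal dimension inside [S] is all of [S]: adjoining a vector of [S] cannot raise
    the dimension. *)
Lemma vspace_of_set (S : set V) : S 0 -> (forall u v, S u -> S v -> S (u + v)) ->
  (forall c v, S v -> S (c *: v)) -> exists W : {vspace V}, forall v, v \in W <-> S v.
Proof.
move=> S0 SD SZ.
pose P d := `[< exists W : {vspace V}, \dim W = d /\ forall v, v \in W -> S v >].
have P0 : exists d, P d.
  exists 0%N; apply/asboolP; exists 0%VS; split; first exact: dimv0.
  by move=> v; rewrite memv0 => /eqP ->.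
have Pub d : P d -> (d <= \dim {:V})%N.
  by move=> /asboolP[W [<- _]]; apply: dimvS; exact: subvf.
case: (ex_maxnP P0 Pub) => d /asboolP[W [dW WS]] dmax.
exists W => v; split=> [|Sv]; first exact: WS.
have : P (\dim (W + <[v]>)%VS).
  apply/asboolP; exists (W + <[v]>)%VS; split=> // u /memv_addP[w Ww [x]].
  by move=> /vlineP[c ->] ->; apply: SD; [exact: WS|exact: SZ].
move=> /dmax; rewrite -dW => le.
have /eqP WE : W == (W + <[v]>)%VS by rewrite eqEdim addvSl.
by rewrite WE; apply: (subvP (addvSr W <[v]>)); exact: memv_line.
Qed.

End SubspaceVspace.

(** * Brackets, perfectness and coordinates of the Lie algebra *)

Section Perfect.
Context (R : realType) (n : nat) (K : set 'M[R]_n.+1).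
Local Notation M := 'M[R]_n.+1.
Hypotheses (gK : matrix_group K) (cK : compact K).
Local Notation k := (lie_algebra K).
Implicit Types (A B C : M).

Lemma lie_vspace : exists W : {vspace M}, forall A, A \in W <-> k A.
Proof.
apply: vspace_of_set.
- exact: lie0.
- by move=> A B; exact: lie_add.
- by move=> c A; exact: lie_scale.
Qed.

Lemma invmx_expmx A t : invmx (expmx (t *: A)) = expmx ((- t) *: A).
Proof.
have H := expmxNK A t; have [u _] := mulmx1_unit H.
by rewrite -[LHS]mulmx1 -H mulmxA mulVmx // mul1mx.
Qed.

(* A linear form vanishing on k vanishes on exp(tA) B exp(-tA), hence on the derivative [A, B] at 0. *)
Lemma lie_lieb A B : k A -> k B -> k (lieb A B).
Proof.
move=> kA kB; have [W kW] := lie_vspace; apply/kW.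
(* [L] is linear with kernel k and stands for all linear forms vanishing on k at once. *)
pose L (v : M) : M := v - projv W v.
have LW v : (L v == 0) = (v \in W).
  rewrite /L subr_eq0; apply/eqP/idP => [->|vW]; first exact: memv_proj.
  by rewrite projv_id.
pose y (s : R) := expmx (s *: A) *m B *m expmx ((- s) *: A).
have dy : is_derive (0 : R) 1 y (lieb A B).
  apply: (is_derive_eq (is_derive_mulmx (is_derive_mulmxr B (is_derive_expmx A 0)) (is_derive_expmxN A 0))).
  by rewrite oppr0 !scale0r expmx0 !mulmx1 mul1mx mulmxN.
have Ly s : L (y s) = 0.
  apply/eqP; rewrite LW; apply/kW; rewrite /y -invmx_expmx.
  by apply: lie_Ad => //; exact: kA.
have linL : linear L.
  by move=> a u v; rewrite /L linearP scalerBr addrACA opprD.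
rewrite -LW; apply/eqP/matrixP => r c; rewrite [RHS]mxE.
have LE v : L v r c = \sum_i \sum_j v i j * L (delta_mx i j) r c.
  pose lm := GRing.isLinear.Build _ _ _ _ _ linL.
  pose LL : {linear M -> M} := HB.pack L lm.
  rewrite -[L]/(LL : M -> M) {1}[v]matrix_sum_delta linear_sum summxE.
  apply: eq_bigr => i _; rewrite linear_sum summxE; apply: eq_bigr => j _.
  by rewrite linearZ mxE.
have dLy : is_derive (0 : R) 1 (fun s => L (y s) r c) (L (lieb A B) r c).
  rewrite LE; have -> : (fun s => L (y s) r c) =
      \sum_i \sum_j (fun s => L (delta_mx i j) r c *: y s i j).
    apply/funext => s; rewrite LE fct_sumE; apply: eq_bigr => i _.
    by rewrite fct_sumE; apply: eq_bigr => j _; rewrite /GRing.scale /= mulrC.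
  apply: is_derive_sum => i; apply: is_derive_sum => j.
  have /is_derive_mxP/(_ i j) d := dy.
  by apply: (is_derive_eq (is_deriveZ _ d)); rewrite /GRing.scale /= mulrC.
have [_ <-] := dLy.
have -> : (fun s => L (y s) r c) = cst 0.
  by apply/funext => s; rewrite Ly mxE.
by rewrite derive_cst.
Qed.

Lemma lie_trace0 A : k A -> \tr (A *m A) = 0 -> A = 0.
Proof.
move=> kA; have [C C0 HC] := matrix_group_bounded cK.
by apply: (@bounded_expmx_trace0 _ _ A C) => t; apply: HC; exact: kA.
Qed.

Hypothesis ssK : semisimple_lie k.

(** Cyclicity of the trace. This invariance makes the orthogonal of [k, k] in k an ideal. *)
Lemma trace_lieb A B C : \tr (lieb A B *m C) = \tr (A *m lieb B C).
Proof.
rewrite /lieb mulmxBl mulmxBr !raddfB /= mulmxA; congr (_ - _).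
by rewrite -mulmxA mxtrace_mulC mulmxA.
Qed.

Lemma lie_sub_derived : k `<=` derived k.
Proof.
have [W kW] := lie_vspace.
have [D kD] : exists D : {vspace M}, forall A, A \in D <-> derived k A.
  apply: vspace_of_set; [exact: lin_span0|exact: lin_spanD|exact: lin_spanZ].
have kk A B : k A -> k B -> derived k (lieb A B).
  by move=> kA kB; apply: lin_span_sub; exists A, B.
have dk : derived k `<=` k.
  apply: lin_span_min; [|exact: lie0|by move=> *; exact: lie_add|by move=> *; exact: lie_scale].
  by move=> _ [A [B [kA kB ->]]]; exact: lie_lieb.
pose J : set M := [set A | k A /\ forall B, derived k B -> \tr (A *m B) = 0].
have J0 : J `<=` [set 0].
  apply: ssK.
    split=> [A []//||A B kA [kB HB]].
      apply: lin_span_min => //.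
      - by split=> [|B _]; [exact: lie0|rewrite mul0mx mxtrace0].
      - move=> A B [kA HA] [kB HB]; split=> [|C dC]; first exact: lie_add.
        by rewrite mulmxDl raddfD /= HA // HB // addr0.
      - move=> c A [kA HA]; split=> [|C dC]; first exact: lie_scale.
        by rewrite -scalemxAl linearZ /= HA // mulr0.
    split=> [|C dC]; first exact: lie_lieb.
    have -> : lieb A B = - lieb B A by rewrite /lieb opprB.
    rewrite mulNmx raddfN /= trace_lieb HB ?oppr0 //.
    by apply: kk => //; exact: dk.
  (* One derivation step suffices: for A, B in [J], tr([A, B]^2) = tr(A [B, [A, B]]) = 0, hence
     [A, B] = 0. *)
  exists 1%N => /=; apply: lin_span_min => //.
  - move=> _ [A [B [[kA HA] [kB HB] ->]]] /=; apply: lie_trace0; first exact: lie_lieb.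
    by rewrite trace_lieb HA //; apply: kk => //; exact: lie_lieb.
  - by move=> u v /= -> ->; rewrite addr0.
  - by move=> c v /= ->; rewrite scaler0.
pose b := vbasis D.
(* Pairing with a basis of [k, k] has kernel [J] = 0 on k, so dim k <= dim [k, k]; with the
   inclusion [k, k] in k this gives equality. *)
pose f (A : M) : 'rV[R]_(\dim D) := \row_i \tr (A *m tnth b i).
have linf : linear f.
  by move=> a u v; apply/rowP => i; rewrite !mxE mulmxDl -scalemxAl raddfD /= linearZ.
pose lm := GRing.isLinear.Build _ _ _ _ _ linf.
pose ff : {linear M -> 'rV[R]_(\dim D)} := HB.pack f lm.
have ker0 : (W :&: lker (linfun ff) = 0)%VS.
  apply/eqP; rewrite -subv0; apply/subvP => A; rewrite memv_cap memv0 => /andP[/kW kA].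
  rewrite memv_ker lfunE /= => /eqP/rowP fA.
  suff : J A by move=> /J0 ->.
  split=> // B /kD/coord_vbasis ->.
  rewrite mulmx_sumr raddf_sum big1 // => i _.
  rewrite -scalemxAr /= mxtraceZ; have := fA i; rewrite !mxE (tnth_nth 0) => ->.
  by rewrite mulr0.
have := limg_ker_dim (linfun ff) W; rewrite ker0 dimv0 add0n => dW.
have DW : (D <= W)%VS by apply/subvP => A /kD/dk/kW.
have /eqP DWE : D == W.
  rewrite eqEdim DW -dW; apply: leq_trans (dimvS (subvf _)) _.
  by rewrite dimvf /dim /= mul1n.
by move=> A /kW; rewrite -DWE => /kD.
Qed.

Lemma lie_double_commutators : k `<=` lin_span
  [set C | exists A B A' B', [/\ k A, k B, k A', k B' & C = lieb (lieb A B) (lieb A' B')]].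
Proof.
move=> C /lie_sub_derived; apply: lin_span_min; [|exact: lin_span0|exact: lin_spanD|exact: lin_spanZ].
move=> _ [A [B [/lie_sub_derived[m [c [a [ka ->]]]] /lie_sub_derived[p [d [b [kb ->]]]] ->]]].
have -> : lieb (\sum_(i < m) c i *: a i) (\sum_(j < p) d j *: b j) =
    \sum_(i < m) \sum_(j < p) (c i * d j) *: lieb (a i) (b j).
  rewrite /lieb mulmx_suml mulmx_sumr -sumrB; apply: eq_bigr => i _.
  rewrite mulmx_sumr mulmx_suml -sumrB; apply: eq_bigr => j _.
  by rewrite -!scalemxAl -!scalemxAr !scalerA scalerBr [d j * c i]mulrC.
apply: lin_span_sum => i; apply: lin_span_sum => j; apply/lin_spanZ/lin_span_sub.
have [A1 [B1 [kA1 kB1 ->]]] := ka i; have [A2 [B2 [kA2 kB2 ->]]] := kb j.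
by exists A1, B1, A2, B2.
Qed.

(** The coordinates are explicit linear forms in the matrix entries, so those of a smooth k-valued
    function are smooth. *)
Lemma lie_coordinates : exists (N : nat) (b q : 'I_N -> M), (forall i, k (b i)) /\
  forall A, k A -> A = \sum_i (\sum_r \sum_c q i r c * A r c) *: b i.
Proof.
have [W kW] := lie_vspace.
exists (\dim W), (fun i => (vbasis W)`_i), (fun i => \matrix_(r, c) coord (vbasis W) i (delta_mx r c)).
split=> [i|A /kW AW].
  by apply/kW; apply: vbasis_mem; rewrite mem_nth // size_tuple.
rewrite {1}(coord_vbasis AW); apply: eq_bigr => i _; congr (_ *: _).
rewrite {1}[A]matrix_sum_delta linear_sum; apply: eq_bigr => r _.
by rewrite linear_sum; apply: eq_bigr => c _; rewrite linearZ mxE mulrC.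
Qed.

End Perfect.

(** * Boundary defining functions *)

Section BoundaryDefiningFunction.
Context (R : realType).
Local Notation E := 'rV[R]_3.
Local Notation sm := (smooth (@setT E)).
Implicit Types (f g : E -> R) (x y v p : E) (O W : set E) (phi psi nu : E -> E).

Lemma is_derive_line (V : normedModType R) (f : E -> V) x v df :
  is_derive x v f df <-> is_derive (0 : R) 1 (fun t : R => f (t *: v + x)) df.
Proof.
have H : (fun h : R => h^-1 *: (((fun t : R => f (t *: v + x)) \o shift 0) (h *: 1) - f (0 *: v + x))) =
    (fun h => h^-1 *: ((f \o shift x) (h *: v) - f x)).
  by apply/funext => h /=; rewrite addr0 scale0r add0r [_%:A]mulr1.
split=> -[d1 d2]; split.
- by rewrite /derivable H.
- by rewrite -d2 /derive H.
- by move: d1; rewrite /derivable H.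
- by rewrite -d2 /derive H.
Qed.

Lemma is_derive_chain g phi x v w : sm g -> is_derive x v phi w ->
  is_derive x v (fun y => g (phi y)) (dot w (grad g (phi x))).
Proof.
move=> sg /is_derive_line[d1 d2]; apply/is_derive_line.
set c := (fun t : R => phi (t *: v + x)) in d1 d2 *.
have c0 : c 0 = phi x by rewrite /c scale0r add0r.
have dc : differentiable c (0 : R) by apply/derivable1_diffP.
have [dg Hg] := smooth_differentiable (c 0) sg.
have dgc : differentiable (g \o c) (0 : R) by exact: differentiable_comp.
split; first by apply/derivable1_diffP.
rewrite (deriveE _ dgc) diff_comp //= Hg c0; congr (dot _ _).
by rewrite -(deriveE _ dc).
Qed.

(** Differentiating psi(phi(x)) = x: the gradients of the coordinate functions form the basis dual
    to the coordinate vectors. The [g i] are global functions with the germs of the components of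
    [psi]. *)
Lemma chart_gradients O W phi psi x (g : 'I_3 -> E -> R) W' :
  boundary_chart O W phi psi -> W x -> (forall i, sm (g i)) ->
  open W' -> W' (phi x) -> (forall i y, W' y -> g i y = psi y 0 i) ->
  forall i j, dot (partial j phi x) (grad (g i) (phi x)) = (i == j)%:R.
Proof.
move=> [[oW oU] [sphi spsi] psiK _] Wx sg oW' Wp' gE i j.
have dphi : is_derive x (delta_mx 0 j) phi (partial j phi x).
  by apply: derivableP; exact: smooth_derivable sphi Wx.
have [_ <-] := is_derive_chain (sg i) dphi.
have nW : nbhs x W by exact: open_nbhs_nbhs.
have nW' : nbhs x (phi @^-1` W').
  have := smooth_continuous sphi Wx; apply; exact: open_nbhs_nbhs.
rewrite (near_eq_derive (g := fun y : E => y 0 i)); first by rewrite eq_sym; exact: partial_coord.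
near=> y; rewrite gE; last by near: y.
by rewrite psiK //; near: y.
Unshelve. all: by end_near. Qed.

Lemma rowM3 (u : E) (A : 'M[R]_3) j : (u *m A) 0 j = u 0 0 * A 0 j + u 0 1 * A 1 j + u 0 2 * A 2 j.
Proof. by rewrite mxE sum3. Qed.

(** [v] is orthogonal to the first two coordinate vectors, so in the dual basis of gradients only
    the third component remains. *)
Lemma normal_parallel_gradient O W phi psi x (g : 'I_3 -> E -> R) W' v :
  boundary_chart O W phi psi -> W x -> (forall i, sm (g i)) ->
  open W' -> W' (phi x) -> (forall i y, W' y -> g i y = psi y 0 i) ->
  W' `<=` phi @` W -> bdry O (phi x) -> inward_normal O (phi x) v ->
  exists2 lam : R, 0 < lam & v = lam *: grad (g 2) (phi x).
Proof.
move=> cW Wx sg oW' Wp' gE W'W bp [vv vT vin].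
have HPQ := chart_gradients cW Wx sg oW' Wp' gE.
pose P : 'M[R]_3 := \matrix_(i, j) grad (g i) (phi x) 0 j.
pose Q : 'M[R]_3 := \matrix_(i, j) partial j phi x 0 i.
have PQ : P *m Q = 1%:M.
  apply/matrixP => i j; rewrite !mxE -(HPQ i j) /dot.
  by apply: eq_bigr => l _; rewrite !mxE mulrC.
have QP : Q *m P = 1%:M by exact: mulmx1C.
have tan (j : 'I_3) : j != 2 -> dot v (partial j phi x) = 0.
  move=> j2; apply: vT; exists W, phi, psi, x.
  have [->|->] : j = 0 \/ j = 1.
    by elim/I3_ind: j j2 => // _; [left|right].
  - by exists 1, 0; split=> //; rewrite scale1r scale0r addr0.
  - by exists 0, 1; split=> //; rewrite scale1r scale0r add0r.
pose lam := dot v (partial 2 phi x).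
have vQ j : (v *m Q) 0 j = dot v (partial j phi x).
  by rewrite mxE; apply: eq_bigr => l _; rewrite mxE.
have vE : v = lam *: grad (g 2) (phi x).
  rewrite -[LHS]mulmx1 -QP mulmxA; apply/rowP => j.
  have E0 : (v *m Q) 0 0 = 0 := etrans (vQ 0) (tan 0 isT).
  have E1 : (v *m Q) 0 1 = 0 := etrans (vQ 1) (tan 1 isT).
  rewrite rowM3 E0 E1 !mul0r !add0r (vQ 2).
  by rewrite [P _ _]mxE [RHS]mxE.
have G0 : 0 < dot (grad (g 2) (phi x)) (grad (g 2) (phi x)).
  rewrite lt0r; apply/andP; split; last first.
    by rewrite /dot sumr_ge0 // => i _; rewrite -expr2 sqr_ge0.
  apply/eqP => G0; move: vv; rewrite vE dotZl dotZr G0 !mulr0 => /esym/eqP.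
  by rewrite oner_eq0.
exists lam => //; rewrite lt0r; apply/andP; split.
  apply/eqP => l0; move: vv; rewrite vE l0 scale0r /dot big1 => [/esym/eqP|i _].
    by rewrite oner_eq0.
  by rewrite mxE mul0r.
(* If [lam] were negative, [g 2] would decrease along [v] from its boundary value 0, whereas the ray
   enters [O], where [g 2] is positive. *)
rewrite leNgt; apply/negP => lam0.
have [dS DS] := smooth_derive (phi x) v (sg 2).
have Sp : g 2 (phi x) = 0.
  rewrite gE //; have [_ _ psiK HO] := cW; rewrite psiK //.
  by have [_] := HO x Wx; move=> /iffLR; exact.
pose m := 'D_v (g 2) (phi x).
have m0 : m < 0.
  by rewrite /m DS [in X in dot X _]vE dotZl nmulr_rlt0.
have := dS; rewrite /derivable -/(derive _ _ _) -/m => /cvgrPdist_lt/(_ (- m)).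
rewrite oppr_gt0 => /(_ m0); rewrite near_withinE => Hd.
have nW' : \forall t \near (0 : R), W' (phi x + t *: v).
  have cl : {for (0 : R), continuous (fun t : R => phi x + t *: v)}.
    apply: continuousD; first exact: cst_continuous.
    exact: scalel_continuous.
  have : nbhs (phi x + 0 *: v) W' by rewrite scale0r addr0; exact: open_nbhs_nbhs.
  by move=> /cl.
have nR : \forall t \near (0 : R)^'+, False.
  near=> t.
  have t0 : 0 < t by near: t; exact: nbhs_right_gt.
  have Ot : O (phi x + t *: v) by near: t.
  have Wt : W' (phi x + t *: v) by near: t; exact: cvg_at_right_filter nW'.
  have q : t != 0 -> `|m - t^-1 *: (g 2 (t *: v + phi x) - g 2 (phi x))| < - m.
    by near: t; exact: cvg_at_right_filter Hd.
  have [x' Wx' Ex'] := W'W _ Wt; have [_ _ psiK HO] := cW.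
  have St : 0 < g 2 (t *: v + phi x).
    by rewrite addrC gE // -Ex' psiK //; apply/(HO x' Wx').1; rewrite Ex'.
  move: (q (lt0r_neq0 t0)); rewrite Sp subr0; apply/negP; rewrite -leNgt.
  have S' : 0 < t^-1 *: g 2 (t *: v + phi x) by rewrite mulr_gt0 ?invr_gt0.
  by rewrite ltr0_norm ?lerN2 ?gerBl ?(ltW S') // subr_lt0 (lt_trans m0).
by have [] := filter_ex nR.
Unshelve. all: by end_near. Qed.

(* S is the third coordinate of a chart, made global by a cutoff. *)
Lemma boundary_defining_function O nu p0 : smooth_boundary O ->
  (forall p, bdry O p -> inward_normal O p (nu p)) -> bdry O p0 ->
  exists (S : E -> R) W, [/\ sm S, open W, W p0,
    (forall x, W x -> (O x <-> 0 < S x) /\ (bdry O x <-> S x = 0))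
  & (forall x, W x -> bdry O x -> exists2 lam : R, 0 < lam & nu x = lam *: grad S x)].
Proof.
move=> sO nuO bp0; have [W0 [phi [psi [cW Wp0]]]] := sO p0 bp0.
have [[oW oU] [sphi spsi] psiK HO] := cW.
have loc i : exists g W, [/\ sm g, open W, W p0 & forall x, W x -> (phi @` W0) x /\ g x = psi x 0 i].
  exact: (smooth_localize oU Wp0 (smooth_coord 0 i oU spsi)).
have [g0 [W1 [sg0 oW1 Wp1 E1]]] := loc 0.
have [g1 [W2 [sg1 oW2 Wp2 E2]]] := loc 1.
have [g2 [W3 [sg2 oW3 Wp3 E3]]] := loc 2.
pose g (i : 'I_3) : E -> R := if i == 0 then g0 else if i == 1 then g1 else g2.
pose W := W1 `&` W2 `&` W3.
have oW' : open W by apply: openI => //; exact: openI.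
have gE i y : W y -> g i y = psi y 0 i.
  move=> [[w1 w2] w3]; elim/I3_ind: i; rewrite /g /=.
  - by have [] := E1 _ w1.
  - by have [] := E2 _ w2.
  - by have [] := E3 _ w3.
have sg i : sm (g i) by elim/I3_ind: i; rewrite /g /=.
have WU : W `<=` phi @` W0 by move=> y [[w1 _] _]; have [] := E1 _ w1.
exists g2, W; split=> //.
  move=> y Wy; have [x Wx xy] := WU _ Wy.
  have -> : g2 y = x 0 2 by rewrite -[g2]/(g 2) gE // -xy psiK.
  by rewrite -xy; exact: HO.
move=> y Wy by'; have [x Wx xy] := WU _ Wy; subst y.
exact: (normal_parallel_gradient cW Wx sg oW' Wy gE WU by' (nuO _ by')).
Qed.

End BoundaryDefiningFunction.

(** * Coulomb fields from Neumann functions *)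

Section VectorAlgebra.
Context (R : realType).
Local Notation E := 'rV[R]_3.
Implicit Types (u v w : E).

Definition cross u v : E := \row_(i < 3)
  [:: u 0 1 * v 0 2 - u 0 2 * v 0 1; u 0 2 * v 0 0 - u 0 0 * v 0 2;
      u 0 0 * v 0 1 - u 0 1 * v 0 0]`_i.

Lemma crossE u v :
  (cross u v 0 0 = u 0 1 * v 0 2 - u 0 2 * v 0 1) *
  (cross u v 0 1 = u 0 2 * v 0 0 - u 0 0 * v 0 2) *
  (cross u v 0 2 = u 0 0 * v 0 1 - u 0 1 * v 0 0).
Proof. by rewrite !mxE. Qed.

Lemma cross_linear (a b : R) u v w :
  cross (a *: u + b *: v) w = a *: cross u w + b *: cross v w.
Proof. by apply/rowP; apply: I3_ind; rewrite !mxE /= ?mxE; ring. Qed.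

Lemma dot3E u v : dot u v = u 0 0 * v 0 0 + u 0 1 * v 0 1 + u 0 2 * v 0 2.
Proof. exact: sum3. Qed.

(* (w.(u x v)) n is a combination of the products of u, v, w with n. *)
Lemma triple_orthogonal u v w n : dot n n = 1 ->
  dot u n = 0 -> dot v n = 0 -> dot w n = 0 -> dot w (cross u v) = 0.
Proof.
move=> nn un vn wn.
have E : dot w (cross u v) * dot n n =
    dot w n * dot n (cross u v) + dot u n * dot n (cross v w) + dot v n * dot n (cross w u).
  by rewrite !dot3E !crossE; ring.
by rewrite nn un vn wn mulr1 !mul0r !addr0 in E.
Qed.

(** If n_i is nonzero, the two other basis vectors in cyclic order have triple product n_i with [n],
    and adding multiples of [n] does not change it. Such multiples arise when gradients are made
    tangential. *)
Lemma exists_frame n : n != 0 -> exists u v, forall a b : R,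
  dot (cross (u - a *: n) (v - b *: n)) n != 0.
Proof.
move=> n0; have [i ni] : exists i, n 0 i != 0.
  have [/forallP H|] := boolP [forall i, n 0 i == 0].
    by case/eqP: n0; apply/rowP => i; rewrite (eqP (H i)) mxE.
  by rewrite negb_forall => /existsP[i ni]; exists i.
elim/I3_ind: i ni => ni.
- exists (delta_mx 0 1), (delta_mx 0 2) => a b.
  suff -> : dot (cross (delta_mx 0 1 - a *: n) (delta_mx 0 2 - b *: n)) n = n 0 0 by [].
  by rewrite dot3E !crossE !mxE /=; ring.
- exists (delta_mx 0 2), (delta_mx 0 0) => a b.
  suff -> : dot (cross (delta_mx 0 2 - a *: n) (delta_mx 0 0 - b *: n)) n = n 0 1 by [].
  by rewrite dot3E !crossE !mxE /=; ring.
- exists (delta_mx 0 0), (delta_mx 0 1) => a b.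
  suff -> : dot (cross (delta_mx 0 0 - a *: n) (delta_mx 0 1 - b *: n)) n = n 0 2 by [].
  by rewrite dot3E !crossE !mxE /=; ring.
Qed.

End VectorAlgebra.

(** * Cross products of gradients as elements of H_0, and the elements of L_0 they produce *)

Section CoulombFields.
Context (R : realType) (n : nat).
Local Notation E := 'rV[R]_3.
Local Notation M := 'M[R]_n.+1.
Local Notation sm := (smooth (@setT E)).
Implicit Types (f g h p q w : E -> R) (x y v : E) (a b : M).

(** The components of grad f x grad g, the Hodge dual of df ^ dg. *)
Definition gcross f g (i : 'I_3) : E -> R := fun x => cross (grad f x) (grad g x) 0 i.

Lemma gcrossE f g x :
  (gcross f g 0 x = partial 1 f x * partial 2 g x - partial 2 f x * partial 1 g x) *
  (gcross f g 1 x = partial 2 f x * partial 0 g x - partial 0 f x * partial 2 g x) *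
  (gcross f g 2 x = partial 0 f x * partial 1 g x - partial 1 f x * partial 0 g x).
Proof. by rewrite /gcross !crossE !mxE. Qed.

Lemma gcross_fun f g :
  (gcross f g 0 = fun x => partial 1 f x * partial 2 g x - partial 2 f x * partial 1 g x) *
  (gcross f g 1 = fun x => partial 2 f x * partial 0 g x - partial 0 f x * partial 2 g x) *
  (gcross f g 2 = fun x => partial 0 f x * partial 1 g x - partial 1 f x * partial 0 g x).
Proof. by split; [split|]; apply/funext => x; rewrite gcrossE. Qed.

Lemma sm_gcross f g i : sm f -> sm g -> sm (gcross f g i).
Proof.
move=> sf sg.
have s2 j k : sm (fun x => partial j f x * partial k g x).
  exact: (sm_mul (sm_partial j sf) (sm_partial k sg)).
have s3 j k l m : sm (fun x => partial j f x * partial k g x - partial l f x * partial m g x).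
  exact: (sm_sub (s2 j k) (s2 l m)).
by elim/I3_ind: i; rewrite gcross_fun; exact: s3.
Qed.

(** This is d(df ^ dg) = 0: the second derivatives cancel in pairs by symmetry. *)
Lemma div_gcross f g x : sm f -> sm g -> \sum_(i < 3) partial i (gcross f g i) x = 0.
Proof.
move=> sf sg.
have P i j k l m : partial i (fun x => partial j f x * partial k g x - partial l f x * partial m g x) x =
    partial i (partial j f) x * partial k g x + partial j f x * partial i (partial k g) x
    - (partial i (partial l f) x * partial m g x + partial l f x * partial i (partial m g) x).
  rewrite (partialB _ _ (sm_mul (sm_partial j sf) (sm_partial k sg)) (sm_mul (sm_partial l sf) (sm_partial m sg))).
  by rewrite (partialM _ _ (sm_partial j sf) (sm_partial k sg)) (partialM _ _ (sm_partial l sf) (sm_partial m sg)).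
rewrite sum3 !gcross_fun !P.
rewrite (schwarz 1 0 sf) (schwarz 2 0 sf) (schwarz 2 1 sf).
rewrite (schwarz 1 0 sg) (schwarz 2 0 sg) (schwarz 2 1 sg).
have H (f0 f1 f2 g0 g1 g2 f01 f02 f12 g01 g02 g12 : R) :
    f01 * g2 + f1 * g02 - (f02 * g1 + f2 * g01) + (f12 * g0 + f2 * g01 - (f01 * g2 + f0 * g12))
    + (f02 * g1 + f0 * g12 - (f12 * g0 + f1 * g02)) = 0 by ring.
exact: H.
Qed.

Variables (O : set E) (nu : E -> E) (K : set M) (s : nat).
Hypotheses (oO : open O) (bO : bounded_set O)
  (nuO : forall y, bdry O y -> inward_normal O y (nu y)).
Hypotheses (gK : matrix_group K) (cK : compact K).
Local Notation k := (lie_algebra K).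

Definition neumann f := forall y, bdry O y -> dot (grad f y) (nu y) = 0.

Lemma gradM f g x : sm f -> sm g ->
  grad (fun x => f x * g x) x = g x *: grad f x + f x *: grad g x.
Proof.
by move=> sf sg; apply/rowP => i; rewrite !mxE (partialM _ _ sf sg) [_ * g x]mulrC.
Qed.

Lemma neumannM f g : sm f -> sm g -> neumann f -> neumann g ->
  neumann (fun x => f x * g x).
Proof.
move=> sf sg nf ng y by'; rewrite (gradM _ sf sg) dotDl !dotZl nf // ng //.
by rewrite !mulr0 addr0.
Qed.

(** Both gradients and [v] lie in the plane orthogonal to the normal, so their triple product is
    zero. *)
Lemma gcross_normal f g y v : neumann f -> neumann g -> tangent O y v ->
  \sum_(i < 3) v 0 i * gcross f g i y = 0.
Proof.
move=> nf ng tv; have by' : bdry O y.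
  by case: tv => W [phi [psi [x [c1 [c2 [_ _ _ ? _]]]]]].
have [nn nT _] := nuO by'.
apply: (@triple_orthogonal R (grad f y) (grad g y) v (nu y)) => //.
- exact: nf.
- exact: ng.
by rewrite dotC; exact: nT.
Qed.

Lemma H0_pair f1 g1 f2 g2 a b : sm f1 -> sm g1 -> sm f2 -> sm g2 ->
  neumann f1 -> neumann g1 -> neumann f2 -> neumann g2 -> k a -> k b ->
  H0 O k s (fun i x => gcross f1 g1 i x *: a + gcross f2 g2 i x *: b).
Proof.
move=> sf1 sg1 sf2 sg2 nf1 ng1 nf2 ng2 ka kb.
have s1 i := sm_gcross i sf1 sg1; have s2 i := sm_gcross i sf2 sg2.
have sa i := sm_scale a (s1 i); have sb i := sm_scale b (s2 i).
have sab i := sm_add (sa i) (sb i).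
split.
- by move=> i x _; apply: lie_add => //; exact: lie_scale.
- by move=> i; apply: continuous_subspaceT; exact: (sm_continuous (sab i)).
- by move=> i r c; apply: (sobolev_smooth s oO bO); exact: (smooth_coord r c openT (sab i)).
- move=> y v tv; under eq_bigr do rewrite scalerDr !scalerA.
  by rewrite big_split /= -!scaler_suml (gcross_normal nf1 ng1 tv) (gcross_normal nf2 ng2 tv) !scale0r addr0.
move=> x _; rewrite /codiff.
have D (c1 c2 : 'I_3 -> R) : \sum_i c1 i = 0 -> \sum_i c2 i = 0 ->
    \sum_i (c1 i *: a + c2 i *: b) = 0.
  by move=> z1 z2; rewrite big_split /= -!scaler_suml z1 z2 !scale0r addr0.
rewrite -[RHS]oppr0 -[in RHS](D _ _ (div_gcross x sf1 sg1) (div_gcross x sf2 sg2)).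
congr (- _); apply: eq_bigr => i _.
by rewrite (partialD _ _ (sa i) (sb i)) (partialZl _ _ _ (s1 i)) (partialZl _ _ _ (s2 i)).
Qed.

Lemma laplaceZl w (c : M) x : sm w -> laplace (fun x => w x *: c) x = laplace w x *: c.
Proof.
move=> sw; rewrite /laplace scaleNr scaler_suml; congr (- _); apply: eq_bigr => i _.
rewrite (_ : partial i (fun x => w x *: c) = fun x => partial i w x *: c).
  exact: (partialZl _ _ _ (sm_partial i sw)).
by apply/funext => y; exact: partialZl.
Qed.

Lemma gcrossMl f g q i x : sm f -> sm g ->
  gcross (fun x => f x * g x) q i x = g x * gcross f q i x + f x * gcross g q i x.
Proof.
by move=> sf sg; rewrite /gcross (gradM _ sf sg) cross_linear [LHS]mxE !(mxE _ (_ *: _)) .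
Qed.

Lemma lieb_pair (c1 c2 d1 d2 : R) a b :
  lieb (c1 *: a + c2 *: b) (d1 *: a + d2 *: b) = (c1 * d2 - c2 * d1) *: lieb a b.
Proof.
rewrite /lieb !mulmxDl !mulmxDr -!scalemxAl -!scalemxAr.
move: (a *m a) (a *m b) (b *m a) (b *m b) => aa ab ba bb.
by apply/matrixP => i j; rewrite !mxE; ring.
Qed.

(** [w] itself serves as Green potential: its equation and boundary values are given, so it only
    remains to exhibit two Coulomb fields with bracket f |B|^2 [a, b], where B = grad p x grad q. *)
Lemma L0_generator p q f w a b : sm p -> sm q -> sm f -> sm w ->
  neumann p -> neumann q -> neumann f -> (forall y, bdry O y -> w y = 0) ->
  (forall x, O x -> laplace w x = f x * \sum_(i < 3) gcross p q i x ^+ 2) ->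
  k a -> k b ->
  (L0 O k s `&` [set g | smooth_on (closure O) g]) (fun x => w x *: lieb a b).
Proof.
move=> sp sq sf sw np nq nf w0 lw ka kb.
have swc := sm_scale (lieb a b) sw.
split; last by move=> x _; exists setT, (fun x => w x *: lieb a b); split=> //; exact: openT.
(* The generators of [L0] carry the curvature factor -2, undone by the scalar -1/2. *)
rewrite (_ : (fun x => w x *: lieb a b) = (- 2^-1) *: (fun x => (-2) *: (w x *: lieb a b))); last first.
  apply/funext => x; rewrite -[RHS]/(- 2^-1 *: (-2 *: (w x *: lieb a b))).
  by rewrite scalerA mulrNN mulVf ?pnatr_eq0 // scale1r.
apply/lin_spanZ/lin_span_sub.
have shp := sm_mul (sm_cst (2^-1 : R)) sp.
have spf := sm_mul sp sf; have spp := sm_mul sp shp.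
have nhp : neumann (fun x => 2^-1 * p x).
  apply: (neumannM (sm_cst (2^-1 : R)) sp) => // y _.
  by rewrite /dot big1 // => i _; rewrite mxE partial_cst mul0r.
(* By Leibniz the coefficients are f B + p A2 and A2 in the first field, p B and B in the second,
   with A2 = grad f x grad q; their antisymmetric combination is f |B|^2. *)
exists (fun i x => gcross (fun x => p x * f x) q i x *: a + gcross f q i x *: b),
  (fun i x => gcross (fun x => p x * (2^-1 * p x)) q i x *: a + gcross p q i x *: b),
  (fun x => w x *: lieb a b).
split.
- exact: (H0_pair spf sq sf sq (neumannM sp sf np nf) nq nf nq ka kb).
- exact: (H0_pair spp sq sp sq (neumannM sp shp np nhp) nq np nq ka kb).
- by move=> x _; apply: lie_scale; exact: lie_lieb.
- split.
  + by apply: continuous_subspaceT; exact: (sm_continuous swc).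
  + by apply: (C_sub (@subsetT _ _)); exact: swc.
  + move=> x Ox; rewrite (laplaceZl _ _ sw) lw // /bracket_dot.
    rewrite mulr_sumr scaler_suml; apply: eq_bigr => i _.
    rewrite lieb_pair; congr (_ *: _).
    rewrite (gcrossMl _ _ _ sp sf) (gcrossMl _ _ _ sp shp) (gcrossMl _ _ _ (sm_cst (2^-1 : R)) sp).
    have -> : gcross (fun=> 2^-1 : R) q i x = 0.
      by elim/I3_ind: i; rewrite gcrossE !partial_cst !mul0r subrr.
    by field.
  + by move=> y /w0 ->; rewrite scale0r.
- by [].
Qed.

End CoulombFields.

(** * Boundary jets of multiples of a defining function *)

Section BoundaryJets.
Context (R : realType).
Local Notation E := 'rV[R]_3.
Local Notation sm := (smooth (@setT E)).
Implicit Types (f g h S c w : E -> R) (x y v : E) (U C : set E).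

Lemma partialM_fun f g i : sm f -> sm g ->
  partial i (fun x => f x * g x) = fun x => partial i f x * g x + f x * partial i g x.
Proof. by move=> sf sg; apply/funext => x; exact: partialM. Qed.

Lemma partial2M f g i j x : sm f -> sm g ->
  partial j (partial i (fun x => f x * g x)) x =
  partial j (partial i f) x * g x + partial i f x * partial j g x
  + (partial j f x * partial i g x + f x * partial j (partial i g) x).
Proof.
move=> sf sg; rewrite (partialM_fun _ sf sg).
have si := sm_partial i sf; have ti := sm_partial i sg.
rewrite (partialD _ _ (sm_mul si sg) (sm_mul sf ti)).
by rewrite (partialM _ _ si sg) (partialM _ _ sf ti).
Qed.

Lemma partial3M f g i j k x : sm f -> sm g ->
  partial k (partial j (partial i (fun x => f x * g x))) x =
  (partial k (partial j (partial i f)) x * g x + partial j (partial i f) x * partial k g x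
   + (partial k (partial i f) x * partial j g x + partial i f x * partial k (partial j g) x))
  + (partial k (partial j f) x * partial i g x + partial j f x * partial k (partial i g) x
   + (partial k f x * partial j (partial i g) x + f x * partial k (partial j (partial i g)) x)).
Proof.
move=> sf sg; rewrite (partialM_fun _ sf sg).
have si := sm_partial i sf; have ti := sm_partial i sg.
rewrite (_ : partial j _ = fun x => partial j (fun x => partial i f x * g x) x + partial j (fun x => f x * partial i g x) x); last first.
  by apply/funext => z; rewrite (partialD _ _ (sm_mul si sg) (sm_mul sf ti)).
rewrite (partialD _ _ (sm_partial j (sm_mul si sg)) (sm_partial j (sm_mul sf ti))).
by rewrite (partial2M _ _ _ si sg) (partial2M _ _ _ sf ti).
Qed.

(** S^3 c, nested so that its jets are computed by adding one factor [S] at a time. *)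
Definition cube_of S c : E -> R := fun x => S x * (S x * (S x * c x)).

Lemma sm_cube_of S c : sm S -> sm c -> sm (cube_of S c).
Proof. by move=> sS sc; exact: (sm_mul sS (sm_mul sS (sm_mul sS sc))). Qed.

Lemma mul_defining_jet S (v : E -> R) y : sm S -> sm v -> S y = 0 -> v y = 0 ->
  (forall i, partial i (fun x => S x * v x) y = 0) /\
  (forall i j, partial j (partial i (fun x => S x * v x)) y =
     partial i S y * partial j v y + partial j S y * partial i v y).
Proof.
move=> sS sv S0 v0; split=> [i|i j].
  by rewrite (partialM _ _ sS sv) S0 v0 mulr0 mul0r addr0.
rewrite (partial2M _ _ _ sS sv) S0 v0.
have H (a b c d e f : R) : a * 0 + b * c + (d * e + 0 * f) = b * c + d * e.
  by rewrite mulr0 add0r mul0r addr0.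
exact: H.
Qed.

Lemma mul_defining_jet3 S (v : E -> R) y : sm S -> sm v -> S y = 0 -> v y = 0 ->
  (forall i, partial i v y = 0) ->
  (forall i j, partial j (partial i (fun x => S x * v x)) y = 0) /\
  (forall i j k, partial k (partial j (partial i (fun x => S x * v x))) y =
     partial i S y * partial k (partial j v) y + partial j S y * partial k (partial i v) y +
     partial k S y * partial j (partial i v) y).
Proof.
move=> sS sv S0 v0 dv; split=> [i j|i j k].
  by apply: (etrans ((mul_defining_jet sS sv S0 v0).2 i j)); rewrite !dv [_ * 0]mulr0 [_ * 0]mulr0 addr0.
rewrite (partial3M _ _ _ _ sS sv) S0 v0 !dv.
have H (a b c d e f g h l m o : R) : a * 0 + b * 0 + (c * 0 + d * e) + (f * 0 + g * h + (l * m + 0 * o))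
    = d * e + g * h + l * m by ring.
exact: H.
Qed.

(** On S = 0 a third derivative survives only if each factor [S] receives exactly one derivative;
    there are 3! = 6 ways. *)
Lemma cube_of_jet S c y : sm S -> sm c -> S y = 0 ->
  (forall i j, partial j (partial i (cube_of S c)) y = 0) /\
  (forall i j k, partial k (partial j (partial i (cube_of S c))) y =
     6 * c y * (partial i S y * partial j S y * partial k S y)).
Proof.
move=> sS sc S0; have s1 := sm_mul sS sc; have s2 := sm_mul sS s1.
have d1 i : partial i (fun x => S x * c x) y = partial i S y * c y.
  by rewrite (partialM _ _ sS sc) S0 mul0r addr0.
have v1 : (fun x => S x * c x) y = 0 by rewrite S0 mul0r.
have v2 : (fun x => S x * (S x * c x)) y = 0 by rewrite S0 mul0r.
have [d2 dd2] := mul_defining_jet sS s1 S0 v1.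
have [dd3 ddd3] := mul_defining_jet3 sS s2 S0 v2 d2.
split=> [i j|i j k]; first exact: dd3.
apply: (etrans (ddd3 i j k)).
move: (dd2 j k) (dd2 i k) (dd2 i j); rewrite !d1.
move: (partial k (partial j _) _) (partial k (partial i _) _) (partial j (partial i _) _).
by move: (partial i S y) (partial j S y) (partial k S y) (c y) => a b d e x1 x2 x3 -> -> ->; ring.
Qed.

Definition gdot f g x := dot (grad f x) (grad g x).

Lemma sm_gdot f g : sm f -> sm g -> sm (gdot f g).
Proof.
move=> sf sg.
apply: (smooth_ext openT _ (sm_sum (fun i => sm_mul (sm_partial i sf) (sm_partial i sg)))) => x _.
by rewrite /gdot /dot; apply: eq_bigr => i _; rewrite !mxE.
Qed.

Lemma sm_laplace f : sm f -> sm (laplace f).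
Proof.
move=> sf; exact: (sm_opp (sm_sum (fun i => sm_partial i (sm_partial i sf)))).
Qed.

Lemma partial_laplace f k x : sm f ->
  partial k (laplace f) x = - \sum_i partial k (partial i (partial i f)) x.
Proof.
move=> sf; have s2 i := sm_partial i (sm_partial i sf).
by rewrite (partialN _ _ (sm_sum s2)) (partial_sum _ _ s2).
Qed.

Lemma laplaceD f g x : sm f -> sm g ->
  laplace (fun x => f x + g x) x = laplace f x + laplace g x.
Proof.
move=> sf sg; rewrite /laplace -opprD -big_split; congr (- _); apply: eq_bigr => i _ /=.
rewrite (_ : partial i (fun x => f x + g x) = fun x => partial i f x + partial i g x).
  exact: (partialD _ _ (sm_partial i sf) (sm_partial i sg)).
by apply/funext => z; exact: (partialD _ _ sf sg).
Qed.

Lemma laplace_cube_of S c y : sm S -> sm c -> S y = 0 ->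
  laplace (cube_of S c) y = 0 /\
  grad (laplace (cube_of S c)) y = (- 6 * c y * gdot S S y) *: grad S y.
Proof.
move=> sS sc S0; have [H2 H3] := cube_of_jet sS sc S0; split.
  by rewrite /laplace big1 ?oppr0 // => i _; exact: H2.
apply/rowP => k; rewrite !mxE (partial_laplace _ _ (sm_cube_of sS sc)).
have -> : gdot S S y = \sum_i partial i S y * partial i S y.
  by apply: eq_bigr => i _; rewrite !mxE.
rewrite mulr_sumr mulr_suml -sumrN; apply: eq_bigr => i _; rewrite H3.
by move: (partial i S y) (partial k S y) (c y) => a b d; ring.
Qed.

Lemma grad_supp C f x : closed C -> (forall x, ~ C x -> f x = 0) -> ~ C x -> grad f x = 0.
Proof.
by move=> cC f0 nCx; apply/rowP => i; rewrite !mxE; exact: (partial_supp i cC f0).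
Qed.

Lemma laplace_supp C f x : closed C -> (forall x, ~ C x -> f x = 0) -> ~ C x ->
  laplace f x = 0.
Proof.
move=> cC f0 nCx; rewrite /laplace big1 ?oppr0 // => i _.
exact: (partial_supp i cC (partial_supp i cC f0)).
Qed.

Lemma gradD f g x : sm f -> sm g -> grad (fun x => f x + g x) x = grad f x + grad g x.
Proof. by move=> sf sg; apply/rowP => i; rewrite !mxE (partialD _ _ sf sg). Qed.

Lemma gradB f g x : sm f -> sm g -> grad (fun x => f x - g x) x = grad f x - grad g x.
Proof. by move=> sf sg; apply/rowP => i; rewrite !mxE (partialB _ _ sf sg). Qed.

(* A term cube_of S c does not change the boundary 2-jet of w; its coefficient c is
   chosen to cancel the normal derivative of laplace w / B2. *)
Lemma neumann_correction S (rho kappa B2 w0 : E -> R) (V C : set E) : sm S -> sm rho -> sm kappa -> sm B2 -> sm w0 ->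
  (forall x, V x -> rho x * gdot S S x = 1 /\ kappa x * B2 x = 1) ->
  closed C -> C `<=` V -> (forall x, ~ C x -> w0 x = 0) ->
  exists c f, [/\ sm c /\ sm f, (forall x, ~ C x -> c x = 0 /\ f x = 0),
    (forall x, laplace (fun x => w0 x + cube_of S c x) x = f x * B2 x)
  & forall y, C y -> S y = 0 -> dot (grad f y) (grad S y) = 0].
Proof.
move=> sS srho skap sB sw0 HV cC CV w00.
have sl0 := sm_laplace sw0; have skl := sm_mul skap sl0.
pose D := gdot (fun x => kappa x * laplace w0 x) S.
have sD : sm D := sm_gdot skl sS.
(* On S = 0 the cubic term contributes -6 kappa c |grad S|^4 to the derivative along grad S, and
   this must equal -D; [kappa] and [rho] are the inverses of [B2] and |grad S|^2. *)
pose c x := 6^-1 * (B2 x * (rho x * rho x)) * D x.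
have sc : sm c.
  exact: (sm_mul (sm_mul (sm_cst (6^-1 : R)) (sm_mul sB (sm_mul srho srho))) sD).
have scube := sm_cube_of sS sc.
pose w x := w0 x + cube_of S c x.
have sw : sm w := sm_add sw0 scube.
have sf : sm (fun x => kappa x * laplace w x) := sm_mul skap (sm_laplace sw).
have kl0 x : ~ C x -> kappa x * laplace w0 x = 0.
  by move=> nC; rewrite (laplace_supp cC w00 nC) mulr0.
have D0 x : ~ C x -> D x = 0.
  by move=> nC; rewrite /D /gdot (grad_supp cC kl0 nC) /dot big1 // => i _; rewrite mxE mul0r.
have c0 x : ~ C x -> c x = 0 by move=> /D0 d; rewrite /c d mulr0.
have w_0 x : ~ C x -> w x = 0.
  by move=> nC; rewrite /w w00 // /cube_of c0 // !mulr0 addr0.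
exists c, (fun x => kappa x * laplace w x); split.
- by [].
- by move=> x nC; split; [exact: c0|rewrite (laplace_supp cC w_0 nC) mulr0].
(* The factorisation is global: on [C] because kappa B2 = 1, off [C] because both sides vanish. *)
- move=> x; have [Cx|nC] := pselect (C x).
    by have [_ kB] := HV x (CV x Cx); rewrite mulrAC kB mul1r.
  by rewrite -/w (laplace_supp cC w_0 nC) mulr0 mul0r.
move=> y Cy S0; have [rG kB] := HV y (CV y Cy).
have [L0 LG] := laplace_cube_of sS sc S0.
have H (g0 g1 t u v : E) (a b : R) : g1 = a *: t + b *: u -> a = 0 -> u = v ->
    g0 + g1 = g0 + b *: v.
  by move=> -> -> ->; rewrite scale0r add0r.
have gE := gradM y skap (sm_laplace scube).
have -> : grad (fun x => kappa x * laplace w x) y =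
    grad (fun x => kappa x * laplace w0 x) y
    + kappa y *: ((- 6 * c y * gdot S S y) *: grad S y).
  apply: etrans (H _ _ _ _ _ _ _ gE L0 LG).
  rewrite -(gradD _ skl (sm_mul skap (sm_laplace scube))); congr (grad _ y).
  by apply/funext => x; rewrite -mulrDr -(laplaceD _ sw0 scube).
rewrite dotDl !dotZl.
rewrite -/(gdot S S y) -/(gdot _ S y) -/(D y) /c.
move: (D y) => d.
have -> : kappa y * (- 6 * (6^-1 * (B2 y * (rho y * rho y)) * d) * gdot S S y * gdot S S y) =
   - ((kappa y * B2 y) * (rho y * gdot S S y) * (rho y * gdot S S y) * d) by field.
by rewrite kB rG !mul1r subrr.
Qed.

End BoundaryJets.

(** * Prescribing the boundary data near a point *)

Section BoundaryData.
Context (R : realType).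
Local Notation E := 'rV[R]_3.
Local Notation sm := (smooth (@setT E)).
Variables (O : set E) (nu : E -> E).
Hypotheses (sO : smooth_boundary O)
  (nuO : forall y, bdry O y -> inward_normal O y (nu y)).
Implicit Types (f g h S rho r chi : E -> R) (W V C : set E) (x y p : E).

(* rho = |grad S|^-2 and r = |grad S| on W. *)
Definition boundary_data W S rho r :=
  [/\ [/\ sm S, sm rho & sm r],
      (forall x, W x -> [/\ bdry O x <-> S x = 0, rho x * gdot S S x = 1
        & r x * r x = gdot S S x])
    & forall x, W x -> bdry O x -> exists2 lam : R, lam * r x = 1 & nu x = lam *: grad S x].

Lemma boundary_data_exists p : bdry O p -> exists W S rho r,
  [/\ open W, W p & boundary_data W S rho r].
Proof.
move=> bp0; have [S [W [sS oW Wp WO Wnu]]] := boundary_defining_function sO nuO bp0.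
have sG : sm (gdot S S) := sm_gdot sS sS.
pose U := [set x | 0 < gdot S S x].
have oU : open U.
  rewrite (_ : U = gdot S S @^-1` [set z | 0 < z]) //; apply: open_comp.
    by move=> x _; exact: (sm_continuous sG).
  exact: open_gt.
have Up : U p.
  have [nn _ _] := nuO bp0; have [lam _ nE] := Wnu _ Wp bp0.
  rewrite /U /= lt0r; apply/andP; split; last first.
    by rewrite /gdot /dot sumr_ge0 // => i _; rewrite -expr2 sqr_ge0.
  apply/eqP => G0; move: nn; rewrite nE dotZl dotZr -/(gdot S S p) G0 !mulr0 => /esym/eqP.
  by rewrite oner_eq0.
have sGU : smooth U (gdot S S) by exact: (smooth_sub (@subsetT _ _) sG).
have U0 x : U x -> gdot S S x != 0 by move=> Ux; rewrite gt_eqF.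
have [rho [W1 [srho oW1 Wp1 E1]]] := smooth_localize oU Up (smooth_inv oU U0 sGU).
have [r [W2 [sr oW2 Wp2 E2]]] :=
  smooth_localize oU Up (smooth_sqrt oU (fun x (h : U x) => h) sGU).
exists (W `&` W1 `&` W2), S, rho, r; split.
- by apply: openI => //; exact: openI.
- by [].
split; first by [].
- move=> x [[Wx W1x] W2x]; have [Ux ->] := E1 _ W1x; have [_ ->] := E2 _ W2x; split.
  + by have [] := WO _ Wx.
  + by rewrite mulVf // U0.
  + by rewrite -expr2 sqr_sqrtr // ltW.
move=> x [[Wx W1x] W2x] bx; have [lam lam0 nE] := Wnu _ Wx bx.
have [Ux rE] := E2 _ W2x; exists lam => //.
have [nn _ _] := nuO bx.
rewrite nE dotZl dotZr -/(gdot S S x) in nn.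
have rr : r x * r x = gdot S S x by rewrite rE -expr2 sqr_sqrtr // ltW.
have r0 : 0 < r x by rewrite rE sqrtr_gt0.
have : (lam * r x) ^+ 2 = 1 by rewrite -nn -rr; ring.
move/eqP; rewrite sqrp_eq1; first by move/eqP.
by rewrite mulr_ge0 // ltW.
Qed.

Lemma neumann_of_gdot W S rho r C f : boundary_data W S rho r -> closed C -> C `<=` W ->
  (forall x, ~ C x -> f x = 0) ->
  (forall y, C y -> S y = 0 -> dot (grad f y) (grad S y) = 0) -> neumann O nu f.
Proof.
move=> [_ WB Wnu] cC CW f0 Hf y by'; have [Cy|nC] := pselect (C y).
  have [lam _ ->] := Wnu _ (CW _ Cy) by'; have [bS _ _] := WB _ (CW _ Cy).
  by rewrite dotZr Hf ?mulr0 //; exact/bS.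
by rewrite (grad_supp cC f0 nC) /dot big1 // => i _; rewrite mxE mul0r.
Qed.

Lemma grad_mul_defining S f y : sm S -> sm f -> S y = 0 ->
  grad (fun x => S x * f x) y = f y *: grad S y.
Proof.
move=> sS sf S0; apply: etrans (gradM y sS sf) _.
have H (a b : R) (u v : E) : b = 0 -> a *: u + b *: v = a *: u.
  by move=> ->; rewrite scale0r addr0.
exact: H.
Qed.

(** Subtracting S rho (grad g . grad S) removes the normal component of grad g on S = 0 and keeps
    the tangential part. *)
Lemma neumann_projection W S rho r C g : boundary_data W S rho r -> closed C -> C `<=` W ->
  sm g -> (forall x, ~ C x -> g x = 0) ->
  exists h, [/\ sm h, neumann O nu h &
    forall y, S y = 0 -> grad h y = grad g y - (rho y * gdot g S y) *: grad S y].
Proof.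
move=> WB cC CW sg g0; have [[sS srho sr] WE Wnu] := WB.
have sd := sm_mul srho (sm_gdot sg sS); have sSd := sm_mul sS sd.
have gE y : S y = 0 -> grad (fun x => g x - S x * (rho x * gdot g S x)) y =
    grad g y - (rho y * gdot g S y) *: grad S y.
  move=> S0; apply: etrans (gradB y sg sSd) _; congr (_ - _).
  exact: (grad_mul_defining sS sd S0).
exists (fun x => g x - S x * (rho x * gdot g S x)); split.
- exact: (sm_sub sg sSd).
- apply: (neumann_of_gdot WB cC CW).
    move=> x nC; rewrite g0 // /gdot (grad_supp cC g0 nC).
    by rewrite /dot big1 ?mulr0 ?subr0 // => i _; rewrite mxE mul0r.
  move=> y Cy S0; rewrite (gE y S0); have [_ rG _] := WE _ (CW _ Cy).
  rewrite dotDl -scaleNr dotZl -/(gdot g S y) -/(gdot S S y).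
  move: (gdot g S y) => a.
  by rewrite mulNr mulrAC rG mul1r subrr.
exact: gE.
Qed.

End BoundaryData.

(** * A nowhere vanishing Coulomb field near a boundary point *)

Section NeumannFrame.
Context (R : realType).
Local Notation E := 'rV[R]_3.
Local Notation sm := (smooth (@setT E)).
Variables (O : set E) (nu : E -> E).
Implicit Types (f g h S rho r chi : E -> R) (W V C : set E) (x y p : E).

Lemma grad_dot u x : grad (fun y : E => dot y u) x = u.
Proof.
have sx j : sm (fun y : E => y 0 j * u 0 j : R) by exact: (sm_mul (sm_coord R j) (sm_cst (u 0 j : R))).
apply/rowP => i; rewrite mxE; apply: etrans (partial_sum i x sx) _.
rewrite (bigD1 i) //= big1 => [|j ji].
  rewrite (partialM _ _ (sm_coord R i) (sm_cst (u 0 i : R))) partial_coord partial_cst eqxx.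
  by rewrite mul1r mulr0 !addr0.
rewrite (partialM _ _ (sm_coord R j) (sm_cst (u 0 j : R))) partial_coord partial_cst.
by rewrite eq_sym (negPf ji) mul0r mulr0 addr0.
Qed.

Lemma sm_dot u : sm (fun y : E => dot y u : R).
Proof. exact: (sm_sum (fun j => sm_mul (sm_coord R j) (sm_cst (u 0 j : R)))). Qed.

Lemma grad_near f g U x : open U -> U x -> (forall y, U y -> f y = g y) -> grad f x = grad g x.
Proof. by move=> oU Ux fg; apply/rowP => i; rewrite !mxE; exact: (partial_near _ oU Ux fg). Qed.

Lemma dot_self_eq0 (u : E) : dot u u = 0 -> u = 0.
Proof.
move=> /eqP; rewrite /dot psumr_eq0 => [/allP H|i _]; last by rewrite -expr2 sqr_ge0.
apply/rowP => i; rewrite mxE; apply/eqP.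
by have := H i (mem_index_enum _); rewrite mulf_eq0 orbb.
Qed.

(** Two linear functions, cut off and made Neumann, have gradients u - a n and v - b n at [p], where
    n = grad S. By the choice of u, v the cross product is nonzero at [p], hence nearby; [kappa] is
    the inverse of its squared length. *)
Lemma neumann_frame W S rho r p : open W -> W p -> boundary_data O nu W S rho r -> bdry O p ->
  exists (f g kappa : E -> R) V, [/\ [/\ sm f, sm g & sm kappa], neumann O nu f, neumann O nu g,
    [/\ open V, V p & V `<=` W]
  & forall x, V x -> kappa x * (\sum_(i < 3) gcross f g i x ^+ 2) = 1].
Proof.
move=> oW Wp WB bp; have [_ WE _] := WB; have [bS rG _] := WE _ Wp.
have S0 : S p = 0 by exact/bS.
have n0 : grad S p != 0.
  apply/eqP => g0; move: rG; rewrite /gdot g0 /dot big1 => [|i _]; last by rewrite mxE mul0r.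
  by rewrite mulr0 => /esym/eqP; rewrite oner_eq0.
have [u [v uv]] := exists_frame n0.
have [chi [C [W1 [schi [cC CW] chi0 [oW1 Wp1] chi1]]]] := bump_exists oW Wp.
have sg w : sm (fun x => chi x * dot x w) := sm_mul schi (sm_dot w).
have g0 w x : ~ C x -> chi x * dot x w = 0 by move=> nC; rewrite chi0 // mul0r.
have gg w : grad (fun x => chi x * dot x w) p = w.
  rewrite -[RHS](grad_dot w p); apply: (grad_near oW1 Wp1) => y Wy.
  by rewrite chi1 // mul1r.
have [f [sf nf Ef]] := neumann_projection WB cC CW (sg u) (g0 u).
have [g [sg' ng Eg]] := neumann_projection WB cC CW (sg v) (g0 v).
pose B2 x := \sum_(i < 3) gcross f g i x ^+ 2.
have sB : sm B2.
  apply: (smooth_ext openT _ (sm_sum (fun i => sm_mul (sm_gcross i sf sg') (sm_gcross i sf sg')))) => x _.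
  by apply: eq_bigr => i _; rewrite expr2.
have Bp : B2 p != 0.
  have := Ef p S0; have := Eg p S0; rewrite !gg => gE fE.
  apply/eqP => B0; move: (uv (rho p * gdot (fun x => chi x * dot x u) S p)
    (rho p * gdot (fun x => chi x * dot x v) S p)).
  rewrite -fE -gE.
  have -> : cross (grad f p) (grad g p) = 0.
    by apply: dot_self_eq0; rewrite -B0; apply: eq_bigr => i _; rewrite expr2.
  by rewrite /dot big1 ?eqxx // => i _; rewrite mxE mul0r.
pose U := [set x | B2 x != 0].
have oU : open U.
  rewrite (_ : U = B2 @^-1` [set z | z != 0]) //; apply: open_comp.
    by move=> x _; exact: (sm_continuous sB).
  exact: open_neq.
have [kap [V [skap oV Vp EV]]] :=
  smooth_localize oU Bp (smooth_inv oU (fun x (h : U x) => h) (smooth_sub (@subsetT _ _) sB)).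
exists f, g, kap, (W `&` V); split.
- by [].
- by [].
- by [].
- split.
  + exact: openI.
  + by [].
  + by move=> x [].
by move=> x [_ Vx]; have [Ux ->] := EV _ Vx; rewrite mulVf.
Qed.

End NeumannFrame.

(** * A single bracket with prescribed boundary data *)

Section BoundaryPatch.
Context (R : realType) (n : nat).
Local Notation E := 'rV[R]_3.
Local Notation M := 'M[R]_n.+1.
Local Notation sm := (smooth (@setT E)).
Variables (O : set E) (nu : E -> E) (K : set M) (s : nat).
Hypotheses (oO : open O) (bO : bounded_set O) (sO : smooth_boundary O)
  (nuO : forall y, bdry O y -> inward_normal O y (nu y)).
Hypotheses (gK : matrix_group K) (cK : compact K).
Local Notation k := (lie_algebra K).
Local Notation smooth_L0 := (L0 O k s `&` [set g | smooth_on (closure O) g]).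
Implicit Types (f g h S rho r chi : E -> R) (W V C : set E) (x y p : E) (a b : M).

(* w = S theta with a cubic correction making kappa * laplace w a Neumann function. *)
Lemma L0_element W S rho r (f g kappa theta : E -> R) V C :
  boundary_data O nu W S rho r -> sm f -> sm g -> sm kappa -> neumann O nu f -> neumann O nu g ->
  V `<=` W -> (forall x, V x -> kappa x * (\sum_(i < 3) gcross f g i x ^+ 2) = 1) ->
  closed C -> C `<=` V -> sm theta -> (forall x, ~ C x -> theta x = 0) ->
  exists c, [/\ sm c, (forall x, ~ C x -> c x = 0) &
    forall a b, k a -> k b ->
      smooth_L0 (fun x => (S x * theta x + cube_of S c x) *: lieb a b)].
Proof.
move=> WB sf sg skap nf ng VW EV cC CV sth th0; have [[sS srho sr] WE _] := WB.
have sB : sm (fun x => \sum_(i < 3) gcross f g i x ^+ 2).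
  apply: (smooth_ext openT _ (sm_sum (fun i => sm_mul (sm_gcross i sf sg) (sm_gcross i sf sg)))) => x _.
  by apply: eq_bigr => i _; rewrite expr2.
have sw0 := sm_mul sS sth.
have w00 x : ~ C x -> S x * theta x = 0 by move=> nC; rewrite th0 // mulr0.
have HV x : V x -> rho x * gdot S S x = 1 /\ kappa x * (\sum_(i < 3) gcross f g i x ^+ 2) = 1.
  by move=> Vx; split; [have [] := WE _ (VW _ Vx)|exact: EV].
have [c [h [[sc sh] ch0 Hlap Hn]]] := neumann_correction sS srho skap sB sw0 HV cC CV w00.
have CW x : C x -> W x by move=> /CV/VW.
exists c; split.
- exact: sc.
- by move=> x /ch0[].
move=> a b ka kb.
apply: (L0_generator s oO bO nuO gK cK sf sg sh (sm_add sw0 (sm_cube_of sS sc)) nf ng _ _ _ ka kb).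
- apply: (neumann_of_gdot WB cC CW) Hn.
  by move=> x /ch0[].
- move=> y by'; have [Cy|nC] := pselect (C y).
    have [bS _ _] := WE _ (CW _ Cy).
    by rewrite /cube_of (iffLR bS by') !mul0r addr0.
  by rewrite w00 // /cube_of (ch0 _ nC).1 !mulr0 addr0.
by move=> x _; exact: Hlap.
Qed.

Lemma lieb_scale (c d : R) a b : lieb (c *: a) (d *: b) = (c * d) *: lieb a b.
Proof. by rewrite /lieb -!scalemxAl -!scalemxAr !scalerA [d * c]mulrC scalerBr. Qed.

(** Bracket of a corrected S^2 th and a corrected S chi. The scalar data [eta] are carried by the
    first factor alone; the second is a fixed cutoff. *)
Lemma boundary_patch p : bdry O p -> exists V, [/\ open V, V p &
  forall eta : E -> R, sm eta -> (forall x, ~ V x -> eta x = 0) ->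
  forall a b a' b', k a -> k b -> k a' -> k b' ->
  exists u : E -> R, [/\ sm u,
    pointwise_brackets smooth_L0 (fun x => u x *: lieb (lieb a b) (lieb a' b')) &
    forall y, bdry O y -> laplace u y = 0 /\ dot (nu y) (grad (laplace u) y) = eta y]].
Proof.
move=> bp; have [W [S [rho [r [oW Wp WB]]]]] := boundary_data_exists sO nuO bp.
have [f [g [kap [V [[sf sg skap] nf ng [oV Vp VW] EV]]]]] := neumann_frame oW Wp WB bp.
(* The patch is the set [V4] on which [chi] = 1, so that eta chi = eta. *)
have [chi [C [V4 [schi [cC CV] chi0 [oV4 V4p] chi1]]]] := bump_exists oV Vp.
exists V4; split.
- exact: oV4.
- exact: V4p.
move=> eta seta eta0 a b a' b' ka kb ka' kb'; have [[sS srho sr] WE Wnu] := WB.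
have etaC x : ~ C x -> eta x = 0.
  move=> nC; apply: eta0 => Vx; move: (chi0 _ nC); rewrite chi1 // => /eqP.
  by rewrite oner_eq0.
have etachi x : eta x * chi x = eta x.
  by have [/chi1 ->|/eta0 ->] := pselect (V4 x); rewrite ?mulr1 ?mul0r.
(* Solves -6 lam th chi |grad S|^4 = eta on the boundary, where nu = lam grad S, lam r = 1, rho
   |grad S|^2 = 1 and eta chi = eta. *)
pose th x := - 6^-1 * (rho x * rho x * (r x * eta x)).
have sth : sm th.
  exact: (sm_mul (sm_cst (- 6^-1 : R)) (sm_mul (sm_mul srho srho) (sm_mul sr seta))).
have sSth := sm_mul sS sth.
have Sth0 x : ~ C x -> S x * th x = 0 by move=> nC; rewrite /th etaC // !mulr0.
have [c1 [sc1 c10 L1]] := L0_element WB sf sg skap nf ng VW EV cC CV sSth Sth0.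
have [c2 [sc2 c20 L2]] := L0_element WB sf sg skap nf ng VW EV cC CV schi chi0.
(* The factors are S^2 (th + S c1) and S (chi + S^2 c2), so their product is S^3 c, with c = th chi
   on the boundary. *)
pose c x := (th x + S x * c1 x) * (chi x + S x * (S x * c2 x)).
have sc : sm c.
  exact: (sm_mul (sm_add sth (sm_mul sS sc1)) (sm_add schi (sm_mul sS (sm_mul sS sc2)))).
have c0 x : ~ C x -> cube_of S c x = 0.
  by move=> nC; rewrite /cube_of /c chi0 // c20 // !mulr0 addr0 !mulr0.
exists (cube_of S c); split.
- exact: (sm_cube_of sS sc).
- apply: lin_span_sub.
  exists (fun x => (S x * (S x * th x) + cube_of S c1 x) *: lieb a b),
    (fun x => (S x * chi x + cube_of S c2 x) *: lieb a' b'); split.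
  + exact: L1.
  + exact: L2.
  apply/funext => x; rewrite lieb_scale; congr (_ *: _).
  by rewrite /cube_of /c; ring.
move=> y by'; have [Cy|nC] := pselect (C y); last first.
  rewrite (laplace_supp cC c0 nC) (grad_supp cC (fun x => @laplace_supp _ C _ x cC c0) nC).
  by rewrite etaC // /dot big1 // => i _; rewrite mxE mulr0.
have Wy : W y by exact/VW/CV.
have [bS rG rr] := WE _ Wy; have S0 : S y = 0 by exact/bS.
have [L0 LG] := laplace_cube_of sS sc S0; split; first exact: L0.
have [lam lr ->] := Wnu _ Wy by'.
rewrite LG dotZl dotZr -/(gdot S S y) /c S0 !mul0r !addr0 /th.
rewrite -[RHS](etachi y).
have -> : lam * (-6 * (- 6^-1 * (rho y * rho y * (r y * eta y)) * chi y) * gdot S S y * gdot S S y)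
   = (rho y * gdot S S y) * (rho y * gdot S S y) * (lam * r y) * (eta y * chi y).
  by move: (gdot S S y) (rho y) (r y) (eta y) (chi y) => v1 v2 v3 v4 v5; field.
by rewrite rG lr !mul1r.
Qed.

End BoundaryPatch.

(** * Global solution *)

Section BoundaryOperator.
Context (R : realType) (n : nat).
Local Notation E := 'rV[R]_3.
Local Notation M := 'M[R]_n.+1.
Local Notation sm := (smooth (@setT E)).
Implicit Types (O : set E) (f g h : E -> R) (x y v : E).

Lemma is_derive_scale (V : normedModType R) f (c : V) x v : sm f ->
  is_derive x v (fun x => f x *: c) (dot v (grad f x) *: c).
Proof.
move=> sf; have [df Df] := smooth_derive x v sf.
have H : (fun h : R => h^-1 *: (f (h *: v + x) *: c - f x *: c)) @ 0^' --> dot v (grad f x) *: c.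
  rewrite (_ : (fun h : R => _) =
    (fun h : R => (h^-1 *: (f (h *: v + x) - f x)) *: c)); last first.
    by apply/funext => z; rewrite -scalerBl scalerA.
  by apply: cvgZr_tmp; rewrite -Df; exact: df.
by split; [apply/cvg_ex; exists (dot v (grad f x) *: c)|exact/cvg_lim].
Qed.

Lemma derive_sum_scale (V : normedModType R) m (u : 'I_m -> E -> R) (c : 'I_m -> V) x v :
  (forall j, sm (u j)) ->
  'D_v (fun x => \sum_j u j x *: c j) x = \sum_j dot v (grad (u j) x) *: c j.
Proof.
move=> su; have H := is_derive_sum (fun j => is_derive_scale (c j) x v (su j)).
rewrite -(@derive_val _ _ _ _ _ _ _ H); congr ('D_v _ x).
by apply/funext => z; rewrite fct_sumE.
Qed.

Lemma laplace_sum_scale m (u : 'I_m -> E -> R) (e : 'I_m -> M) x : (forall j, sm (u j)) ->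
  laplace (fun x => \sum_j u j x *: e j) x = \sum_j laplace (u j) x *: e j.
Proof.
move=> su.
have P (w : 'I_m -> E -> R) i y : (forall j, sm (w j)) ->
    partial i (fun x => \sum_j w j x *: e j) y = \sum_j partial i (w j) y *: e j.
  move=> sw; rewrite (partial_sum _ _ (fun j => sm_scale (e j) (sw j))).
  by apply: eq_bigr => j _; exact: partialZl.
rewrite /laplace.
have PP i : partial i (partial i (fun x => \sum_j u j x *: e j)) x =
    \sum_j partial i (partial i (u j)) x *: e j.
  rewrite -(P (fun j => partial i (u j)) i x (fun j => sm_partial i (su j))).
  by congr (partial i _ x); apply/funext => y; exact: P.
rewrite (eq_bigr _ (fun i _ => PP i)) exchange_big -sumrN; apply: eq_bigr => j _ /=.
by rewrite scaleNr scaler_suml.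
Qed.

Lemma boundary_value_continuous O (f : E -> M) y : closure O y -> {for y, continuous f} ->
  boundary_value O f y = f y.
Proof.
move=> cO cf; apply: cvg_lim; first exact: norm_hausdorff.
have PF : ProperFilter (within O (nbhs y)).
  split; last exact: within_filter.
  by move=> /cO[x [Ox]]; exact.
by apply: cvg_trans cf; apply: cvg_fmap2; exact: cvg_within.
Qed.

(** With [nu y] frozen, the derivative of the Laplacian is smooth on the whole space, so both
    boundary limits in [T0] are values at [y]. *)
Lemma T0_sum_scale O nu tau m (u : 'I_m -> E -> R) (e : 'I_m -> M) y :
  closure O y -> (forall j, sm (u j)) -> (forall j, laplace (u j) y = 0) ->
  T0 O nu tau (fun x => \sum_j u j x *: e j) y =
  \sum_j dot (nu y) (grad (laplace (u j)) y) *: e j.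
Proof.
move=> cO su l0; have sl j := sm_laplace (su j).
have LE : laplace (fun x => \sum_j u j x *: e j) = fun x => \sum_j laplace (u j) x *: e j.
  by apply/funext => x; exact: laplace_sum_scale.
have DE : (fun x => 'D_(nu y) (laplace (fun x => \sum_j u j x *: e j)) x) =
    fun x => \sum_j dot (nu y) (grad (laplace (u j)) x) *: e j.
  by apply/funext => x; rewrite LE; exact: derive_sum_scale.
have sd j : sm (fun x => dot (nu y) (grad (laplace (u j)) x)).
  apply: (smooth_ext openT _ (sm_sum (fun i => sm_mul (sm_cst (nu y 0 i : R)) (sm_partial i (sl j))))).
  by move=> x _; rewrite /dot; apply: eq_bigr => i _; rewrite !mxE.
rewrite /T0 DE LE !boundary_value_continuous //.
- rewrite [X in _ + _ *: X]big1 => [|j _]; last by rewrite l0 scale0r.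
  by rewrite scaler0 addr0.
- exact: (sm_continuous (sm_sum (fun j => sm_scale (e j) (sl j)))).
- exact: (sm_continuous (sm_sum (fun j => sm_scale (e j) (sd j)))).
Qed.

Lemma bdry_compact O : open O -> bounded_set O -> compact (bdry O).
Proof.
move=> oO bO; apply: bounded_closed_compact; last first.
  apply: closedI; first exact: closed_closure.
  by apply: open_closedC; exact: open_interior.
have [A [rA HA]] := bO; exists A; split => // B AB x [cx _].
have cl : closed [set z : E | `|z| <= B].
  apply: (@closed_comp _ _ (fun z : E => `|z|) [set t | t <= B]); last exact: closed_le.
  by move=> z _; exact: norm_continuous.
rewrite closureE in cx; apply: (cx [set z : E | `|z| <= B]); split; first exact: cl.
by move=> z Oz; exact: (HA B AB z Oz).
Qed.

End BoundaryOperator.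

(** * Superposition and partition of unity *)

Section GlobalSolution.
Context (R : realType) (n : nat).
Local Notation E := 'rV[R]_3.
Local Notation M := 'M[R]_n.+1.
Local Notation sm := (smooth (@setT E)).
Variables (O : set E) (nu : E -> E) (K : set M) (s : nat).
Hypotheses (oO : open O) (bO : bounded_set O) (sO : smooth_boundary O)
  (nuO : forall y, bdry O y -> inward_normal O y (nu y)).
Hypotheses (gK : matrix_group K) (cK : compact K) (ssK : semisimple_lie (lie_algebra K)).
Local Notation k := (lie_algebra K).
Local Notation smooth_L0 := (L0 O k s `&` [set g | smooth_on (closure O) g]).
Implicit Types (f g h chi psi : E -> R) (W V C : set E) (x y p : E) (A : M) (F H : E -> M).

(** Pairs of a solution and its boundary data: a span in the product space forms the same linear
    combinations of both. *)
Definition elementary_solution : set ((E -> M) * (E -> M)) :=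
  [set fH | exists (u : E -> R) e, [/\ sm u, fH.1 = (fun x => u x *: e),
    pointwise_brackets smooth_L0 fH.1 &
    forall y, bdry O y -> laplace u y = 0 /\
      fH.2 y = dot (nu y) (grad (laplace u) y) *: e]].

Definition solvable_data H := exists fH, lin_span elementary_solution fH /\
  forall y, bdry O y -> fH.2 y = H y.

(** [T0] is built from limits and is not linear on arbitrary functions. The combination is therefore
    first assembled as a sum with smooth scalar coefficients, and [T0] is evaluated once. *)
Lemma solvable_dataP tau H : solvable_data H -> exists f : E -> M, pointwise_brackets smooth_L0 f /\
  forall y, bdry O y -> T0 O nu tau f y = H y.
Proof.
move=> [_ [[m [c [a [aE ->]]]] HE]].
have [u [e ue]] : exists (u : 'I_m -> E -> R) (e : 'I_m -> M), forall j,
    [/\ sm (u j), (a j).1 = (fun x => u j x *: e j),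
    pointwise_brackets smooth_L0 (a j).1 &
    forall y, bdry O y -> laplace (u j) y = 0 /\
      (a j).2 y = dot (nu y) (grad (laplace (u j)) y) *: e j].
  have /choice[u /choice[e ue]] := aE.
  by exists u, e.
have su j : sm (u j) by have [] := ue j.
pose f x := \sum_j u j x *: (c j *: e j).
exists f; split.
  rewrite (_ : f = \sum_j c j *: (a j).1).
    by apply: lin_span_sum => j; apply: lin_spanZ; have [] := ue j.
  apply/funext => x; rewrite fct_sumE; apply: eq_bigr => j _.
  have [_ -> _ _] := ue j.
  by rewrite -[RHS]/(c j *: (u j x *: e j)) !scalerA mulrC.
move=> y by'; have [cy _] := by'.
have l0 j : laplace (u j) y = 0 by have [_ _ _ /(_ y by')[]] := ue j.
rewrite (T0_sum_scale _ _ _ cy su l0) -(HE y by') .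
rewrite (_ : (\sum_j c j *: a j).2 = \sum_j (c j *: a j).2); last first.
  by elim/big_ind2 : _ => // x1 x2 y1 y2 <- <-.
rewrite fct_sumE; apply: eq_bigr => j _.
have [_ _ _ /(_ y by')[_ aj]] := ue j.
by rewrite -[RHS]/(c j *: (a j).2 y) aj !scalerA mulrC.
Qed.

Lemma eq_solvable_data H1 H2 : (forall y, bdry O y -> H1 y = H2 y) ->
  solvable_data H1 -> solvable_data H2.
Proof. by move=> H12 [fH [sf e]]; exists fH; split=> // y by'; rewrite e // H12. Qed.

Lemma solvable_data0 : solvable_data (fun=> 0).
Proof. by exists 0; split; [exact: lin_span0|]. Qed.

Lemma solvable_dataD H1 H2 : solvable_data H1 -> solvable_data H2 ->
  solvable_data (fun y => H1 y + H2 y).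
Proof.
move=> [f1 [s1 e1]] [f2 [s2 e2]]; exists (f1 + f2); split; first exact: lin_spanD.
by move=> y by'; rewrite -e1 // -e2.
Qed.

Lemma solvable_dataZ c H : solvable_data H -> solvable_data (fun y => c *: H y).
Proof.
move=> [f [s1 e1]]; exists (c *: f); split; first exact: lin_spanZ.
by move=> y by'; rewrite -e1.
Qed.

Lemma solvable_data_sum m (H : 'I_m -> E -> M) : (forall j, solvable_data (H j)) ->
  solvable_data (fun y => \sum_j H j y).
Proof.
elim: m H => [|m IH] H sH.
  by apply: eq_solvable_data solvable_data0 => y _; rewrite big_ord0.
apply: eq_solvable_data (solvable_dataD (sH ord0) (IH _ (fun j => sH (lift ord0 j)))).
by move=> y _; rewrite big_ord_recl.
Qed.

(** For fixed [eta] the admissible [A] form a subspace, which contains the double commutators and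
    hence k. *)
Lemma solvable_patch p : bdry O p -> exists V, [/\ open V, V p &
  forall eta : E -> R, sm eta -> (forall x, ~ V x -> eta x = 0) ->
  forall A, k A -> solvable_data (fun y => eta y *: A)].
Proof.
move=> bp; have [V [oV Vp HV]] := boundary_patch s oO bO sO nuO gK cK bp.
exists V; split=> // eta seta eta0 A kA.
apply: (lin_span_min (T := [set A | solvable_data (fun y => eta y *: A)]) _ _ _ _
  (lie_double_commutators gK cK ssK kA)) => /=.
- move=> _ [a [b [a' [b' [ka kb ka' kb' ->]]]]].
  have [u [su pu Hu]] := HV eta seta eta0 a b a' b' ka kb ka' kb'.
  exists (fun x => u x *: lieb (lieb a b) (lieb a' b'),
          fun y => eta y *: lieb (lieb a b) (lieb a' b')); split=> //.
  apply: lin_span_sub; exists u, (lieb (lieb a b) (lieb a' b')); split=> //.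
  by move=> y by'; have [l0 dE] := Hu y by'; split; [exact: l0|rewrite dE].
- by apply: eq_solvable_data solvable_data0 => y _; rewrite scaler0.
- move=> a b sa sb; apply: eq_solvable_data (solvable_dataD sa sb) => y _.
  by rewrite scalerDr.
- move=> c a sa; apply: eq_solvable_data (solvable_dataZ c sa) => y _.
  by rewrite !scalerA mulrC.
Qed.

Variable F : E -> M.
Hypotheses (kF : forall y, bdry O y -> k (F y)) (sF : smooth_on (bdry O) F).

(** In a basis of k, a cut-off local extension of [F] has smooth scalar coordinates supported in the
    patch, and each is solved separately. The free factor [psi] makes room for the coefficients of
    the partition of unity. *)
Lemma solvable_local p : bdry O p -> exists (chi : E -> R) W, [/\ sm chi, open W, W p,
  (forall x, W x -> chi x = 1) &
  forall psi, sm psi -> solvable_data (fun y => (psi y * chi y) *: F y)].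
Proof.
move=> bp; have [V [oV Vp HV]] := solvable_patch bp.
have [U [G [oU Up sG FG]]] := sF bp.
have [N [b [q [kb HN]]]] := lie_coordinates gK cK.
have oUV : open (U `&` V) by exact: openI.
have [chi [C [W [schi [cC CUV] chi0 [oW Wp] chi1]]]] := bump_exists oUV (conj Up Vp).
have CU : C `<=` U by move=> x /CUV[].
have sc r c : sm (fun x => chi x * G x r c).
  exact: (sm_cutoff oU cC CU schi chi0 (smooth_coord r c oU sG)).
have sq i r c : sm (fun x => q i r c * (chi x * G x r c)) := sm_mul (sm_cst (q i r c : R)) (sc r c).
have sqq i : sm (fun x => \sum_r \sum_c q i r c * (chi x * G x r c)).
  exact: (sm_sum (fun r => sm_sum (fun c => sq i r c))).
exists chi, W; split=> // psi spsi.
have spq i := sm_mul spsi (sqq i).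
have s0 i x : ~ V x -> psi x * (\sum_r \sum_c q i r c * (chi x * G x r c)) = 0.
  move=> nV; have c0 : chi x = 0 by apply: chi0 => /CUV[].
  rewrite big1 ?mulr0 // => r _; rewrite big1 // => c _.
  by rewrite c0 mul0r mulr0.
apply: eq_solvable_data (solvable_data_sum (fun i => HV _ (spq i) (s0 i) _ (kb i))) => y by'.
have [Cy|nC] := pselect (C y); last first.
  rewrite chi0 // mulr0 scale0r big1 // => i _.
  rewrite big1 ?mulr0 ?scale0r // => r _; rewrite big1 // => c _.
  by rewrite mul0r mulr0.
rewrite [in RHS](HN _ (kF by')) scaler_sumr; apply: eq_bigr => i _.
rewrite scalerA -mulrA; congr ((_ * _) *: _).
rewrite mulr_sumr; apply: eq_bigr => r _; rewrite mulr_sumr; apply: eq_bigr => c _.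
by rewrite (FG _ (CU _ Cy) by') mulrCA.
Qed.

(* Partition of unity: 1 - prod (1 - chi_p) is a combination of the chi_p. *)
Lemma solvable_global : solvable_data F.
Proof.
have /choice[cW HcW] : forall p, exists cW : (E -> R) * set E, bdry O p ->
    [/\ sm cW.1, open cW.2, cW.2 p, (forall x, cW.2 x -> cW.1 x = 1) &
    forall psi, sm psi -> solvable_data (fun y => (psi y * cW.1 y) *: F y)].
  (* Off the boundary the pair is a dummy value; the cover is indexed by boundary points. *)
  move=> p; have [bp|nb] := pselect (bdry O p); last by exists (fun=> 0, set0).
  by have [chi [W HW]] := solvable_local bp; exists (chi, W).
have := bdry_compact oO bO; rewrite compact_cover => /(_ _ (bdry O) (fun p => (cW p).2)).
case.
- by move=> p /HcW[].
- by move=> p bp; exists p => //; have [] := HcW p bp.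
move=> D DO cD.
pose P (l : seq E) x := \prod_(p <- l) (1 - (cW p).1 x).
have HP (l : seq E) : (forall p, p \in l -> bdry O p) ->
    sm (P l) /\ solvable_data (fun y => (1 - P l y) *: F y).
  elim: l => [_|p l IH Hl].
    split; first by apply: (smooth_ext openT _ (sm_cst (1 : R))) => x _; rewrite /P big_nil.
    by apply: eq_solvable_data solvable_data0 => y _; rewrite /P big_nil subrr scale0r.
  have [sP dP] : sm (P l) /\ solvable_data (fun y => (1 - P l y) *: F y).
    by apply: IH => z zl; apply: Hl; rewrite inE zl orbT.
  have [schi _ _ _ Hchi] := HcW p (Hl p (mem_head _ _)).
  split.
    apply: (smooth_ext openT _ (sm_mul (sm_sub (sm_cst (1 : R)) schi) sP)) => x _.
    by rewrite /P big_cons.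
  (* 1 - (1 - chi) P = (1 - P) + P chi, with psi = P in the local solution at [p]. *)
  apply: eq_solvable_data (solvable_dataD dP (Hchi _ sP)) => y _.
  rewrite -scalerDl /P big_cons; congr (_ *: _).
  by ring.
have [|_] := HP (finmap.enum_fset D).
  by move=> p pD; have := DO p pD; rewrite inE.
apply: eq_solvable_data => y by'; have [p /= pD Wy] := cD y by'.
have bp : bdry O p by have := DO p pD; rewrite inE.
have [_ _ _ chi1 _] := HcW p bp.
(* [y] lies in a member of the cover whose cutoff is 1 there, so one factor of the product is
   zero. *)
suff -> : P (finmap.enum_fset D) y = 0 by rewrite subr0 scale1r.
by rewrite /P (big_rem p) //= chi1 // subrr mul0r.
Qed.

End GlobalSolution.

Theorem lemma7 (R : realType) (O : set 'rV[R]_3) (n : nat)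
    (K : set 'M[R]_n.+1) (k : nat)
    (nu : 'rV[R]_3 -> 'rV[R]_3) (tau : 'rV[R]_3 -> R)
    (F : 'rV[R]_3 -> 'M[R]_n.+1) :
  open O -> bounded_set O -> smooth_boundary O ->
  matrix_group K -> compact K -> semisimple_lie (lie_algebra K) ->
  3 / 2 + 1 < k%:R :> R ->
  (forall p, bdry O p -> inward_normal O p (nu p)) ->
  is_tau O tau ->
  (forall p, bdry O p -> lie_algebra K (F p)) ->
  smooth_on (bdry O) F ->
  exists f : 'rV[R]_3 -> 'M[R]_n.+1,
    pointwise_brackets
      (L0 O (lie_algebra K) k `&` [set g | smooth_on (closure O) g]) f /\
    (forall p, bdry O p -> T0 O nu tau f p = F p).
Proof.
move=> oO bO sO gK cK ssK _ nuO _ kF sF.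
exact: (solvable_dataP tau (solvable_global k oO bO sO nuO gK cK ssK kF sF)).
Qed.
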